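(* Let $S_1,S_2,\ldots\sim_{i.i.d.} f_s$ be locations in $\mathcal R$. For $i=1,\ldots,n$, let the exposures be generated as $X(S_i)=h(S_i)+\eta(S_i)\in\mathbb R^p$ with $h=(h_1,\ldots,h_p)^\top:\mathcal R\to\mathbb R^p$ a fixed continuous function, and let the outcomes be generated as $Y(S_i)=X(S_i)^\top\beta^*+g(S_i)+\epsilon(S_i)$ with $g:\mathcal R\to\mathbb R$ a fixed continuous function and $\beta^*\in\mathbb R^p$. Consider the generalized least squares estimator $$\hat\beta_{GLS}=(X^\top\Sigma^{-1}X)^{-1}X^\top\Sigma^{-1}Y,$$ using the working covariance matrix $\Sigma=K+\tau^2 I$, where $0<\tau^2<\infty$, $K_{ij}=K(S_i,S_j)$, and $K(\cdot,\cdot)$ is a stationary Matérn kernel with any fixed set of parameters (variance $0<\sigma^2<\infty$, spatial decay $0<\phi<\infty$, smoothness $0<\nu\le\infty$, where $\nu=\infty$ denotes the squared exponential kernel). Then $\hat\beta_{GLS}\to\beta^*$ in probability as $n\to\infty$.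
   Context: $\mathcal R\subset\mathbb R^d$ is a fixed convex and compact spatial domain, and $f_s$ is a probability density (with respect to Lebesgue measure) with support the whole of $\mathcal R$. $X$ is the $n\times p$ matrix with rows $X(S_1)^\top,\ldots,X(S_n)^\top$ and $Y=(Y(S_1),\ldots,Y(S_n))^\top$; $p$ and $\mathcal R$ are fixed as $n\to\infty$. Error assumptions: $\{\epsilon(s)\}_{s\in\mathcal R}$ are i.i.d. real random variables with $E(\epsilon(s))=0$, $\mathrm{var}(\epsilon(s))<\infty$; $\{\eta(s)\}_{s\in\mathcal R}$ are i.i.d. $\mathbb R^p$-valued random vectors with $E(\eta(s))=0$ and $\mathrm{var}(\eta(s))$ finite and strictly positive definite; the process $\epsilon(\cdot)$, the process $\eta(\cdot)$ and the locations $S_1,S_2,\ldots$ are mutually independent (so $\epsilon(\cdot)$ is independent of $X(\cdot)$). Since locations are almost surely distinct, this is understood to mean that $\epsilon(S_1),\epsilon(S_2),\ldots$ are i.i.d. with the law of $\epsilon(s)$, $\eta(S_1),\eta(S_2),\ldots$ are i.i.d. with the law of $\eta(s)$, and these two sequences and the sequence of locations are mutually independent. Matérn kernel: for $0<\nu<\infty$, $K(s,s')=\sigma^2\frac{2^{1-\nu}}{\Gamma(\nu)}(\phi\|s-s'\|)^\nu \mathcal K_\nu(\phi\|s-s'\|)$ for $s\ne s'$ and $K(s,s)=\sigma^2$, where $\mathcal K_\nu$ is the modified Bessel function of the second kind; for $\nu=\infty$, $K(s,s')=\sigma^2\exp(-\phi\|s-s'\|^2)$. On the event that $X^\top\Sigma^{-1}X$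 is singular, $\hat\beta_{GLS}$ may be assigned an arbitrary value. *)

(* Defs.v *)
From HB Require Import structures.
From mathcomp Require Import all_boot all_order all_algebra.
From mathcomp Require Import finmap.
From mathcomp Require Import all_classical all_reals all_analysis.

Set Implicit Arguments.
Unset Strict Implicit.
Unset Printing Implicit Defensive.

Import Order.TTheory GRing.Theory Num.Theory.
Import numFieldNormedType.Exports.

Local Open Scope classical_set_scope.
Local Open Scope ring_scope.

(* Matrices carry the sigma-algebra generated by their entries; over the reals
   this is the Borel sigma-algebra. *)
Definition measure_matrix_display : measure_display -> measure_display.
Proof. exact. Qed.

Section measurable_matrix.
Context {d : measure_display} {T : measurableType d} (m n : nat).

Definition matrix_entry_sets : set (set 'M[T]_(m, n)) :=
  [set A | exists (i : 'I_m) (j : 'I_n) (B : set T),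
     measurable B /\ A = [set M : 'M[T]_(m, n) | B (M i j)]].

Let matrix_set0 : <<s matrix_entry_sets >> set0.
Proof. exact: sigma_algebra0. Qed.

Let matrix_setC A :
  <<s matrix_entry_sets >> A -> <<s matrix_entry_sets >> (~` A).
Proof. exact: sigma_algebraC. Qed.

Let matrix_bigcup (F : _^nat) : (forall i, <<s matrix_entry_sets >> (F i)) ->
  <<s matrix_entry_sets >> (\bigcup_i F i).
Proof. exact: sigma_algebra_bigcup. Qed.

HB.instance Definition _ := @isMeasurable.Build (measure_matrix_display d)
  'M[T]_(m, n) <<s matrix_entry_sets >> matrix_set0 matrix_setC matrix_bigcup.

End measurable_matrix.

Lemma measurable_entry d (T : measurableType d) m n (i : 'I_m) (j : 'I_n) :
  measurable_fun [set: 'M[T]_(m, n)] (fun M : 'M[T]_(m, n) => M i j).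
Proof.
move=> _ B mB; rewrite setTI; apply: sub_sigma_algebra.
by exists i, j, B.
Qed.

Lemma measurable_fun_matrixP d d' (T : measurableType d)
    (T' : measurableType d') m n (f : T -> 'M[T']_(m, n)) :
  measurable_fun [set: T] f <->
  forall i j, measurable_fun [set: T] (fun x => f x i j).
Proof.
split=> [mf i j|mf]; first exact: measurableT_comp (measurable_entry i j) mf.
apply: measurability => //.
move=> _ [_ [i [j [B [mB ->]]]] <-].
exact: mf.
Qed.

(* The canonical instances on m1 \x m2 only infer the finite case. *)
Lemma product_sigma_finite d1 d2 (T1 : measurableType d1)
    (T2 : measurableType d2) (R : realType)
    (m1 : {sigma_finite_measure set T1 -> \bar R})
    (m2 : {sigma_finite_measure set T2 -> \bar R}) :
  sigma_finite setT (m1 \x m2)%E.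
Proof.
have /sigma_finiteP[F [TF ndF Foo]] := sigma_finiteT m1.
have /sigma_finiteP[G [TG ndG Goo]] := sigma_finiteT m2.
exists (fun n => F n `*` G n).
 rewrite -setXTT TF TG predeqE => -[x y]; split.
    move=> [/= [n _ Fnx] [k _ Gky]]; exists (maxn n k) => //; split.
    - by move: x Fnx; exact/subsetPset/ndF/leq_maxl.
    - by move: y Gky; exact/subsetPset/ndG/leq_maxr.
  by move=> [n _ []/= ? ?]; split; exists n.
move=> k; have [? ?] := Foo k; have [? ?] := Goo k.
split; first exact: measurableX.
by rewrite product_measure1E// lte_mul_pinfty// ge0_fin_numE.
Qed.

(* d-dimensional Lebesgue measure, by iterated products. *)
Section lebesgue_rV_step.
Context {R : realType} (n : nat).
Variable mu : {sigma_finite_measure set 'rV[R]_n -> \bar R}.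

Definition rV_cons (x : measurableTypeR R * 'rV[R]_n) : 'rV[R]_n.+1 :=
  \row_(j < n.+1) if unlift ord0 j is Some k then x.2 ord0 k else x.1.

Definition rV_uncons (v : 'rV[R]_n.+1) : measurableTypeR R * 'rV[R]_n :=
  (v ord0 ord0, \row_(k < n) v ord0 (lift ord0 k)).

Lemma rV_unconsK : cancel rV_uncons rV_cons.
Proof.
by move=> v; apply/rowP => j; rewrite mxE; case: unliftP => [k ->|->] //=; rewrite mxE.
Qed.

Lemma rV_consK : cancel rV_cons rV_uncons.
Proof.
move=> [x v]; rewrite /rV_uncons mxE unlift_none; congr pair.
by apply/rowP => k; rewrite !mxE liftK.
Qed.

Lemma measurable_rV_cons : measurable_fun setT rV_cons.
Proof.
apply/measurable_fun_matrixP => i j.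
rewrite (_ : (fun x => _) = fun x : measurableTypeR R * 'rV[R]_n =>
    if unlift ord0 j is Some k then x.2 ord0 k else x.1); last first.
  by apply/funext => x; rewrite mxE.
case: unliftP => [k _|_]; last exact: measurable_fst.
exact: measurableT_comp (measurable_entry (T := R) _ _) measurable_snd.
Qed.

Lemma measurable_rV_uncons : measurable_fun setT rV_uncons.
Proof.
have h0 : measurable_fun setT (fun v : 'rV[R]_n.+1 => v ord0 ord0).
  exact: (measurable_entry (T := R)).
apply: (measurable_fun_pair h0).
apply/measurable_fun_matrixP => i j.
rewrite (_ : (fun x => _) = fun x : 'rV[R]_n.+1 => x ord0 (lift ord0 j)).
  exact: (measurable_entry (T := R)).
by apply/funext => x; rewrite mxE.
Qed.

Definition lebesgue_rV_step : set 'rV[R]_n.+1 -> \bar R :=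
  pushforward (lebesgue_measure \x mu)%E rV_cons.

Let measurable_preimage_cons A :
  measurable A -> measurable (rV_cons @^-1` A).
Proof. by move=> mA; rewrite -[X in measurable X]setTI; exact: measurable_rV_cons. Qed.

Let step0 : lebesgue_rV_step set0 = 0%E.
Proof. by rewrite /lebesgue_rV_step /pushforward preimage_set0 measure0. Qed.

Let step_ge0 A : (0 <= lebesgue_rV_step A)%E.
Proof. by rewrite /lebesgue_rV_step /pushforward. Qed.

Let step_sigma_additive : semi_sigma_additive lebesgue_rV_step.
Proof.
move=> F mF tF mUF; rewrite /lebesgue_rV_step /pushforward preimage_bigcup.
apply: measure_semi_sigma_additive.
- by move=> i; exact: measurable_preimage_cons.
- apply/trivIsetP => /= i j _ _ ij; rewrite -preimage_setI.
  by move/trivIsetP : tF => /(_ _ _ _ _ ij) ->//; rewrite preimage_set0.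
- by rewrite -preimage_bigcup; exact: measurable_preimage_cons.
Qed.

HB.instance Definition _ := isMeasure.Build _ _ _ lebesgue_rV_step
  step0 step_ge0 step_sigma_additive.

Let step_sigma_finite : sigma_finite setT lebesgue_rV_step.
Proof.
have [F F_cover F_fin] := product_sigma_finite (@lebesgue_measure R) mu.
have FE i : rV_cons @^-1` (rV_uncons @^-1` F i) = F i.
  by rewrite -comp_preimage; apply/seteqP; split=> x /=; rewrite rV_consK.
exists (fun i => rV_uncons @^-1` F i).
  by rewrite -preimage_bigcup -F_cover preimage_setT.
move=> i; have [mFi Fi_fin] := F_fin i; split; last first.
  by rewrite /lebesgue_rV_step /pushforward FE.
by rewrite -[X in measurable X]setTI; exact: measurable_rV_uncons.
Qed.

HB.instance Definition _ := Measure_isSigmaFinite.Build _ _ _ lebesgue_rV_step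
  step_sigma_finite.

End lebesgue_rV_step.

Fixpoint lebesgue_rV {R : realType} (d : nat) :
    {sigma_finite_measure set 'rV[R]_d -> \bar R} :=
  if d is n.+1 then lebesgue_rV_step (lebesgue_rV n) else \d_(0 : 'rV[R]_0).

(* Euclidean norm: `|_| on matrices is the sup norm. *)
Definition enorm {R : realType} m n (A : 'M[R]_(m, n)) : R :=
  Num.sqrt (\sum_i \sum_j A i j ^+ 2).

Definition gamma_fun {R : realType} (x : R) : R :=
  \int[lebesgue_measure]_(t in `]0%R, +oo[) (t `^ (x - 1) * expR (- t)).

Definition cosh {R : realType} (x : R) : R := (expR x + expR (- x)) / 2.

(* Modified Bessel function of the second kind, for x > 0, as the integral
   K_nu(x) = int_0^oo exp(- x cosh t) cosh(nu t) dt. *)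
Definition besselK {R : realType} (nu x : R) : R :=
  \int[lebesgue_measure]_(t in `[0%R, +oo[)
    (expR (- x * cosh t) * cosh (nu * t)).

(* nu = +oo is the squared exponential kernel; nu = -oo is a junk case. *)
Definition matern {R : realType} d (sigma2 phi : R) (nu : \bar R)
    (s s' : 'rV[R]_d) : R :=
  match nu with
  | nu%:E =>
      if s == s' then sigma2
      else sigma2 * (2 `^ (1 - nu) / gamma_fun nu)
           * (phi * enorm (s - s')) `^ nu * besselK nu (phi * enorm (s - s'))
  | +oo%E => sigma2 * expR (- phi * enorm (s - s') ^+ 2)
  | -oo%E => 0
  end.

Section probability.
Context {dO : measure_display} {Omega : measurableType dO} {R : realType}.
Variable P : probability Omega R.

Definition mutually_independent (I : choiceType) (F : I -> set (set Omega)) :=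
  forall (J : {fset I}) (A : I -> set Omega),
    (forall i, i \in J -> F i (A i)) ->
    P (\bigcap_(i in [set` J]) A i) = (\prod_(i <- J) fine (P (A i)))%:E.

Definition sigma_of d' (T : measurableType d') (X : Omega -> T) :
    set (set Omega) :=
  preimage_set_system setT X measurable.

Definition sigma_of_seq d' (T : measurableType d') (X : nat -> Omega -> T) :
    set (set Omega) :=
  <<s \bigcup_i sigma_of (X i) >>.

Definition iid d' (T : measurableType d') (X : nat -> {RV P >-> T}) :=
  mutually_independent (fun i => sigma_of (X i)) /\
  (forall i j A, measurable A -> distribution P (X i) A = distribution P (X j) A).

Definition independent_seq3 d1 d2 d3 (T1 : measurableType d1)
    (T2 : measurableType d2) (T3 : measurableType d3)
    (X : nat -> Omega -> T1) (Y : nat -> Omega -> T2) (Z : nat -> Omega -> T3) :=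
  forall A B C,
    sigma_of_seq X A -> sigma_of_seq Y B -> sigma_of_seq Z C ->
    P (A `&` B `&` C) = (P A * P B * P C)%E.

Definition has_density n (X : {RV P >-> 'rV[R]_n}) (f : 'rV[R]_n -> R) :=
  forall A, measurable A ->
    distribution P X A = (\int[lebesgue_rV n]_(s in A) (f s)%:E)%E.

Definition covmx p (V : Omega -> 'cV[R]_p) : 'M[R]_p :=
  \matrix_(k, l)
    fine (covariance P (fun w => V w k ord0) (fun w => V w l ord0)).

Definition cvg_in_probability p (V : nat -> Omega -> 'cV[R]_p) (v : 'cV[R]_p) :=
  forall e : R, 0 < e ->
    P [set w | e < enorm (V n w - v)] @[n --> \oo] --> 0%E.

End probability.

Definition is_density {R : realType} n (f : 'rV[R]_n -> R) :=
  [/\ measurable_fun setT f, (forall s, 0 <= f s)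
    & (\int[lebesgue_rV n]_s (f s)%:E = 1)%E].

Definition posdef {R : realType} p (A : 'M[R]_p) :=
  forall u : 'cV[R]_p, u != 0 -> 0 < (u^T *m A *m u) ord0 ord0.

Definition design_mx {R : realType} n p (X : nat -> 'cV[R]_p) : 'M[R]_(n, p) :=
  \matrix_(i, j) X i j ord0.

Definition response {R : realType} n (Y : nat -> R) : 'cV[R]_n :=
  \col_(i < n) Y i.

Definition working_cov {R : realType} n d (K : 'rV[R]_d -> 'rV[R]_d -> R)
    (tau2 : R) (S : nat -> 'rV[R]_d) : 'M[R]_n :=
  \matrix_(i, j) K (S i) (S j) + tau2%:M.

(* Meaningful when X^T Sigma^-1 X is invertible: invmx is the identity on
   singular matrices. *)
Definition gls {R : realType} n p (X : 'M[R]_(n, p)) (Sigma : 'M[R]_n)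
    (Y : 'cV[R]_n) : 'cV[R]_p :=
  invmx (X^T *m invmx Sigma *m X) *m X^T *m invmx Sigma *m Y.

(* Main.v *)
(* Put Q = (K + tau^2 I)^-1. The Matern kernel is a scale mixture of Gaussian
   kernels: extending the Bessel integral to the whole line and shifting t,
     matern(r) = (sigma^2 / Z) \int w(t) expR (- phi^2 r^2 e^-t / 2) dt,
     w(t) = expR (nu t - e^t / 2).
   Expanding the Gaussian kernels into monomials shows that products of a fixed
   positive function with polynomials have finite norm in the reproducing kernel
   space of K, so this space is uniformly dense in the continuous functions on
   the compact domain. As tau^2 f^T Q f <= |f|^2 and f^T Q f <= ||f||_K^2, every
   continuous g satisfies g^T Q g = o(n) along the sampled locations: the smooth
   parts of X and Y are asymptotically annihilated.

   Writing E for the matrix of the eta(S_i), the error of the estimator is then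
   controlled by E^T Q E and E^T Q eps. The cross term is o(n) by Chebyshev,
   because Q depends on the locations only and its squared Frobenius norm is at
   most n / tau^4. For the lower bound on E^T Q E, Cauchy-Schwarz gives
     |E u|^4 <= (E u)^T Q (E u) * (E u)^T (K + tau^2 I) (E u),
   and the last factor has expectation (sigma^2 + tau^2) tr(V) n |u|^2 at most,
   since the off-diagonal terms of K vanish in expectation. *)
From HB Require Import structures.
Require Import Defs.
From mathcomp Require Import all_boot all_order all_algebra.
From mathcomp Require Import finmap ring lra.
From mathcomp Require Import all_classical all_reals all_analysis measurable_realfun.

Import Order.TTheory GRing.Theory Num.Theory.
Import numFieldNormedType.Exports.

Local Open Scope classical_set_scope.
Local Open Scope ring_scope.

Set Implicit Arguments.
Unset Strict Implicit.
Unset Printing Implicit Defensive.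

(** * Finite integrals *)

(** The obstacle is that [Q] is not bounded below by a fixed multiple of the identity: eigenvalues
    of [K] can be of order n, and [Q] damps the corresponding directions. No limit of [X^T Q X / n]
    is identified. A lower bound is enough, and duality with [K + tau^2 I] turns it into an upper
    bound on a first moment.

    Deterministic and random arguments are kept apart. A tolerance [rho], depending neither on n nor
    on the sample, is fixed so that perturbations below it move the estimator by at most e. The
    smooth parts meet this tolerance for every configuration of locations in the domain once n is
    large, so probability enters only through finitely many bad events about the errors, handled by
    Markov and Chebyshev. Because the errors have second moments only, the lower bound on [E^T E]
    needs a truncation.

    The mixing scale is restricted to a range bounded away from 0 and infinity. This keeps the
    constants in the monomial expansions uniform over the mixture. *)

Section has_integral.
Context {d : measure_display} {T : measurableType d} {R : realType}.
Variables (mu : {measure set T -> \bar R}) (D : set T).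
Hypothesis mD : measurable D.
Implicit Types (f g : T -> R) (a b : R).

(** Integrability travels with a real value, so that the linearity, comparison and product rules
    compose without side conditions in the extended reals. *)
Definition has_integral f a :=
  mu.-integrable D (EFin \o f) /\ (\int[mu]_(x in D) (f x)%:E = a%:E)%E.

Lemma integrable_has_integral f : mu.-integrable D (EFin \o f) ->
  has_integral f (fine (\int[mu]_(x in D) (f x)%:E)%E).
Proof. by move=> fi; split=> //; rewrite fineK//; exact: integrable_fin_num fi. Qed.

Lemma has_integral_measurable f a : has_integral f a -> measurable_fun D f.
Proof. by case=> /(measurable_int mu) /measurable_EFinP. Qed.

Lemma has_integral_uniq f a b : has_integral f a -> has_integral f b -> a = b.
Proof. by move=> [_ fa] [_]; rewrite fa => -[]. Qed.

Lemma has_integral_eq f g a : {in D, f =1 g} -> has_integral f a ->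
  has_integral g a.
Proof.
move=> fg [fi fa]; split; last by rewrite -fa; apply: eq_integral => x /fg ->.
by apply: eq_integrable fi => // x xD /=; rewrite fg.
Qed.

Lemma has_integral0 : has_integral (fun=> 0) 0.
Proof. by split; [exact: integrable0|rewrite integral0]. Qed.

Lemma has_integralD f g a b : has_integral f a -> has_integral g b ->
  has_integral (fun x => f x + g x) (a + b).
Proof.
move=> [fi fa] [gi gb]; split; first exact: (integrableD mD fi gi).
under eq_integral do rewrite EFinD.
by rewrite integralD// fa gb.
Qed.

Lemma has_integralZl k f a : has_integral f a ->
  has_integral (fun x => k * f x) (k * a).
Proof.
move=> [fi fa]; split; first exact: (integrableZl mD k fi).
under eq_integral do rewrite EFinM.
by rewrite integralZl// fa.
Qed.

Lemma has_integral_sum (I : Type) (r : seq I) (Q : pred I) (f : I -> T -> R)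
    (a : I -> R) : (forall i, Q i -> has_integral (f i) (a i)) ->
  has_integral (fun x => \sum_(i <- r | Q i) f i x) (\sum_(i <- r | Q i) a i).
Proof.
move=> fa; elim: r => [|i r ih].
  rewrite big_nil; apply: has_integral_eq has_integral0 => x _.
  by rewrite big_nil.
rewrite big_cons; case: ifPn => Qi.
  apply: has_integral_eq (has_integralD (fa _ Qi) ih) => x _.
  by rewrite big_cons Qi.
by apply: has_integral_eq ih => x _; rewrite big_cons (negbTE Qi).
Qed.

Lemma has_integral_le f g a b : (forall x, D x -> f x <= g x) ->
  has_integral f a -> has_integral g b -> a <= b.
Proof.
move=> fg [fi fa] [gi gb]; rewrite -lee_fin -fa -gb.
by apply: le_integral => // x xD; rewrite lee_fin fg// -inE.
Qed.

Lemma has_integral_ge0 f a : (forall x, D x -> 0 <= f x) -> has_integral f a ->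
  0 <= a.
Proof. by move=> f0; apply: has_integral_le f0 has_integral0. Qed.

Lemma dominated_has_integral f g b : measurable_fun D f ->
  (forall x, D x -> `|f x| <= g x) -> has_integral g b ->
  exists2 a, has_integral f a & `|a| <= b.
Proof.
move=> mf fg gb; have fi : mu.-integrable D (EFin \o f).
  apply: le_integrable gb.1 => //; first exact/measurable_EFinP.
  by move=> x Dx /=; rewrite lee_fin (le_trans (fg _ Dx))// ler_norm.
have fa := integrable_has_integral fi; eexists; first exact: fa.
rewrite ler_norml -[- b]mulN1r.
rewrite (has_integral_le _ (has_integralZl (-1) gb) fa) /=; last first.
  by move=> x Dx; rewrite mulN1r; have := fg _ Dx; rewrite ler_norml => /andP[].
rewrite (has_integral_le _ fa gb)// => x Dx.
exact: le_trans (ler_norm _) (fg _ Dx).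
Qed.

(** The integral of [m (l - f)^2] is a quadratic polynomial in [l] that is never negative; the
    inequality is its discriminant condition. *)
Lemma has_integral_cauchy_schwarz (m f : T -> R) m0 a b :
  (forall x, D x -> 0 <= m x) -> has_integral m m0 ->
  has_integral (fun x => m x * f x) a ->
  has_integral (fun x => m x * f x ^+ 2) b ->
  a ^+ 2 <= m0 * b.
Proof.
move=> m_ge0 mm mf mff.
have key l : 0 <= l ^+ 2 * m0 - 2 * l * a + b.
  apply: (@has_integral_ge0 (fun x => l ^+ 2 * m x - 2 * l * (m x * f x)
    + m x * f x ^+ 2)) => [x Dx|].
    rewrite (_ : _ + _ = m x * (l - f x) ^+ 2); last by ring.
    by rewrite mulr_ge0 ?m_ge0 ?sqr_ge0.
  apply: has_integralD => //; apply: has_integralD; first exact: has_integralZl.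
  rewrite -mulNr; apply: has_integral_eq (has_integralZl (- (2 * l)) mf).
  by move=> x _; rewrite mulNr.
have m0_ge0 := has_integral_ge0 m_ge0 mm.
have b_ge0 : 0 <= b by have := key 0; rewrite expr0n/= mulr0 !mul0r subr0 add0r.
have [m00|m0_neq0] := eqVneq m0 0; last first.
  have m0_gt0 : 0 < m0 by rewrite lt_neqAle eq_sym m0_neq0.
  have := key (a / m0); rewrite (_ : _ + b = b - a ^+ 2 / m0); last by field.
  by rewrite subr_ge0 ler_pdivrMr// mulrC.
have [->|a0] := eqVneq a 0; first by rewrite expr0n/= mulr_ge0.
(* With [m0 = 0] the polynomial is affine in [l]; at this [l] it would equal -1. *)
have := key ((b + 1) / (2 * a)); rewrite m00.
rewrite (_ : _ + b = -1); first by rewrite ler0N1.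
by field.
Qed.

End has_integral.

(** * Quadratic forms and the deterministic error bound *)

Section quadratic_forms.
Context {R : realFieldType}.

Definition bilin n (A : 'M[R]_n) (u v : 'cV[R]_n) : R :=
  (u^T *m A *m v) ord0 ord0.

Definition psd n (A : 'M[R]_n) := forall u, 0 <= bilin A u u.

Lemma bilinE n (A : 'M[R]_n) u v :
  bilin A u v = \sum_i \sum_j u i ord0 * v j ord0 * A i j.
Proof.
rewrite /bilin mxE [RHS]exchange_big; apply: eq_bigr => j _.
by rewrite mxE big_distrl; apply: eq_bigr => i _ /=; rewrite mxE; ring.
Qed.

Lemma bilin1E n (u v : 'cV[R]_n) :
  bilin 1%:M u v = \sum_i u i ord0 * v i ord0.
Proof. by rewrite /bilin mulmx1 mxE; apply: eq_bigr => i _; rewrite mxE. Qed.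

Lemma bilinC n (A : 'M[R]_n) u v : A^T = A -> bilin A u v = bilin A v u.
Proof.
by move=> AT; rewrite /bilin -(trmxK (_ *m v)) mxE !trmx_mul trmxK AT mulmxA.
Qed.

Lemma bilinDl n (A : 'M[R]_n) u v w :
  bilin A (u + v) w = bilin A u w + bilin A v w.
Proof. by rewrite /bilin linearD/= !mulmxDl mxE. Qed.

Lemma bilinDr n (A : 'M[R]_n) u v w :
  bilin A w (u + v) = bilin A w u + bilin A w v.
Proof. by rewrite /bilin mulmxDr mxE. Qed.

Lemma bilinZl n (A : 'M[R]_n) k u v : bilin A (k *: u) v = k * bilin A u v.
Proof. by rewrite /bilin linearZ/= -!scalemxAl mxE. Qed.

Lemma bilinZr n (A : 'M[R]_n) k u v : bilin A v (k *: u) = k * bilin A v u.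
Proof. by rewrite /bilin -scalemxAr mxE. Qed.

Lemma bilinDm n (A B : 'M[R]_n) u v :
  bilin (A + B) u v = bilin A u v + bilin B u v.
Proof. by rewrite /bilin mulmxDr mulmxDl mxE. Qed.

Lemma bilinZm n (A : 'M[R]_n) k u v : bilin (k *: A) u v = k * bilin A u v.
Proof. by rewrite /bilin -scalemxAr -scalemxAl mxE. Qed.

Lemma bilin_mulmx n m (A : 'M[R]_n) (B : 'M[R]_(n, m)) u v :
  bilin A (B *m u) (B *m v) = bilin (B^T *m A *m B) u v.
Proof. by rewrite /bilin trmx_mul !mulmxA. Qed.

Lemma bilin_mulr n (A B : 'M[R]_n) u v :
  bilin A u (B *m v) = bilin (A *m B) u v.
Proof. by rewrite /bilin !mulmxA. Qed.

Lemma bilin_suml n m (A : 'M[R]_n) (u : 'I_m -> 'cV[R]_n) v :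
  bilin A (\sum_k u k) v = \sum_k bilin A (u k) v.
Proof.
elim/big_ind2: _ => [|x y z t <- <-|//]; last by rewrite bilinDl.
by rewrite /bilin linear0 !mul0mx mxE.
Qed.

Lemma bilin_sumr n m (A : 'M[R]_n) (u : 'I_m -> 'cV[R]_n) v :
  bilin A v (\sum_k u k) = \sum_k bilin A v (u k).
Proof.
elim/big_ind2: _ => [|x y z t <- <-|//]; last by rewrite bilinDr.
by rewrite /bilin mulmx0 mxE.
Qed.

Lemma psd1 n : psd (1%:M : 'M[R]_n).
Proof.
by move=> u; rewrite bilin1E; apply: sumr_ge0 => i _; rewrite -expr2 sqr_ge0.
Qed.

Lemma bilin_cauchy_schwarz n (A : 'M[R]_n) u v : A^T = A -> psd A ->
  bilin A u v ^+ 2 <= bilin A u u * bilin A v v.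
Proof.
move=> AT A0.
set a := bilin A u u; set b := bilin A u v; set c := bilin A v v.
have key x y : 0 <= x ^+ 2 * a + 2 * x * y * b + y ^+ 2 * c.
  have := A0 (x *: u + y *: v).
  rewrite bilinDl !bilinDr !bilinZl !bilinZr (bilinC v u AT) -/a -/b -/c.
  by congr (_ <= _); ring.
have a0 : 0 <= a := A0 u.
have c0 : 0 <= c := A0 v.
have [a00|a00] := eqVneq a 0; last first.
  have a_gt0 : 0 < a by rewrite lt_neqAle eq_sym a00.
  (* The minimizing direction, scaled by [a] to avoid a division. *)
  have := key (- b) a.
  rewrite (_ : _ + _ = a * (a * c - b ^+ 2)); last by ring.
  by rewrite pmulr_rge0// subr_ge0.
have [->|b0] := eqVneq b 0; first by rewrite expr0n/= mulr_ge0.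
(* [A] is only semidefinite, so [a = 0] must be treated apart; here the form would take the value
   -1. *)
have := key (- ((c + 1) / (2 * b))) 1; rewrite a00.
rewrite (_ : _ + _ = -1); first by rewrite ler0N1.
by field.
Qed.

(** The gap between the two sides is half the sum of the form over all differences [u k - u l]. *)
Lemma bilin_sum_le n m (A : 'M[R]_n) (u : 'I_m -> 'cV[R]_n) :
  A^T = A -> psd A ->
  bilin A (\sum_k u k) (\sum_k u k) <= m%:R * \sum_k bilin A (u k) (u k).
Proof.
move=> AT A0; rewrite -subr_ge0.
have : 0 <= \sum_k \sum_l bilin A (u k - u l) (u k - u l).
  by apply: sumr_ge0 => k _; apply: sumr_ge0 => l _; exact: A0.
rewrite (_ : \sum_k _ = 2 * (m%:R * \sum_k bilin A (u k) (u k) -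
  bilin A (\sum_k u k) (\sum_k u k))); first by rewrite pmulr_rge0.
have -> : 2 * (m%:R * \sum_k bilin A (u k) (u k) -
    bilin A (\sum_k u k) (\sum_k u k)) =
  \sum_k \sum_(l < m) bilin A (u k) (u k) + \sum_(k < m) \sum_l bilin A (u l) (u l)
  - 2 * \sum_k \sum_l bilin A (u k) (u l).
  rewrite bilin_suml; under [in X in - X]eq_bigr do rewrite bilin_sumr.
  rewrite sumr_const card_ord -mulr_natl.
  under [X in _ = X + _ - _]eq_bigr do rewrite sumr_const card_ord -mulr_natl.
  by rewrite -mulr_sumr; ring.
rewrite mulr_sumr -sumrN -!big_split/=; apply: eq_bigr => k _.
rewrite mulr_sumr -sumrN -!big_split/=; apply: eq_bigr => l _.
rewrite -scaleN1r bilinDl !bilinDr !bilinZl !bilinZr (bilinC (u l) (u k) AT).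
by ring.
Qed.

Lemma bilin_colsum n m (A : 'M[R]_n) (B : 'M[R]_(n, m)) u :
  A^T = A -> psd A ->
  bilin A (B *m u) (B *m u) <=
  m%:R * \sum_k u k ord0 ^+ 2 * bilin A (col k B) (col k B).
Proof.
move=> AT A0; have -> : B *m u = \sum_k u k ord0 *: col k B.
  apply/colP => i; rewrite mxE summxE; apply: eq_bigr => k _.
  by rewrite !mxE mulrC.
apply: le_trans (bilin_sum_le _ AT A0) _; rewrite ler_wpM2l// ler_sum// => k _.
by rewrite bilinZl bilinZr mulrA expr2.
Qed.

(** The gap is half the form at [u + 2 v]. It isolates a main term [u] from a perturbation [v]
    without any control of the mixed term. *)
Lemma bilin_half n (A : 'M[R]_n) u v : A^T = A -> psd A ->
  bilin A u u / 2 - bilin A v v <= bilin A (u + v) (u + v).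
Proof.
move=> AT A0; have := A0 (u + 2%:R *: v).
rewrite !bilinDl !bilinDr !bilinZl !bilinZr (bilinC v u AT).
by have := A0 v; lra.
Qed.

Section regularized.
Variables (n : nat) (K : 'M[R]_n) (t : R).
Hypotheses (KT : K^T = K) (K0 : psd K) (t0 : 0 < t).
Let S := K + t%:M.
Let Q := invmx S.

Lemma bilin_reg u v : bilin S u v = bilin K u v + t * bilin 1%:M u v.
Proof. by rewrite bilinDm -(@scalemx1 _ n t) bilinZm. Qed.

Lemma tr_reg : S^T = S.
Proof. by rewrite /S linearD/= KT tr_scalar_mx. Qed.

Lemma psd_reg : psd S.
Proof.
by move=> u; rewrite bilin_reg addr_ge0 ?K0// mulr_ge0 ?(ltW t0)//; exact: psd1.
Qed.

Lemma reg_ge u : t * bilin 1%:M u u <= bilin S u u.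
Proof. by rewrite bilin_reg lerDr; exact: K0. Qed.

(** A kernel vector has form value zero. The premise is the contrapositive of strict positivity,
    which is how coercivity bounds deliver it. *)
Lemma posdef_unitmx m (A : 'M[R]_m) :
  (forall u, bilin A u u <= 0 -> u = 0) -> A \in unitmx.
Proof.
move=> A0; rewrite -unitmx_tr -row_free_unit; apply/inj_row_free => v vA.
have : v^T = 0; last by move/(congr1 trmx); rewrite trmxK trmx0.
apply: A0; rewrite /bilin trmxK -mulmxA.
have -> : A *m v^T = 0 by rewrite -[A]trmxK -trmx_mul vA trmx0.
by rewrite mulmx0 mxE.
Qed.

Lemma bilin1_eq0 m (u : 'cV[R]_m) : bilin 1%:M u u <= 0 -> u = 0.
Proof.
move=> u0; apply/colP => i; rewrite mxE; apply/eqP; rewrite -sqrf_eq0.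
rewrite eq_le sqr_ge0 andbT (le_trans _ u0)// bilin1E (bigD1 i)//= -expr2.
by rewrite lerDl sumr_ge0// => j _; rewrite -expr2 sqr_ge0.
Qed.

Lemma reg_unit : S \in unitmx.
Proof.
apply: posdef_unitmx => u /(le_trans (reg_ge u)); rewrite pmulr_rle0//.
exact: bilin1_eq0.
Qed.

Lemma tr_reg_inv : Q^T = Q.
Proof. by rewrite /Q trmx_inv tr_reg. Qed.

Lemma bilin_reg_inv u v : bilin Q u v = bilin S (Q *m u) (Q *m v).
Proof.
rewrite bilin_mulmx tr_reg_inv -mulmxA mulmxV ?reg_unit// mulmx1 //.
Qed.

Lemma psd_reg_inv : psd Q.
Proof. by move=> u; rewrite bilin_reg_inv; exact: psd_reg. Qed.

Lemma reg_inv_mul_le u : t * bilin 1%:M (Q *m u) (Q *m u) <= bilin Q u u.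
Proof. by rewrite bilin_reg_inv; exact: reg_ge. Qed.

(** By Cauchy-Schwarz [(u^T Q u)^2 <= |u|^2 |Q u|^2], and [t |Q u|^2 <= u^T Q u]; one factor
    [u^T Q u] then cancels. *)
Lemma reg_inv_le u : t * bilin Q u u <= bilin 1%:M u u.
Proof.
have [Q0|Q0] := eqVneq (bilin Q u u) 0; first by rewrite Q0 mulr0 psd1.
have Q_gt0 : 0 < bilin Q u u by rewrite lt_neqAle eq_sym Q0 psd_reg_inv.
have := bilin_cauchy_schwarz u (Q *m u) (trmx1 _ _) (@psd1 n).
rewrite [bilin _ u (_ *m _)]bilin_mulr mul1mx => QQ.
rewrite -(ler_pM2r Q_gt0).
rewrite -mulrA -expr2 (le_trans (ler_wpM2l (ltW t0) QQ))// mulrCA.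
by rewrite ler_wpM2l ?psd1// reg_inv_mul_le.
Qed.

(** By symmetry row [i] of [Q] is [Q e] for the unit vector [e], and
    [t |Q e|^2 <= e^T Q e <= 1 / t]. *)
Lemma reg_inv_frobenius : \sum_i \sum_j Q i j ^+ 2 <= n%:R / t ^+ 2.
Proof.
have -> : n%:R / t ^+ 2 = \sum_(i < n) t ^- 2.
  by rewrite sumr_const card_ord -[RHS]mulr_natl.
apply: ler_sum => i _; pose e : 'cV[R]_n := delta_mx i ord0.
have e1 : bilin 1%:M e e = 1.
  rewrite bilin1E (bigD1 i)//= big1 ?addr0 => [|j ji]; rewrite !mxE ?eqxx ?mulr1//.
  by rewrite (negbTE ji) mul0r.
have -> : \sum_j Q i j ^+ 2 = bilin 1%:M (Q *m e) (Q *m e).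
  rewrite bilin1E; apply: eq_bigr => j _.
  by rewrite -colE mxE -expr2 -[in RHS]tr_reg_inv mxE.
have := reg_inv_mul_le e; have := reg_inv_le e; rewrite e1 => h1 h2.
rewrite -ler_pdivlMl// in h1; rewrite -ler_pdivlMl// in h2.
rewrite (le_trans h2)// -exprVn expr2 ler_wpM2l ?invr_ge0 ?(ltW t0)//.
by rewrite -[leRHS]mulr1.
Qed.

(** Cauchy-Schwarz for the form of [S] between [Q u] and [u], whose product in that form is
    [|u|^2]. *)
Lemma reg_inv_dual u : bilin 1%:M u u ^+ 2 <= bilin Q u u * bilin S u u.
Proof.
have := bilin_cauchy_schwarz (Q *m u) u tr_reg psd_reg.
rewrite -bilin_reg_inv; congr (_ ^+ 2 <= _).
by rewrite /bilin trmx_mul tr_reg_inv -[_ *m Q *m S]mulmxA mulVmx ?reg_unit.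
Qed.

(* Membership of [u] in the reproducing kernel space of [K], with squared norm
   at most [C], in its dual form. *)
Lemma reg_inv_rkhs u C : 0 <= C ->
  (forall a, bilin 1%:M a u ^+ 2 <= C * bilin K a a) -> bilin Q u u <= C.
Proof.
(* The test vector [a = Q u] makes the left side [(u^T Q u)^2], while its [K]-form is at most its
   [S]-form, which is [u^T Q u]. *)
move=> C0 uC; have := uC (Q *m u).
have -> : bilin 1%:M (Q *m u) u = bilin Q u u.
  by rewrite /bilin trmx_mul tr_reg_inv mulmx1.
have h : bilin K (Q *m u) (Q *m u) <= bilin Q u u.
  rewrite [leRHS]bilin_reg_inv bilin_reg lerDl mulr_ge0 ?(ltW t0)//; exact: psd1.
move/le_trans/(_ (ler_wpM2l C0 h)); have := psd_reg_inv u.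
rewrite le_eqVlt => /predU1P[<-//|Q0].
by rewrite expr2 ler_pM2r.
Qed.

End regularized.

(** No eigenvalues are used: the form of the inverse [W] is at most [C |u|^2], with [C] read off its
    entries, and Cauchy-Schwarz between [u] and [W u] gives [|u|^4 <= (u^T V u) (u^T W u)]. *)
Lemma posdef_lower_bound p (V : 'M[R]_p) : V^T = V ->
  (forall u, u != 0 -> 0 < bilin V u u) ->
  exists2 c, 0 < c & forall u, c * bilin 1%:M u u <= bilin V u u.
Proof.
move=> VT V0; have Vpsd : psd V.
  by move=> u; have [->|/V0/ltW//] := eqVneq u 0; rewrite /bilin mulmx0 mxE.
have Vu : V \in unitmx.
  by apply: posdef_unitmx => u; have [//|/V0] := eqVneq u 0; rewrite ltNge => /negbTE ->.
pose W := invmx V; pose C := 1 + \sum_i \sum_j `|W i j|.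
have C0 : 0 < C.
  by rewrite ltr_pwDl// sumr_ge0// => i _; rewrite sumr_ge0.
have WC u : bilin W u u <= C * bilin 1%:M u u.
  have u2 i : u i ord0 ^+ 2 <= bilin 1%:M u u.
    rewrite bilin1E (bigD1 i)//= -expr2 lerDl sumr_ge0// => j _.
    by rewrite -expr2 sqr_ge0.
  rewrite bilinE mulrDl mul1r -[leLHS]add0r lerD ?psd1// mulr_suml.
  apply: ler_sum => i _; rewrite mulr_suml; apply: ler_sum => j _.
  rewrite mulrC (le_trans (ler_norm _))// normrM ler_wpM2l//.
  rewrite normrM -(@ler_pM2l _ 2)//.
  have := u2 i; have := u2 j; have := sqr_ge0 (`|u i ord0| - `|u j ord0|).
  by rewrite sqrrB !real_normK ?num_real//; lra.
exists C^-1 => [|u]; first by rewrite invr_gt0.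
have [->|u0] := eqVneq u 0; first by rewrite /bilin !mulmx0 mxE mulr0.
have u_gt0 : 0 < bilin 1%:M u u.
  rewrite lt_neqAle psd1 andbT eq_sym; apply: contraNneq u0 => h.
  by apply/eqP/bilin1_eq0; rewrite h.
rewrite ler_pdivrMl//.
have := bilin_cauchy_schwarz u (W *m u) VT Vpsd.
rewrite bilin_mulmx bilin_mulr mulmxV// trmx_inv VT.
rewrite (_ : invmx V *m V *m W = W); last by rewrite mulVmx// mul1mx.
move=> h; rewrite -(ler_pM2r u_gt0) -expr2 (le_trans h)// mulrAC mulrC.
by rewrite ler_wpM2r ?Vpsd.
Qed.

End quadratic_forms.
Lemma enorm_cV {R : realType} p (v : 'cV[R]_p) :
  enorm v = Num.sqrt (bilin 1%:M v v).
Proof.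
rewrite /enorm bilin1E; congr Num.sqrt; apply: eq_bigr => i _.
by rewrite big_ord1 expr2.
Qed.

Section gls_error.
Context {R : realType}.

Lemma bilin_abs_le n (A : 'M[R]_n) u v a b : A^T = A -> psd A ->
  0 <= a -> 0 <= b -> bilin A u u <= a ^+ 2 -> bilin A v v <= b ^+ 2 ->
  `|bilin A u v| <= a * b.
Proof.
move=> AT A0 a0 b0 ua vb; rewrite -ler_sqr ?nnegrE ?mulr_ge0//.
rewrite real_normK ?num_real// (le_trans (bilin_cauchy_schwarz _ _ AT A0))//.
by rewrite exprMn ler_pM.
Qed.

(* [E] and [eps] are the noise, [H] and [g] the smooth parts of the exposures
   and of the outcomes. The lower bound on [X^T Q X] comes from
   [|E u|^4 <= (E u)^T Q (E u) * (E u)^T Sigma (E u)], so that only an upper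
   bound on the quadratic forms of [Sigma] itself is needed. *)
Lemma gls_error_bound p (c M e t : R) :
  0 < c -> 0 < M -> 0 < e -> 0 < t ->
  exists2 rho, 0 < rho &
  forall n (K : 'M[R]_n) (H E : 'M[R]_(n, p)) (g eps : 'cV[R]_n)
    (beta : 'cV[R]_p),
  let S := K + t%:M in let Q := invmx S in let X := H + E in
  (0 < n)%N -> K^T = K -> psd K ->
  (forall k, bilin Q (col k H) (col k H) <= rho ^+ 2 * n%:R) ->
  bilin Q g g <= rho ^+ 2 * n%:R ->
  bilin 1%:M eps eps <= t * (M ^+ 2 * n%:R) ->
  (forall k, bilin 1%:M (col k E) (col k E) <= t * (M ^+ 2 * n%:R)) ->
  \sum_k bilin S (col k E) (col k E) <= M * n%:R ->
  (forall u, c * n%:R * bilin 1%:M u u <= bilin 1%:M (E *m u) (E *m u)) ->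
  (forall k, `|bilin Q (col k E) eps| <= rho * n%:R) ->
  X^T *m Q *m X \in unitmx /\
  enorm (gls X S (X *m beta + g + eps) - beta) <= e.
Proof.
move=> c0 M0 e0 t0.
(* [p + 1] rather than [p], to stay positive when [p = 0]. *)
pose q : R := p.+1%:R; have q0 : 0 < q by rewrite ltr0n.
(* The coercivity constant of [E^T Q E / n]: [c] bounds [|E u|^2] from below and [q M] bounds the
   form of [S] at [E u] from above. *)
pose c1 := c ^+ 2 / (q * M); have c1_gt0 : 0 < c1 by rewrite divr_gt0 ?exprn_gt0 ?mulr_gt0.
have c1E : c1 * (q * M) = c ^+ 2 by rewrite divfK// gt_eqF ?mulr_gt0.
clearbody c1.
(* The score [X^T Q (g + eps)] splits into four terms, bounded by [rho], [rho M], [M rho] and [rho]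
   times n. Below, [r1] keeps the effect of [H] on coercivity under [c1 / 4], and [r2] brings the
   final error under [e]. *)
pose B := 2 + 2 * M; have B0 : 0 < B by rewrite addr_gt0 ?mulr_gt0.
pose r1 := c1 / (4 * q); pose r2 := e * c1 / (4 * q * B).
have r1_gt0 : 0 < r1 by apply: divr_gt0 => //; exact: mulr_gt0.
have r2_gt0 : 0 < r2.
  by apply: divr_gt0; [exact: mulr_gt0|apply: mulr_gt0 => //; exact: mulr_gt0].
pose rho := Num.min 1 (Num.min r1 r2).
have rho0 : 0 < rho by rewrite !lt_min ltr01 r1_gt0.
exists rho => // n K H E g eps beta S Q X n0 KT K0 hH hg heps hE hS hc hEeps.
have N0 : 0 < n%:R :> R by rewrite ltr0n.
set N := n%:R in N0 hH hg heps hE hS hc hEeps.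
have rho1 : rho <= 1 by rewrite ge_min lexx.
have rho_r1 : rho <= r1 by rewrite !ge_min lexx !orbT.
have rho_r2 : rho <= r2 by rewrite !ge_min lexx !orbT.
have XE : X = H + E by [].
clearbody rho X.
have QT : Q^T = Q by exact: tr_reg_inv.
have Q0 : psd Q by exact: psd_reg_inv.
have u2 (u : 'cV[R]_p) k : u k ord0 ^+ 2 <= bilin 1%:M u u.
  rewrite bilin1E (bigD1 k)//= -expr2 lerDl sumr_ge0// => j _.
  by rewrite -expr2 sqr_ge0.
have Ole x : bilin 1%:M x x <= t * (M ^+ 2 * N) -> bilin Q x x <= M ^+ 2 * N.
  by move=> xM; rewrite -(ler_pM2l t0) (le_trans _ xM)// reg_inv_le.
have coercE u : c1 * N * bilin 1%:M u u <= bilin Q (E *m u) (E *m u).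
  have [->|u0] := eqVneq u 0; first by rewrite /bilin !mulmx0 !mxE mulr0.
  have u_gt0 : 0 < bilin 1%:M u u.
    rewrite lt_neqAle psd1 andbT eq_sym; apply: contraNneq u0 => h.
    by apply/eqP/bilin1_eq0; rewrite h.
  have SE : bilin S (E *m u) (E *m u) <= q * M * N * bilin 1%:M u u.
    rewrite (le_trans (bilin_colsum _ _ (tr_reg _ KT) (psd_reg K0 t0)))//.
    rewrite -!mulrA ler_pM// ?ler_nat//.
      by apply: sumr_ge0 => k _; rewrite mulr_ge0 ?sqr_ge0 ?(psd_reg K0 t0).
    rewrite mulrA (le_trans _ (ler_wpM2r (psd1 u) hS))// mulr_suml.
    by apply: ler_sum => k _; rewrite mulrC ler_wpM2l ?u2 ?(psd_reg K0 t0).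
  have h : (c * N * bilin 1%:M u u) ^+ 2 <=
      bilin Q (E *m u) (E *m u) * (q * M * N * bilin 1%:M u u).
    rewrite (le_trans _ (ler_wpM2l (Q0 _) SE))//.
    rewrite (le_trans _ (reg_inv_dual KT K0 t0 _))//.
    by rewrite ler_sqr ?nnegrE ?psd1// ?mulr_ge0 ?psd1 ?(ltW c0) ?(ltW N0).
  have d0 : 0 < q * M * N * bilin 1%:M u u by rewrite !mulr_gt0.
  rewrite -(ler_pM2r d0) (le_trans _ h)// le_eqVlt; apply/orP; left; apply/eqP.
  by rewrite !exprMn -c1E; ring.
(* Half of [c1] survives the splitting of [X u] into [E u + H u], and the smooth part removes at
   most another quarter. *)
have coerc u : c1 / 4 * N * bilin 1%:M u u <= bilin Q (X *m u) (X *m u).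
  have HU : bilin Q (H *m u) (H *m u) <= q * rho * N * bilin 1%:M u u.
    rewrite (le_trans (bilin_colsum _ _ QT Q0))//.
    apply: (@le_trans _ _ (p%:R * (rho ^+ 2 * N * bilin 1%:M u u))).
      rewrite ler_wpM2l// bilin1E mulr_sumr ler_sum// => k _.
      by rewrite mulrC -expr2 ler_wpM2r ?sqr_ge0.
    have -> : p%:R * (rho ^+ 2 * N * bilin 1%:M u u) =
        p%:R * rho ^+ 2 * (N * bilin 1%:M u u) by ring.
    rewrite -[leRHS]mulrA ler_wpM2r ?mulr_ge0 ?psd1 ?(ltW N0)//.
    rewrite ler_pM ?sqr_ge0 ?ler_nat//.
    by rewrite expr2 ler_piMl ?(ltW rho0).
  rewrite XE mulmxDl addrC (le_trans _ (bilin_half _ _ QT Q0))//.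
  have := coercE u; have h0 := mulr_ge0 (ltW N0) (psd1 u).
  have : q * rho <= c1 / 4.
    rewrite -ler_pdivlMl// (le_trans rho_r1)// /r1 le_eqVlt.
    by apply/orP; left; apply/eqP; field; rewrite gt_eqF.
  move=> /(ler_wpM2r h0) h1; move: HU h1; rewrite -!mulrA => HU h1.
  move=> h2; move: HU h1 h2; set y := N * _ => HU h1 h2; lra.
have Xu : X^T *m Q *m X \in unitmx.
  apply: posdef_unitmx => u; rewrite -bilin_mulmx.
  move/(le_trans (coerc u)); rewrite pmulr_rle0 ?mulr_gt0 ?invr_gt0//.
  exact: bilin1_eq0.
split=> //.
set v := gls _ _ _ - beta.
have vE : v = invmx (X^T *m Q *m X) *m (X^T *m Q *m (g + eps)).
  have glsE y : gls X S y = invmx (X^T *m Q *m X) *m (X^T *m Q *m y).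
    by rewrite /gls -!mulmxA.
  rewrite /v glsE -addrA mulmxDr (mulmxA _ X) mulmxDr.
  by rewrite [invmx _ *m (_ *m beta)]mulmxA mulVmx// mul1mx addrAC subrr add0r.
pose r k := bilin Q (col k X) (g + eps).
have rB k : `|r k| <= rho * B * N.
  rewrite /r (_ : col k X = col k H + col k E) ?XE ?linearD//.
  rewrite bilinDl !bilinDr.
  have sN : Num.sqrt N ^+ 2 = N by rewrite sqr_sqrtr ?(ltW N0).
  have sqN a : a ^+ 2 * N = (a * Num.sqrt N) ^+ 2 by rewrite exprMn sN.
  have rN0 : 0 <= rho * Num.sqrt N by rewrite mulr_ge0 ?sqrtr_ge0 ?(ltW rho0).
  have MN0 : 0 <= M * Num.sqrt N by rewrite mulr_ge0 ?sqrtr_ge0 ?(ltW M0).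
  have hgS := hg; have hHS := hH k; have hepsS := Ole _ heps; have hES := Ole _ (hE k).
  rewrite !sqN in hgS hHS hepsS hES.
  have h1 := bilin_abs_le QT Q0 rN0 rN0 hHS hgS.
  have h2 := bilin_abs_le QT Q0 rN0 MN0 hHS hepsS.
  have h3 := bilin_abs_le QT Q0 MN0 rN0 hES hgS.
  have h4 := hEeps k.
  have sm a b : a * Num.sqrt N * (b * Num.sqrt N) = a * b * N.
    by rewrite -{3}sN; ring.
  rewrite !sm in h1 h2 h3.
  have h5 : rho * rho * N <= rho * N.
    by rewrite ler_wpM2r ?(ltW N0)// ler_piMl ?(ltW rho0).
  rewrite (le_trans (ler_normD _ _))//.
  rewrite (le_trans (lerD (ler_normD _ _) (ler_normD _ _)))//.
  apply: le_trans (lerD (lerD h1 h2) (lerD h3 h4)) _.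
  apply: (@le_trans _ _ (rho * N + rho * M * N + (M * rho * N + rho * N))).
    by rewrite !lerD.
  by rewrite le_eqVlt; apply/orP; left; apply/eqP; rewrite /B; ring.
have vr : bilin Q (X *m v) (X *m v) = \sum_k v k ord0 * r k.
  have Wv : X^T *m Q *m X *m v = X^T *m Q *m (g + eps) by rewrite vE mulKVmx.
  rewrite bilin_mulmx /bilin -mulmxA Wv.
  rewrite mxE; apply: eq_bigr => k _; rewrite mxE; congr (_ * _).
  by rewrite /r /bilin tr_col -!row_mul [RHS]mxE.
(* The weight [c1 / 8] is half the coercivity constant, so the quadratic term can be absorbed on the
   left. *)
have amgm k : v k ord0 * r k <=
    c1 / 8 * N * v k ord0 ^+ 2 + 2 / (c1 * N) * (rho * B * N) ^+ 2.
  apply: (@le_trans _ _ (c1 / 8 * N * v k ord0 ^+ 2 + 2 / (c1 * N) * r k ^+ 2)).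
    rewrite -subr_ge0.
    rewrite (_ : _ - _ = c1 / 8 * N * (v k ord0 - 4 / (c1 * N) * r k) ^+ 2).
      by rewrite mulr_ge0 ?sqr_ge0// !mulr_ge0 ?invr_ge0 ?(ltW N0) ?(ltW c1_gt0).
    by field; rewrite !gt_eqF.
  rewrite lerD2l ler_wpM2l ?divr_ge0 ?mulr_ge0 ?(ltW N0) ?(ltW c1_gt0)//.
  rewrite -[r k ^+ 2]real_normK ?num_real// ler_sqr// nnegrE//.
  exact: le_trans (rB k).
have := coerc v; rewrite vr => /le_trans/(_ (ler_sum _ (fun k _ => amgm k))).
rewrite big_split/= -mulr_sumr.
rewrite (_ : \sum_i v i ord0 ^+ 2 = bilin 1%:M v v); last first.
  by rewrite bilin1E; apply: eq_bigr => i _; rewrite expr2.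
rewrite sumr_const card_ord -[_ *+ p]mulr_natl => hv.
have vB : bilin 1%:M v v <= q * (4 * B * rho / c1) ^+ 2.
  have d0 : 0 < c1 / 8 * N by rewrite !mulr_gt0.
  rewrite -(ler_pM2l d0); apply: (@le_trans _ _
    (p%:R * (2 / (c1 * N) * (rho * B * N) ^+ 2))); first by lra.
  apply: (@le_trans _ _ (q * (2 / (c1 * N) * (rho * B * N) ^+ 2))).
    rewrite ler_wpM2r ?ler_nat// mulr_ge0 ?sqr_ge0//.
    by rewrite divr_ge0 ?mulr_ge0 ?(ltW N0) ?(ltW c1_gt0).
  by rewrite le_eqVlt; apply/orP; left; apply/eqP; field; rewrite !gt_eqF.
rewrite enorm_cV -[leRHS](gtr0_norm e0) -sqrtr_sqr ler_wsqrtr// (le_trans vB)//.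
have : q * (4 * B * rho / c1) <= e.
  rewrite -ler_pdivlMl// ler_pdivrMr// -ler_pdivlMl ?mulr_gt0//.
  rewrite (le_trans rho_r2)// /r2 le_eqVlt.
  by apply/orP; left; apply/eqP; field; rewrite !gt_eqF.
move=> h; apply: (@le_trans _ _ ((q * (4 * B * rho / c1)) ^+ 2)).
  rewrite [leRHS]exprMn ler_wpM2r ?sqr_ge0// expr2 ler_peMl ?(ltW q0)//.
  by rewrite ler1n.
by rewrite ler_sqr ?nnegrE ?(ltW e0)// !mulr_ge0 ?invr_ge0 ?(ltW q0) ?(ltW B0) ?(ltW rho0) ?(ltW c1_gt0).
Qed.

End gls_error.

(** * Independence and deviation bounds *)

Section independence.
Context {d : measure_display} {T : measurableType d} {R : realType}.
Variable P : probability T R.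
Implicit Types f g h : T -> R.

Definition indep2 f g := forall A B, measurable A -> measurable B ->
  P (f @^-1` A `&` g @^-1` B) = (P (f @^-1` A) * P (g @^-1` B))%E.

Definition indep3 f g h := forall A B C,
  measurable A -> measurable B -> measurable C ->
  P (f @^-1` A `&` g @^-1` B `&` h @^-1` C) =
  (P (f @^-1` A) * P (g @^-1` B) * P (h @^-1` C))%E.

(** Independence identifies the joint law of [(f, g)] with the product of the two laws, since they
    agree on rectangles; Fubini then computes the integral of the product. *)
Lemma has_integral_indep2 f g a b : indep2 f g ->
  has_integral P setT f a -> has_integral P setT g b ->
  has_integral P setT (fun x => f x * g x) (a * b).
Proof.
move=> fg fa gb.
have mf := has_integral_measurable fa; have mg := has_integral_measurable gb.
pose F : {RV P >-> R} := HB.pack f (isMeasurableFun.Build _ _ _ _ _ mf).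
pose G : {RV P >-> R} := HB.pack g (isMeasurableFun.Build _ _ _ _ _ mg).
have mFG : measurable_fun setT
    (fun x => (f x, g x) : (R * R)%type).
  exact: measurable_fun_pair.
pose FG : {RV P >-> (R * R)%type} :=
  HB.pack (fun x => (f x, g x) : (R * R)%type)
    (isMeasurableFun.Build _ _ _ _ _ mFG).
pose m1 := distribution P F; pose m2 := distribution P G.
have muE X : measurable X -> (m1 \x m2)%E X = distribution P FG X.
  apply: product_measure_unique => A B mA mB.
  by rewrite -fg.
pose z (x : (R * R)%type) : \bar R := (x.1 * x.2)%:E.
have mz : measurable_fun setT z.
  apply/measurable_EFinP; apply: measurable_funM.
    exact: measurable_fst.
  exact: measurable_snd.
have intF : (\int[m1]_x (x%:E) = a%:E)%E.
  by rewrite integral_distribution//; [exact: fa.2|exact: fa.1].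
have intG : (\int[m2]_x (x%:E) = b%:E)%E.
  by rewrite integral_distribution//; [exact: gb.2|exact: gb.1].
have iF : m1.-integrable setT (EFin : R -> _).
  by apply: integrable_pushforward => //; exact: fa.1.
have iG : m2.-integrable setT (EFin : R -> _).
  by apply: integrable_pushforward => //; exact: gb.1.
have iz : (m1 \x m2)%E.-integrable setT z.
  apply/integrable12ltyP => //.
  have gE x : (\int[m2]_y `|z (x, y)| = `|x%:E| * \int[m2]_y `|y%:E|)%E.
    rewrite -ge0_integralZl//; last exact: measurableT_comp.
    by apply: eq_integral => y _; rewrite /z /= normrM.
  under eq_integral do rewrite gE.
  have /integrableP[_ gfin] := iG.
  rewrite ge0_integralZr//; [|exact: measurableT_comp|exact: integral_ge0].
  have /integrableP[_ ffin] := iF.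
  by rewrite lte_mul_pinfty// ?integral_ge0// ge0_fin_numE// integral_ge0.
have iz' : (distribution P FG).-integrable setT z.
  apply/integrableP; split=> //; have /integrableP[_ h] := iz.
  rewrite (eq_measure_integral (m1 \x m2)%E)// => A mA _.
  exact/esym/muE.
split.
  have /integrableP[_] := iz'.
  rewrite ge0_integral_distribution//; last exact: measurableT_comp.
  move=> h; apply/integrableP; split; last exact: h.
  by apply/measurable_EFinP; exact: measurable_funM.
rewrite -[LHS](integral_distribution (X := FG) mz)//; last first.
  apply/integrableP; split; first by apply: measurableT_comp.
  have /integrableP[_] := iz'.
  by rewrite ge0_integral_distribution//; exact: measurableT_comp.
rewrite (eq_measure_integral (m1 \x m2)%E)//; last first.
  by move=> A mA _; exact/esym/muE.
rewrite -integral12_prod_meas1//.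
rewrite /fubini_F.
under eq_integral => x _.
  rewrite (_ : (\int[m2]_y z (x, y) = x%:E * b%:E)%E); last first.
    by rewrite /z/=; under eq_integral do rewrite EFinM; rewrite integralZl// intG.
  over.
by rewrite /= integralZr// intF.
Qed.

(** For fixed [A], the law of [(g, h)] restricted to [f^-1 A] and the law of [(g, h)] scaled by
    [P (f^-1 A)] agree on rectangles, hence on all measurable sets of the plane. *)
Lemma indep3_prod f g h : measurable_fun setT f -> measurable_fun setT g ->
  measurable_fun setT h -> indep3 f g h -> indep2 f (fun x => g x * h x).
Proof.
move=> mf mg mh fgh A B mA mB.
have mfA : measurable (f @^-1` A) by rewrite -[X in measurable X]setTI; exact: mf.
have mgh : measurable_fun setT
    (fun x => (g x, h x) : (R * R)%type).
  exact: measurable_fun_pair.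
pose a := NngNum (fine_ge0 (measure_ge0 P (f @^-1` A))).
have aE : P (f @^-1` A) = (a%:num)%:E by rewrite /= fineK// fin_num_measure.
pose m1 : {measure set _ -> \bar R} := pushforward (mrestr P mfA) 
  (fun x => (g x, h x) : (R * R)%type).
pose m2 : {measure set _ -> \bar R} := mscale a (pushforward P
  (fun x => (g x, h x) : (R * R)%type)).
pose C := [set Z : set ((R * R)%type) |
  exists X, measurable X /\ exists Y, measurable Y /\ Z = X `*` Y].
pose Z := [set z : (R * R)%type | B (z.1 * z.2)].
have mZ : measurable Z.
  rewrite -[X in measurable X]setTI.
  have : measurable_fun setT
    (fun z : (R * R)%type => z.1 * z.2 : R).
    by apply: measurable_funM; [exact: measurable_fst|exact: measurable_snd].
  exact.
have : m1 mgh Z = m2 mgh Z.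
  apply: (measure_unique C (fun=> setT)) => //.
  - rewrite measurable_prod_measurableType; congr (<<s _ >>).
    rewrite predeqE; split => [[X mX [Y mY <-]]|[X [mX [Y [mY ->]]]]].
      by exists X; split => //; exists Y.
    by exists X => //; exists Y.
  - move=> X Y [X1 [mX1 [X2 [mX2 ->]]]] [Y1 [mY1 [Y2 [mY2 ->]]]].
    rewrite -setXI; exists (X1 `&` Y1); split; first exact: measurableI.
    by exists (X2 `&` Y2); split => //; exact: measurableI.
  - by move=> i; exists setT; split => //; exists setT; split => //; rewrite setXTT.
  - by rewrite bigcup_const.
  - move=> _ [X [mX [Y [mY ->]]]].
    have -> : m1 mgh (X `*` Y) = P (g @^-1` X `&` h @^-1` Y `&` f @^-1` A) by [].
    have -> : m2 mgh (X `*` Y) = ((a%:num)%:E * P (g @^-1` X `&` h @^-1` Y))%E by [].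
    rewrite -aE setIC setIA fgh// -muleA; congr (_ * _)%E.
    have := fgh setT X Y measurableT mX mY.
    by rewrite preimage_setT setTI probability_setT mul1e.
  - move=> _; rewrite /m1 /= /pushforward /mrestr /= preimage_setT setTI.
    by rewrite (le_lt_trans (probability_le1 _ _))// ltry.
have -> : m1 mgh Z = P ((fun x => g x * h x) @^-1` B `&` f @^-1` A) by [].
have -> : m2 mgh Z = ((a%:num)%:E * P ((fun x => g x * h x)%R @^-1` B))%E by [].
by rewrite -aE setIC.
Qed.

Lemma has_integral_indep3 f g h a b c : indep3 f g h ->
  has_integral P setT f a -> has_integral P setT g b ->
  has_integral P setT h c ->
  has_integral P setT (fun x => f x * (g x * h x)) (a * (b * c)).
Proof.
move=> fgh fa gb hc; apply: has_integral_indep2 => //.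
  exact: (indep3_prod (has_integral_measurable fa) (has_integral_measurable gb)
    (has_integral_measurable hc)).
apply: has_integral_indep2 => // A B mA mB.
have := fgh setT A B measurableT mA mB.
by rewrite preimage_setT setTI probability_setT mul1e.
Qed.

Lemma has_integral_cst (k : R) : has_integral P setT (fun=> k) k.
Proof.
split; first exact: finite_measure_integrable_cst.
by have := expectation_cst P k; rewrite unlock.
Qed.

Lemma has_integral_sqr f v : measurable_fun setT f ->
  (\int[P]_w (f w ^+ 2)%:E = v%:E)%E -> has_integral P setT (fun w => f w ^+ 2) v.
Proof.
move=> mf fv; split=> //; apply/integrableP; split.
  by apply/measurable_EFinP; exact: measurable_funX.
rewrite (_ : (\int[P]_x _ = v%:E)%E) ?ltry// -fv.
by apply: eq_integral => x _ /=; rewrite ger0_norm ?sqr_ge0.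
Qed.

(* [|f g| <= f^2 + g^2] *)
Lemma has_integral_prod2 f g v w : measurable_fun setT f ->
  measurable_fun setT g -> has_integral P setT (fun x => f x ^+ 2) v ->
  has_integral P setT (fun x => g x ^+ 2) w ->
  exists c, has_integral P setT (fun x => f x * g x) c.
Proof.
move=> mf mg fv gw.
have [||c] := dominated_has_integral measurableT _ _ (has_integralD measurableT fv gw)
  (f := fun x => f x * g x).
- exact: measurable_funM.
- move=> x _ /=; rewrite normrM.
  have := sqr_ge0 (`|f x| - `|g x|); rewrite sqrrB !real_normK ?num_real//.
  by have := sqr_ge0 (f x); have := sqr_ge0 (g x); lra.
by exists c.
Qed.

(** An outer-measure bound: bad events quantified over all vectors [u] can be used without proving
    them measurable. *)
Definition within_prob (A : set T) (r : R) :=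
  exists B, [/\ measurable B, A `<=` B & (P B <= r%:E)%E].

Lemma within_probS A B r : A `<=` B -> within_prob B r -> within_prob A r.
Proof. by move=> AB [C [mC BC Cr]]; exists C; split => //; exact: subset_trans BC. Qed.

Lemma within_probU A B r s : within_prob A r -> within_prob B s ->
  within_prob (A `|` B) (r + s).
Proof.
move=> [C [mC AC Cr]] [D [mD BD Ds]]; exists (C `|` D); split.
- exact: measurableU.
- exact: setUSS.
- by rewrite (le_trans (measureU2 P mC mD))// EFinD leeD.
Qed.

Lemma within_prob_bigcup (I : finType) (A : I -> set T) r :
  (forall i, within_prob (A i) r) ->
  within_prob [set w | exists i, A i w] (#|I|%:R * r).
Proof.
move=> Ar; have : within_prob [set w | exists2 i, i \in enum I & A i w] ((size (enum I))%:R * r).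
  elim: (enum I) => [|i s ih].
    exists set0; split => //; last by rewrite measure0 mul0r.
    by move=> w [].
  rewrite /= -natr1 mulrDl mul1r addrC.
  apply: within_probS (within_probU (Ar i) ih) => w [j].
  rewrite inE => /predU1P[->|js]; first by left.
  by right; exists j.
rewrite -cardE; apply: within_probS => w [i Aiw]; exists i => //.
by rewrite mem_enum.
Qed.

Lemma markov_within f a t : 0 < t -> (forall x, 0 <= f x) ->
  has_integral P setT f a -> within_prob [set w | t <= f w] (a / t).
Proof.
move=> t0 f0 fa; have mf := has_integral_measurable fa.
have mB : measurable [set w | t <= f w].
  rewrite -[X in measurable X]setTI.
  have -> : [set w | t <= f w] = f @^-1` `[t, +oo[.
    by apply/seteqP; split => w /=; rewrite in_itv/= andbT.
  by apply: mf => //; exact: measurable_itv.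
exists [set w | t <= f w]; split => //.
have ind : has_integral P setT \1_[set w | t <= f w] (fine (P [set w | t <= f w])).
  rewrite [X in has_integral _ _ _ (fine X)](_ : _ = \int[P]_x (\1_[set w | t <= f w] x)%:E)%E.
    apply: integrable_has_integral => //.
    by apply: integrable_indic => //; exact: fin_num_measure.
  by rewrite integral_indic// setIT.
rewrite -[P _]fineK ?fin_num_measure// lee_fin ler_pdivlMr// mulrC.
apply: has_integral_le (has_integralZl measurableT t ind) fa => // x _ /=.
rewrite indicE; have [|_] := boolP (x \in _); last by rewrite mulr0.
by rewrite inE mulr1.
Qed.

(** Orthogonality reduces the second moment of the sum to the diagonal. The index type is arbitrary
    because the cross term between the two noises is a sum over pairs. *)
Lemma chebyshev_within (I : finType) (Z : I -> T -> R) (c : I -> I -> R) v t :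
  0 < t -> (forall i j, has_integral P setT (fun w => Z i w * Z j w) (c i j)) ->
  (forall i j, i != j -> c i j = 0) -> \sum_i c i i <= v ->
  within_prob [set w | t <= `|\sum_i Z i w| ] (v / t ^+ 2).
Proof.
move=> t0 Zc c0 cv.
have Sc : has_integral P setT (fun w => (\sum_i Z i w) ^+ 2) (\sum_i c i i).
  have := has_integral_sum measurableT (index_enum I) (Q := xpredT)
    (fun i _ => has_integral_sum measurableT (index_enum I) (Q := xpredT)
      (fun j _ => Zc i j)).
  rewrite (_ : \sum_i \sum_j c i j = \sum_i c i i); last first.
    apply: eq_bigr => i _; rewrite (bigD1 i)//= big1 ?addr0// => j ji.
    by rewrite c0// eq_sym.
  apply: has_integral_eq => // w _; rewrite expr2 mulr_suml.
  by apply: eq_bigr => i _; rewrite mulr_sumr.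
have [B [mB SB PB]] := markov_within (exprn_gt0 2 t0) (fun w => sqr_ge0 _) Sc.
exists B; split => //.
  apply: subset_trans SB => w /= tZ.
  by rewrite -[leRHS]real_normK ?num_real// ler_sqr// nnegrE ltW.
by rewrite (le_trans PB)// lee_fin ler_wpM2r// invr_ge0 exprn_ge0 ?ltW.
Qed.

End independence.

Lemma within_prob_le {d} {T : measurableType d} {R : realType}
    (P : probability T R) A (r s : R) :
  r <= s -> within_prob P A r -> within_prob P A s.
Proof.
by move=> rs [B [mB AB PB]]; exists B; split => //; rewrite (le_trans PB)// lee_fin.
Qed.

Lemma within_prob_measure {d} {T : measurableType d} {R : realType}
    (P : probability T R) A (r : R) :
  measurable A -> within_prob P A r -> (P A <= r%:E)%E.
Proof.
by move=> mA [B [mB AB PB]]; rewrite (le_trans _ PB)// le_measure ?inE.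
Qed.

(** * The Matern kernel as a Gaussian mixture *)

Section substitutions.
Context {R : realType}.
Local Notation mu := (@lebesgue_measure R).

Lemma lebesgue_measure_shift (a : R) (A : set R) : measurable A ->
  pushforward mu ((fun x => x + a) : R -> measurableTypeR R) A = mu A.
Proof.
move=> mA; have mf : measurable_fun [set: R] ((fun x => x + a) : R -> measurableTypeR R).
  exact: measurable_funD.
apply/esym.
pose m : {measure set (measurableTypeR R) -> \bar R} := 
  pushforward mu ((fun x => x + a) : R -> measurableTypeR R).
apply: (lebesgue_measure_unique (mu := m mf)) => //= _ [[b c]] _ <-.
rewrite /pushforward.
have -> : (fun x => x + a) @^-1` `]b, c]%classic = `]b - a, c - a]%classic.
  by apply/seteqP; split=> x /=; rewrite !in_itv/= lerBrDr ltrBlDr.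
rewrite !lebesgue_measure_itv/= !lte_fin ltrD2r.
by case: ifP => // _; rewrite -!EFinD; congr (_%:E); ring.
Qed.

Lemma ge0_integral_shift (a : R) (f : R -> \bar R) : measurable_fun setT f ->
  (forall x, 0 <= f x)%E ->
  (\int[mu]_x f x = \int[mu]_x f (x + a)%R)%E.
Proof.
move=> mf f0.
transitivity (\int[mu]_(x in ((fun x => x + a)%R : R -> measurableTypeR R) @^-1` setT)
    f (x + a)%R)%E; last by rewrite preimage_setT.
rewrite -ge0_integral_pushforward//=; last exact: measurable_funD.
apply: eq_measure_integral => //=; first exact: measurable_funD.
by move=> _ A mA _; apply: esym; exact: lebesgue_measure_shift.
Qed.

Lemma ge0_integral_fold (f : R -> \bar R) : measurable_fun setT f ->
  (forall x, 0 <= f x)%E ->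
  (\int[mu]_x f x =
   \int[mu]_(x in `[0%R, +oo[) f x + \int[mu]_(x in `[0%R, +oo[) f (- x)%R)%E.
Proof.
move=> mf f0; rewrite addeC.
have mfN : measurable_fun setT (fun x : R => f (- x)) by exact: measurableT_comp.
rewrite (ge0_integration_by_substitution0 mfN)//.
under [X in (_ = X + _)%E]eq_integral do rewrite opprK.
rewrite -integral_itv_bndo_bndc; last exact: measurable_funTS.
rewrite -ge0_integral_setU//=; first by rewrite (itv_setU_setT true 0%R).
- by apply: measurable_funTS.
- apply/disj_set2P; rewrite -subset0 => x /=; rewrite !in_itv/= andbT => -[].
  by move=> /lt_geF ->.
Qed.

(** The substitution [u = expR t] is made on compact intervals; [[expR (- n), expR n]] and
    [[- n, n]] exhaust the two domains, and monotone convergence concludes. *)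
Lemma ge0_integral_expR (G : R -> R) : {in `]0, +oo[, continuous G} ->
  measurable_fun setT G -> (forall x, 0 <= G x) ->
  (\int[mu]_(u in `]0%R, +oo[) (G u)%:E = \int[mu]_t (G (expR t) * expR t)%:E)%E.
Proof.
move=> cG mG G0.
pose A (n : nat) : set R := `[expR (- n%:R), expR n%:R]%classic.
pose B (n : nat) : set R := `[(- n%:R), n%:R]%classic.
have AB n : (\int[mu]_(u in A n) (G u)%:E =
    \int[mu]_(t in B n) (G (expR t) * expR t)%:E)%E.
  have cexp (x : R) : {for x, continuous (@expR R)} by exact: continuous_expR.
  have dE : derive1 expR = expR :> (R -> R) by apply/funext => x; rewrite derive1E derive_val.
  rewrite /A integration_by_substitution_increasing//.
  - by apply: eq_integral => t _; rewrite !fctE dE.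
  - by rewrite (@le_trans _ _ 0) ?oppr_le0 ?ler0n.
  - by move=> x y _ _; rewrite ltr_expR.
  - by rewrite dE => x _; exact: continuous_expR.
  - by rewrite dE; apply/cvg_ex; exists (expR (- n%:R)); apply: cvg_at_right_filter; exact: cexp.
  - by rewrite dE; apply/cvg_ex; exists (expR n%:R); apply: cvg_at_left_filter; exact: cexp.
  - split; first by move=> x _; exact: derivable_expR.
      by apply: cvg_at_right_filter; exact: cexp.
    by apply: cvg_at_left_filter; exact: cexp.
  - apply: continuous_in_subspaceT => x; rewrite inE/= in_itv/= => /andP[x0 _].
    by apply: cG; rewrite in_itv/= andbT (lt_le_trans (expR_gt0 _) x0).
have mGe : measurable_fun setT (fun t => G (expR t) * expR t).
  apply: measurable_funM; last exact: measurable_expR.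
  by apply: measurableT_comp => //; exact: measurable_expR.
have Acvg : (\int[mu]_(u in A n) (G u)%:E @[n --> \oo] -->
    \int[mu]_(u in `]0%R, +oo[) (G u)%:E)%E.
  have -> : `]0%R, +oo[%classic = \bigcup_n A n.
    apply/seteqP; split => x /=; rewrite in_itv/= andbT.
      move=> x0; exists (Num.truncn `|ln x|).+1 => //=.
      have lnx : `|ln x| <= (Num.truncn `|ln x|).+1%:R.
        by apply/ltW; rewrite truncnS_gt.
      move: lnx; rewrite /A/= in_itv/= ler_norml => /andP[h1 h2]; apply/andP; split.
        by rewrite -[leRHS](lnK x0) ler_expR.
      by rewrite -[leLHS](lnK x0) ler_expR.
    by move=> [n _]; rewrite /A/= in_itv/= => /andP[+ _]; apply: lt_le_trans; exact: expR_gt0.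
  apply: ge0_nondecreasing_set_cvg_integral => //=.
  - move=> m n mn; apply/subsetPset => x; rewrite /A/= !in_itv/= => /andP[h1 h2].
    rewrite (le_trans _ h1)/= ?(le_trans h2)// ler_expR ?ler_nat//.
    by rewrite lerN2 ler_nat.
  - by move=> n; exact: measurable_itv.
  - by move=> n; apply/measurable_EFinP; exact: measurable_funTS.
  - by move=> n x _; rewrite lee_fin.
have Bcvg : (\int[mu]_(t in B n) (G (expR t) * expR t)%:E @[n --> \oo] -->
    \int[mu]_t (G (expR t) * expR t)%:E)%E.
  have -> : setT = \bigcup_n B n.
    apply/esym/seteqP; split => x //= _; exists (Num.truncn `|x|).+1 => //=.
    by rewrite /B/= in_itv/= -ler_norml ltW// truncnS_gt.
  apply: ge0_nondecreasing_set_cvg_integral => //=.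
  - move=> m n mn; apply/subsetPset => x; rewrite /B/= !in_itv/= => /andP[h1 h2].
    by rewrite (le_trans _ h1)/= ?(le_trans h2)// ?lerN2 ler_nat.
  - by move=> n; exact: measurable_itv.
  - by move=> n; apply/measurable_EFinP; exact: measurable_funTS.
  - by move=> n x _; rewrite lee_fin mulr_ge0// expR_ge0.
move: Acvg; rewrite (_ : (fun n => _) = fun n =>
  (\int[mu]_(t in B n) (G (expR t) * expR t)%:E)%E); last exact/funext.
move=> Acvg; exact: cvg_unique Acvg Bcvg.
Qed.

End substitutions.

Section matern_mixture.
Context {R : realType}.
Local Notation mu := (@lebesgue_measure R).

(* After [u = expR t / 2], the weight of the Gamma integral
   [2^nu * \int u^(nu - 1) expR (- u) du]. *)
Definition matern_weight (nu t : R) : R := expR (nu * t - expR t / 2).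

Lemma measurable_matern_weight nu : measurable_fun setT (matern_weight nu).
Proof.
apply: measurableT_comp; first exact: measurable_expR.
apply: measurable_funB; first exact: measurable_funM.
by apply: measurable_funM => //; exact: measurable_expR.
Qed.

Lemma integral_expRNM_lty (c : R) : 0 < c ->
  (\int[mu]_(t in `[0%R, +oo[) (expR (- (c * t)))%:E < +oo)%E.
Proof.
move=> c0; have /integrableP[_] := integrable_exponential_pdf c0.
rewrite (_ : (\int[mu]_x _)%E =
  (\int[mu]_(t in `[0%R, +oo[) (c%:E * (expR (- (c * t)))%:E))%E); last first.
  rewrite [RHS]integral_mkcond; apply: eq_integral => x _ /=.
  rewrite /exponential_pdf !patchE; case: ifPn => _; last by rewrite normr0.
  by rewrite ger0_norm ?mulr_ge0 ?expR_ge0 ?(ltW c0)// mulNr.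
rewrite ge0_integralZl//; last 2 first.
- apply/measurable_EFinP; apply: measurable_funTS; apply: measurableT_comp.
    exact: measurable_expR.
  by apply: measurableT_comp => //; exact: measurable_funM.
- by rewrite lee_fin ltW.
have : (0 <= \int[mu]_(t in `[0%R, +oo[) (expR (- (c * t)))%:E)%E.
  by apply: integral_ge0 => x _; rewrite lee_fin expR_ge0.
case: (\int[mu]_(t in `[0%R, +oo[) _)%E => [r _ _|_|//]; first by rewrite ltry.
by rewrite gt0_muley ?lte_fin// ltxx.
Qed.

Lemma matern_weight_integrable (nu : R) : 0 < nu ->
  exists2 Z, 0 < Z & has_integral mu setT (matern_weight nu) Z.
Proof.
move=> nu0; have mw := measurable_matern_weight nu.
have w0 t : 0 <= matern_weight nu t by exact: expR_ge0.
have wfin : (\int[mu]_t (matern_weight nu t)%:E < +oo)%E.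
  rewrite ge0_integral_fold//; last first.
    by apply/measurable_EFinP.
  apply: lte_add_pinfty; last first.
    apply: le_lt_trans (integral_expRNM_lty nu0); apply: ge0_le_integral => //.
    - by move=> t _; rewrite lee_fin.
    - apply/measurable_EFinP; apply: measurable_funTS.
      by apply: measurableT_comp mw _.
    - apply/measurable_EFinP; apply: measurable_funTS; apply: measurableT_comp.
        exact: measurable_expR.
      by apply: measurableT_comp => //; exact: measurable_funM.
    - move=> t _; rewrite lee_fin ler_expR mulrN lerBlDr lerDl.
      by rewrite divr_ge0 ?expR_ge0.
  (* From [expR t / 2 >= t^2 / 4] and the square of [t / 2 - (nu + 1)], the weight is at most
     [expR ((nu + 1)^2 - t)]. *)
  apply: (@le_lt_trans _ _ (\int[mu]_(t in `[0%R, +oo[)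
      ((expR ((nu + 1) ^+ 2))%:E * (expR (- (1 * t)))%:E))%E).
    apply: ge0_le_integral => //.
    - by move=> t _; rewrite lee_fin.
    - by apply/measurable_EFinP; exact: measurable_funTS.
    - apply/measurable_EFinP; apply: measurable_funTS; apply: measurable_funM => //.
      apply: measurableT_comp; first exact: measurable_expR.
      by apply: measurableT_comp => //; exact: measurable_funM.
    - move=> t; rewrite /= in_itv/= andbT => t0.
      rewrite -EFinM lee_fin -expRD ler_expR mul1r.
      have := expR_ge1Dxn 1 t0; rewrite (_ : 2`!%:R = 2 :> R)//.
      by have := sqr_ge0 (t / 2 - (nu + 1)); lra.
  rewrite ge0_integralZl//; last first.
    apply/measurable_EFinP; apply: measurable_funTS; apply: measurableT_comp.
      exact: measurable_expR.
    by apply: measurableT_comp => //; exact: measurable_funM.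
  rewrite lte_mul_pinfty// ?lee_fin ?expR_ge0//.
  exact: integral_expRNM_lty.
have wi : mu.-integrable setT (EFin \o matern_weight nu).
  apply/integrableP; split; first exact/measurable_EFinP.
  by under eq_integral do rewrite /= ger0_norm//.
have wZ := integrable_has_integral measurableT wi.
exists (fine (\int[mu]_x (matern_weight nu x)%:E)%E) => //.
(* A minorant on the unit interval, which makes the normalization strictly positive. *)
have ge0_I01 x : (\1_(`[0%R, 1%R]%classic) x * expR (- (expR 1 / 2)) : R) <= matern_weight nu x.
  rewrite indicE mem_setE; case: (boolP (x \in `[0, 1])) => [|_]; last by rewrite mul0r.
  rewrite in_itv/= => /andP[x0 x1]; rewrite mul1r ler_expR.
  rewrite lerBrDl -lerBrDr opprK addrC.
  have : expR x <= expR 1 by rewrite ler_expR.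
  have := mulr_ge0 (ltW nu0) x0; lra.
have i01 : has_integral mu setT (fun x => expR (- (expR 1 / 2)) * \1_(`[0%R, 1%R]%classic) x) (expR (- (expR 1 / 2)) * 1).
  apply: has_integralZl => //; split; first exact: integrable_indic_itv.
  transitivity (mu `[0%R, 1%R]%classic).
    by rewrite integral_indic ?setIT//; exact: measurable_itv.
  by rewrite lebesgue_measure_itv/= lte_fin ltr01 -EFinD subr0.
apply: lt_le_trans (has_integral_le measurableT _ i01 wZ).
  by rewrite mulr1 expR_gt0.
by move=> x _; rewrite mulrC.
Qed.

Lemma gamma_fun_weight (nu Z : R) : 0 < nu ->
  has_integral mu setT (matern_weight nu) Z ->
  gamma_fun nu = 2 `^ (- nu) * Z.
Proof.
move=> nu0 [_ wZ]; rewrite /gamma_fun /Rintegral.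
pose G (u : R) := expR ((nu - 1) * ln u) * expR (- u).
have mG : measurable_fun setT G.
  apply: measurable_funM.
    apply: measurableT_comp; first exact: measurable_expR.
    by apply: measurable_funM => //; exact: measurable_ln.
  by apply: measurableT_comp; [exact: measurable_expR|].
have cG : {in `]0, +oo[, continuous G}.
  move=> u; rewrite in_itv/= andbT => u0; apply: cvgM.
    apply: continuous_comp; last exact: continuous_expR.
    by apply: cvgM; [exact: cvg_cst|exact: continuous_ln].
  by apply: continuous_comp; [exact: opp_continuous|exact: continuous_expR].
rewrite (_ : (\int[mu]_(t in _) _)%E = (\int[mu]_(t in `]0%R, +oo[) (G t)%:E)%E); last first.
  apply: eq_integral => t; rewrite inE/= in_itv/= andbT => t0.
  by rewrite /powR gt_eqF.
rewrite ge0_integral_expR//; last by move=> u; rewrite mulr_ge0 ?expR_ge0.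
(* Replacing [t] by [t - ln 2] turns [u = expR t] into [u = expR t / 2] and produces the factor
   [2^(- nu)]. *)
rewrite (ge0_integral_shift (- ln 2)); last 2 first.
- apply/measurable_EFinP; apply: measurable_funM; last exact: measurable_expR.
  by apply: measurableT_comp => //; exact: measurable_expR.
- by move=> t; rewrite lee_fin !mulr_ge0 ?expR_ge0.
under eq_integral => t _.
  rewrite (_ : (_ * _)%R = (2 `^ (- nu) * matern_weight nu t)%R); last first.
    rewrite /G /matern_weight /powR gt_eqF// expRK -!expRD; congr expR.
    by rewrite expRD expRN lnK ?posrE//; ring.
  rewrite EFinM; over.
rewrite ge0_integralZl//=; last 2 first.
- by apply/measurable_EFinP; exact: measurable_matern_weight.
- by move=> t _; rewrite lee_fin expR_ge0.
by rewrite wZ.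
Qed.

Lemma besselK_weight (nu r a : R) : 0 < r ->
  has_integral mu setT
    (fun t => matern_weight nu t * expR (- (expR (- t) / 2) * r ^+ 2)) a ->
  r `^ nu * besselK nu r = a / 2.
Proof.
move=> r0 [_ wa]; rewrite /besselK /Rintegral.
pose f (t : R) := expR (- r * cosh t + nu * t).
have mf : measurable_fun setT f.
  apply: measurableT_comp; first exact: measurable_expR.
  apply: measurable_funD; last exact: measurable_funM.
  apply: measurable_funM => //; apply: measurable_funM => //.
  apply: measurable_funD; first exact: measurable_expR.
  by apply: measurableT_comp; [exact: measurable_expR|].
have f0 t : (0 <= (f t)%:E)%E by rewrite lee_fin expR_ge0.
have mfN : measurable_fun setT (fun t : R => f (- t)) by exact: measurableT_comp mf _.
(* [cosh (nu t)] is the even part of [expR (nu t)], and [cosh t] is even, so the half-line integral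
   is half of one over the whole line. *)
have -> : (\int[mu]_(t in `[0%R, +oo[) (expR (- r * cosh t) * cosh (nu * t))%:E =
  2^-1%:E * \int[mu]_t (f t)%:E)%E.
  rewrite ge0_integral_fold//; last exact/measurable_EFinP.
  rewrite -ge0_integralD//; last 2 first.
  - by apply/measurable_EFinP; exact: measurable_funTS.
  - by apply/measurable_EFinP; exact: measurable_funTS.
  rewrite -ge0_integralZl//; last 2 first.
  - apply: emeasurable_funD.
      by apply/measurable_EFinP; exact: measurable_funTS.
    by apply/measurable_EFinP; exact: measurable_funTS.
  - by move=> t _; rewrite adde_ge0.
  apply: eq_integral => t _; rewrite -EFinD -EFinM; congr EFin.
  rewrite /f /cosh opprK (addrC (expR (- t))) !expRD mulrN -mulrDr.
  by ring.
(* The shift uses [r cosh (t - ln r) = expR t / 2 + r^2 expR (- t) / 2], which separates the weight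
   from a Gaussian in [r]. *)
rewrite (ge0_integral_shift (- ln r))//; last exact/measurable_EFinP.
under eq_integral => t _.
  rewrite (_ : f _ = (r `^ nu)^-1 * (matern_weight nu t *
      expR (- (expR (- t) / 2) * r ^+ 2))); last first.
    rewrite /f /matern_weight /powR gt_eqF// -expRN -!expRD; congr expR.
    rewrite /cosh opprB addrC !expRD !expRN lnK ?posrE//.
    by field; rewrite !gt_eqF ?expR_gt0.
  rewrite EFinM; over.
rewrite ge0_integralZl//=; last 3 first.
- apply/measurable_EFinP; apply: measurable_funM; first exact: measurable_matern_weight.
  apply: measurableT_comp; first exact: measurable_expR.
  apply: measurable_funM => //; apply: measurableT_comp => //.
  by apply: measurable_funM => //; apply: measurableT_comp; [exact: measurable_expR|].
- by move=> t _; rewrite lee_fin mulr_ge0 ?expR_ge0.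
- by rewrite lee_fin invr_ge0 powR_ge0.
by rewrite wa /=; field; rewrite gt_eqF// powR_gt0.
Qed.

(** The factor [2^(1 - nu)], the value [2^(- nu) Z] of the Gamma integral and the 1/2 of the Bessel
    integral collapse to [1 / Z]. As [Z] is the total weight, the same formula gives [sigma2] at
    coincident points. *)
Lemma maternE (d : nat) (sigma2 phi nu Z : R) (s s' : 'rV[R]_d) :
  0 < phi -> 0 < nu -> 0 < Z -> has_integral mu setT (matern_weight nu) Z ->
  has_integral mu setT (fun t => sigma2 / Z * matern_weight nu t *
     expR (- (phi ^+ 2 * expR (- t) / 2) * enorm (s - s') ^+ 2))
    (matern sigma2 phi nu%:E s s').
Proof.
move=> phi0 nu0 Z0 wZ; rewrite /matern.
have [->|ss'] := eqVneq s s'.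
  rewrite subrr (_ : enorm (0 : 'rV[R]_d) = 0); last first.
    rewrite /enorm big1 ?sqrtr0// => i _; rewrite big1// => j _.
    by rewrite mxE expr0n.
  rewrite -{2}(divfK (lt0r_neq0 Z0) sigma2).
  apply: has_integral_eq (has_integralZl _ (sigma2 / Z) wZ) => //= t _.
  by rewrite expr0n/= mulr0 expR0 mulr1.
have r0 : 0 < phi * enorm (s - s').
  rewrite mulr_gt0// /enorm sqrtr_gt0 big_ord1.
  have : s - s' != 0 by rewrite subr_eq0.
  case/rV0Pn => j sj; rewrite (bigD1 j)//= ltr_pwDl//.
    by rewrite exprn_even_gt0.
  by rewrite sumr_ge0// => i _; rewrite sqr_ge0.
set r := phi * _ in r0 *.
have [|x _|a wa _] := dominated_has_integral measurableT _ _ wZ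
  (f := fun t : measurableTypeR R =>
    matern_weight nu t * expR (- (expR (- t) / 2) * r ^+ 2)).
- apply: measurable_funM; first exact: measurable_matern_weight.
  apply: measurableT_comp; first exact: measurable_expR.
  apply: measurable_funM => //; apply: measurableT_comp => //.
  by apply: measurable_funM => //; apply: measurableT_comp; [exact: measurable_expR|].
- rewrite ger0_norm ?mulr_ge0 ?expR_ge0// ler_piMr ?expR_ge0//.
  by rewrite -expR0 ler_expR mulNr oppr_le0 mulr_ge0 ?sqr_ge0// divr_ge0 ?expR_ge0.
rewrite -mulrA (besselK_weight r0 wa) (gamma_fun_weight nu0 wZ).
rewrite (_ : _ * (a / 2) = sigma2 / Z * a); last first.
  rewrite powRD; last by rewrite pnatr_eq0 implybT.
  rewrite powRr1// invfM; field.
  by rewrite gt_eqF//= gt_eqF// powR_gt0.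
apply: has_integral_eq (has_integralZl _ (sigma2 / Z) wa) => // t _ /=.
rewrite mulrA; congr (_ * expR _).
by rewrite /r exprMn; ring.
Qed.

End matern_mixture.

(** * Universality of Gaussian mixtures *)

Section polynomial_approximation.
Context {R : realType} {d : nat}.
Implicit Types (s x y : 'rV[R]_d) (f G : 'rV[R]_d -> R) (D : set 'rV[R]_d).

(** Distances are measured by the squared norm, which is polynomial and is what Gaussian kernels
    depend on. The price is a factor 2 in the triangle inequality. *)
Definition sqn s : R := \sum_l s ord0 l ^+ 2.

Lemma enorm_sqr s : enorm s ^+ 2 = sqn s.
Proof.
rewrite /enorm big_ord1 sqr_sqrtr//.
by apply: sumr_ge0 => i _; rewrite sqr_ge0.
Qed.

Lemma sqn_ge0 s : 0 <= sqn s.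
Proof. by apply: sumr_ge0 => i _; rewrite sqr_ge0. Qed.

Lemma sqnN s : sqn (- s) = sqn s.
Proof. by apply: eq_bigr => i _; rewrite mxE sqrrN. Qed.

Lemma sqnD x y : sqn (x + y) <= 2 * (sqn x + sqn y).
Proof.
rewrite -big_split/= mulr_sumr; apply: ler_sum => i _; rewrite mxE.
by have := sqr_ge0 (x ord0 i - y ord0 i); rewrite sqrrB sqrrD; lra.
Qed.

Lemma sqn_coord s l : s ord0 l ^+ 2 <= sqn s.
Proof.
by rewrite /sqn (bigD1 l)//= lerDl sumr_ge0// => i _; rewrite sqr_ge0.
Qed.

Lemma continuous_sum_fun (T : topologicalType) (I : Type) (r : seq I)
    (F : I -> T -> R) :
  (forall i, continuous (F i)) -> continuous (fun t => \sum_(i <- r) F i t).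
Proof.
move=> cF; elim: r => [|i r ih].
  rewrite (_ : (fun _ => _) = cst 0); first exact: cst_continuous.
  by apply/funext => t; rewrite big_nil.
rewrite (_ : (fun _ => _) = fun t => F i t + \sum_(j <- r) F j t); last first.
  by apply/funext => t; rewrite big_cons.
by move=> t; apply: cvgD; [exact: cF|exact: ih].
Qed.

Lemma continuous_sqnB y : continuous (fun s => sqn (s - y)).
Proof.
apply: continuous_sum_fun => l; rewrite (_ : (fun _ => _) =
  fun s : 'rV[R]_d => (s ord0 l - y ord0 l) ^+ 2); last first.
  by apply/funext => s; rewrite !mxE.
move=> s; have cs : {for s, continuous (fun t : 'rV[R]_d => t ord0 l - y ord0 l)}.
  have cl : continuous (fun t : 'rV[R]_d => t ord0 l) := @coord_continuous _ _ _ _ _.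
  by apply: continuousB; [exact: cl|exact: cst_continuous].
exact: (cvgM cs cs).
Qed.

Lemma open_sqnB y (r : R) : open [set s | sqn (s - y) < r].
Proof.
rewrite (_ : [set s | _] = (fun s => sqn (s - y)) @^-1` [set z | z < r])//.
apply: open_comp; first by move=> s _; exact: continuous_sqnB.
exact: open_lt.
Qed.

Lemma near_sqnB (x : 'rV[R]_d) (U : set 'rV[R]_d) : nbhs x U ->
  exists2 e : R, 0 < e & forall s, sqn (s - x) < e -> U s.
Proof.
move=> /nbhs_ballP[e /= e0 xU]; exists (e ^+ 2); first by rewrite exprn_gt0.
move=> s sx; apply: xU; split => // i j.
rewrite (ord1 i) /ball/= distrC -ltr_sqr ?nnegrE ?(ltW e0)//.
rewrite real_normK ?num_real// (le_lt_trans _ sx)//.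
by have := sqn_coord (s - x) j; rewrite !mxE.
Qed.

Lemma compact_unif_cont D G (e : R) : compact D -> {within D, continuous G} ->
  0 < e -> exists2 r : R, 0 < r &
    forall x y, D x -> D y -> sqn (y - x) < r -> `|G y - G x| <= e.
Proof.
move=> cD /subspace_continuousP cG e0.
have e20 : 0 < e / 2 by rewrite divr_gt0.
pose P (r : R) x := D x -> forall y, D y -> sqn (y - x) < r -> `|G y - G x| <= e.
suff [r [r0 rP]] : exists r : R, 0 < r /\ D `<=` P r.
  by exists r => // x y Dx Dy; exact: rP.
have nc : \forall r \near (0:R)^'+, D `<=` P r.
  apply: (compact_near_coveringP D).1 => // x Dx.
  have /cvgrPdist_lt/(_ _ e20) Gx := cG _ Dx.
  have /near_sqnB[q q0 xq] : nbhs x (fun t => D t -> `|G x - G t| < e / 2) := Gx.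
  (* Two squared distances below [q / 4] combine to one below [q], by [sqnD]. *)
  have q40 : 0 < q / 4 by rewrite divr_gt0.
  exists ([set x' | sqn (x' - x) < q / 4], [set r | r < q / 4]) => /=.
    split; last exact: nbhs_right_lt.
    apply: open_nbhs_nbhs; split; first exact: open_sqnB.
    by rewrite /= subrr /sqn big1// => l _; rewrite mxE expr0n.
  move=> [x' r] [/= x'x rq] Dx' y Dy yx'.
  have Gx' : `|G x - G x'| < e / 2 by apply: xq => //; lra.
  have Gy : `|G x - G y| < e / 2.
    apply: xq => //; have := sqnD (y - x') (x' - x).
    by rewrite addrA subrK; lra.
  rewrite (_ : G y - G x' = (G x - G x') - (G x - G y)); last by ring.
  by rewrite (le_trans (ler_normB _ _))//; lra.
near (0:R)^'+ => r; exists r; split; first by near: r; exact: nbhs_right_gt.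
by near: r.
Unshelve. all: by end_near. Qed.

Lemma compact_net D (r : R) : compact D -> 0 < r ->
  exists2 ys : seq 'rV[R]_d, (forall y, y \in ys -> D y) &
    forall s, D s -> exists2 y, y \in ys & sqn (s - y) < r.
Proof.
move=> cD r0; have := cD; rewrite compact_cover.
move=> /(_ _ D (fun y => [set s | sqn (s - y) < r])) [||E ED DE].
- by move=> y _; exact: open_sqnB.
- move=> s Ds; exists s => //=; rewrite subrr /sqn big1// => l _.
  by rewrite mxE expr0n.
- exists (enum_fset E) => [y yE|s /DE[y /= yE sy]]; last by exists y.
  by have := ED _ yE; rewrite inE.
Qed.

(** Polynomial functions as a closure, so that membership in the kernel space is proved by induction
    on their construction and not on coefficients. *)
Inductive polyfun : ('rV[R]_d -> R) -> Prop :=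
| polyfun_cst c : polyfun (fun=> c)
| polyfun_coord l : polyfun (fun s => s ord0 l)
| polyfunD f1 f2 : polyfun f1 -> polyfun f2 -> polyfun (fun s => f1 s + f2 s)
| polyfunM f1 f2 : polyfun f1 -> polyfun f2 -> polyfun (fun s => f1 s * f2 s).

Lemma polyfun_sum (I : Type) (r : seq I) (F : I -> 'rV[R]_d -> R) :
  (forall i, polyfun (F i)) -> polyfun (fun s => \sum_(i <- r) F i s).
Proof.
move=> cF; elim: r => [|i r ih].
  under eq_fun do rewrite big_nil; exact: polyfun_cst.
by under eq_fun do rewrite big_cons; exact: polyfunD.
Qed.

Lemma polyfunX f n : polyfun f -> polyfun (fun s => f s ^+ n).
Proof.
move=> pf; elim: n => [|n ih]; first by under eq_fun do rewrite expr0; exact: polyfun_cst.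
by under eq_fun do rewrite exprS; exact: polyfunM.
Qed.

Lemma polyfun_sqnB y : polyfun (fun s => sqn (s - y)).
Proof.
apply: polyfun_sum => l; apply: polyfunX; under eq_fun do rewrite !mxE.
by apply: polyfunD; [exact: polyfun_coord|exact: polyfun_cst].
Qed.

Lemma exprn_small (x e : R) : 0 <= x -> x < 1 -> 0 < e ->
  exists N : nat, x ^+ N <= e.
Proof.
move=> x0 x1 e0; have /cvgrPdist_le/(_ _ e0) : (x ^+ n @[n --> \oo] --> 0).
  by apply: cvg_expr; rewrite ger0_norm.
move=> [N _ /(_ N)]/= /(_ (leqnn N)).
by rewrite sub0r normrN ger0_norm ?exprn_ge0// => h; exists N.
Qed.

(* Weighted averages of the values of [G] on a net, with weights
   [(1 - |s - y|^2 / M)^N] concentrating around [s]; their normalization is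
   inverted by a geometric sum. *)
Lemma polyfun_dense D G (e : R) : compact D -> {within D, continuous G} ->
  0 < e -> exists2 f, polyfun f & forall s, D s -> `|G s - f s| <= e.
Proof.
move=> cD cG e0; pose e3 := e / 3.
have e30 : 0 < e3 by rewrite divr_gt0.
have [r r0 Gr] := compact_unif_cont cD cG e30.
have r40 : 0 < r / 4 by rewrite divr_gt0.
have [ys ysD ysnet] := compact_net cD r40.
pose B : R := \sum_(y <- ys) `|G y| + e3.
have B0 : 0 < B by rewrite ltr_wpDl// sumr_ge0.
have GyB y : y \in ys -> `|G y| <= B.
  move=> yys; rewrite /B (big_rem y)//= -addrA lerDl addr_ge0 ?(ltW e30)//.
  exact: sumr_ge0.
have GB s : D s -> `|G s| <= B.
  move=> Ds; have [y yys sy] := ysnet _ Ds.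
  have Gsy : `|G s - G y| <= e3 by apply: Gr => //; [exact: ysD|lra].
  rewrite -[G s](subrK (G y)) (le_trans (ler_normD _ _))// addrC lerD//.
  by rewrite (big_rem y)//= lerDl sumr_ge0.
(* Large enough to dominate every [sqn (s - y)] with [s] in [D] and [y] in the net, so that the
   weights lie in [0, 1]. *)
pose M : R := r + 2 * \sum_(y <- ys) \sum_(z <- ys) sqn (y - z).
have sumM0 : 0 <= \sum_(y <- ys) \sum_(z <- ys) sqn (y - z).
  by do 2 (apply: sumr_ge0 => ? _); exact: sqn_ge0.
have M0 : 0 < M by rewrite ltr_wpDr// mulr_ge0.
have rM : r <= M by rewrite lerDl mulr_ge0.
have sM s y : D s -> y \in ys -> sqn (s - y) <= M.
  move=> Ds yys; have [z zys sz] := ysnet _ Ds.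
  have := sqnD (s - z) (z - y); rewrite addrA subrK => /le_trans; apply.
  have : sqn (z - y) <= \sum_(y <- ys) \sum_(z <- ys) sqn (y - z).
    rewrite (big_rem z)//= (big_rem y)//= -addrA lerDl addr_ge0//.
      by apply: sumr_ge0 => ? _; exact: sqn_ge0.
    by do 2 (apply: sumr_ge0 => ? _); exact: sqn_ge0.
  by rewrite /M; lra.
pose m : R := (size ys).+1%:R; have m0 : 0 < m by rewrite ltr0n.
(* Net points at squared distance at least [r] have weight at most [a1^N], while some net point
   within [r / 4] has weight at least [a2^N]. As [a1 < a2], a large [N] makes the far points
   negligible. *)
pose a1 := 1 - r / M; pose a2 := 1 - r / (4 * M).
have rM1 : r / M <= 1 by rewrite ler_pdivrMr// mul1r.
have rM0 : 0 < r / M by rewrite divr_gt0.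
have r4M : r / (4 * M) = r / M / 4 by field; rewrite gt_eqF.
have a10 : 0 <= a1 by rewrite subr_ge0.
have a20 : 0 < a2 by rewrite /a2 r4M; lra.
have a12 : a1 < a2 by rewrite /a1 /a2 r4M; lra.
have a21 : a2 <= 1 by rewrite /a2 r4M; lra.
have [|||N thN] := @exprn_small (a1 / a2) (e3 / (2 * B * m)).
- by rewrite divr_ge0// ltW.
- by rewrite ltr_pdivrMr// mul1r.
- by rewrite divr_gt0// !mulr_gt0.
pose phi y s := (1 - sqn (s - y) / M) ^+ N.
pose q s := \sum_(y <- ys) phi y s.
pose num s := \sum_(y <- ys) G y * phi y s.
pose dl := a2 ^+ N; have dl0 : 0 < dl by rewrite exprn_gt0.
have dl1 : dl <= 1 by rewrite exprn_ile1// ltW.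
have m1 : 1 <= m by rewrite ler1n.
have dlm : dl / m <= 1 by rewrite ler_pdivrMr// mul1r (le_trans dl1).
(* The total weight [q] lies in [[dl, m]], so [1 - q / m] is uniformly below 1 and [L] terms of the
   geometric series for [m / q] suffice. *)
have [|||L LB] := @exprn_small (1 - dl / m) (e3 / B).
- by rewrite subr_ge0.
- by rewrite ltrBlDr ltrDl divr_gt0.
- by rewrite divr_gt0.
exists (fun s => num s * (m^-1 * \sum_(k < L) (1 - q s / m) ^+ k)).
  have pphi y : polyfun (phi y).
    apply: polyfunX; apply: polyfunD; first exact: polyfun_cst.
    rewrite (_ : (fun s => _) = fun s => (- M^-1) * sqn (s - y)).
      by apply: polyfunM; [exact: polyfun_cst|exact: polyfun_sqnB].
    by apply/funext => s; rewrite mulNr mulrC.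
  apply: polyfunM.
    by apply: polyfun_sum => y; apply: polyfunM; [exact: polyfun_cst|].
  apply: polyfunM; first exact: polyfun_cst.
  apply: polyfun_sum => k; apply: polyfunX.
  apply: polyfunD; first exact: polyfun_cst.
  rewrite (_ : (fun s => _) = fun s => (- m^-1) * q s).
    by apply: polyfunM; [exact: polyfun_cst|exact: polyfun_sum].
  by apply/funext => s; rewrite mulNr mulrC.
move=> s Ds.
have phi01 y : y \in ys -> 0 <= phi y s <= 1.
  move=> yys; have h : 0 <= 1 - sqn (s - y) / M.
    by rewrite subr_ge0 ler_pdivrMr// mul1r sM.
  rewrite exprn_ge0//= exprn_ile1// lerBlDr lerDl divr_ge0 ?sqn_ge0//.
  exact: ltW.
have phi0 y : y \in ys -> 0 <= phi y s by move=> /phi01/andP[].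
have q_ge : dl <= q s.
  have [y yys sy] := ysnet _ Ds; rewrite /q (big_rem y)//= -[dl]addr0 lerD//.
    rewrite lerXn2r ?nnegrE ?(ltW a20)//.
      by rewrite subr_ge0 ler_pdivrMr// mul1r sM.
    rewrite lerD2l lerN2 r4M ler_pdivrMr// -!mulrA (mulrCA M^-1).
    by rewrite mulVf ?gt_eqF// mulr1; lra.
  by rewrite big_seq sumr_ge0// => z /mem_rem/phi0.
have q0 : 0 < q s by exact: lt_le_trans q_ge.
have qm : q s <= m.
  rewrite (@le_trans _ _ (\sum_(y <- ys) 1))//.
    by rewrite /q big_seq [leRHS]big_seq ler_sum// => y /phi01/andP[].
  by rewrite big_const_seq count_predT iter_addr_0 /m -natr1 lerDl.
have numB : `|num s| <= B * q s.
  rewrite (le_trans (ler_norm_sum _ _ _))// mulr_sumr big_seq [leRHS]big_seq.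
  by apply: ler_sum => y yys; rewrite normrM (ger0_norm (phi0 _ yys)) ler_wpM2r ?phi0 ?GyB.
have near_far : `|num s - G s * q s| <= 2 * e3 * q s.
  have -> : num s - G s * q s = \sum_(y <- ys) (G y - G s) * phi y s.
    by rewrite mulr_sumr -sumrB; apply: eq_bigr => y _; rewrite mulrBl.
  rewrite (le_trans (ler_norm_sum _ _ _))//.
  apply: (@le_trans _ _ (\sum_(y <- ys) (e3 * phi y s + 2 * B * a1 ^+ N))).
    rewrite big_seq [leRHS]big_seq; apply: ler_sum => y yys.
    rewrite normrM (ger0_norm (phi0 _ yys)).
    have [sy|sy] := ltP (sqn (s - y)) r.
      rewrite -[leLHS]addr0 lerD//.
        by rewrite ler_wpM2r ?phi0// distrC Gr//; exact: ysD.
      by rewrite mulr_ge0 ?exprn_ge0// mulr_ge0// ltW.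
    rewrite -[leLHS]add0r; apply: lerD; first by rewrite mulr_ge0 ?phi0 ?(ltW e30).
    rewrite ler_pM ?phi0//.
      by have := ler_normB (G y) (G s); have := GyB _ yys; have := GB _ Ds; lra.
    rewrite lerXn2r ?nnegrE//.
      by rewrite subr_ge0 ler_pdivrMr// mul1r sM.
    by rewrite lerD2l lerN2 ler_wpM2r ?invr_ge0 ?(ltW M0).
  rewrite big_split/= -mulr_sumr -/(q s) big_const_seq count_predT iter_addr_0.
  have -> : 2 * e3 * q s = e3 * q s + e3 * q s by ring.
  rewrite lerD2l -[leLHS]mulr_natr.
  have a1E : a1 ^+ N = (a1 / a2) ^+ N * dl.
    by rewrite /dl -exprMn divfK// gt_eqF.
  rewrite a1E.
  apply: (@le_trans _ _ (2 * B * ((e3 / (2 * B * m)) * q s) * m)).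
    rewrite ler_pM ?ler0n//.
    - by rewrite !mulr_ge0 ?exprn_ge0 ?divr_ge0 ?(ltW a20) ?(ltW B0) ?(ltW dl0).
    - rewrite ler_wpM2l ?mulr_ge0 ?(ltW B0)// ler_pM ?(ltW dl0)//.
      by rewrite exprn_ge0// divr_ge0// ltW.
    - by rewrite ler_nat.
  by rewrite le_eqVlt; apply/orP; left; apply/eqP; field; rewrite !gt_eqF.
have geoE : m^-1 * \sum_(k < L) (1 - q s / m) ^+ k =
    (1 - (1 - q s / m) ^+ L) / q s.
  have := subrXX 1 (1 - q s / m) L; rewrite expr1n => ->.
  rewrite (_ : 1 - (1 - q s / m) = q s / m); last by ring.
  under [X in _ = _ * X / _]eq_bigr do rewrite expr1n mul1r.
  by field; rewrite !gt_eqF.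
rewrite geoE.
(* The error of the weighted average, at most [2 e3], plus that of the truncated series, at most
   [e3]. *)
have -> : G s - num s * ((1 - (1 - q s / m) ^+ L) / q s) =
    - ((num s - G s * q s) / q s) + (num s / q s) * (1 - q s / m) ^+ L.
  by field; rewrite gt_eqF.
rewrite (le_trans (ler_normD _ _))// normrN.
rewrite (_ : e = 2 * e3 + e3); last by rewrite /e3; field.
have qNm : `|(q s)^-1| = (q s)^-1 by rewrite ger0_norm// invr_ge0 ltW.
have qm01 : 0 <= 1 - q s / m by rewrite subr_ge0 ler_pdivrMr// mul1r.
apply: lerD; first by rewrite normrM qNm ler_pdivrMr.
rewrite !normrM qNm (ger0_norm (exprn_ge0 _ qm01)).
apply: (@le_trans _ _ (B * (e3 / B))); last first.
  by rewrite mulrC divfK// gt_eqF.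
apply: ler_pM; rewrite ?mulr_ge0 ?invr_ge0 ?(ltW q0) ?exprn_ge0//.
  by rewrite ler_pdivrMr.
rewrite (le_trans _ LB)// lerXn2r ?nnegrE ?subr_ge0//.
  by rewrite ler_pdivrMr// mul1r.
by rewrite lerD2l lerN2 ler_wpM2r ?invr_ge0 ?(ltW m0).
Qed.

End polynomial_approximation.

(** * Reproducing kernel spaces of Gaussian mixtures *)

Section kernels.
Context {R : realType} {d : nat}.
Implicit Types (K : 'rV[R]_d -> 'rV[R]_d -> R) (D : set 'rV[R]_d).

Definition kquad K n (s : 'I_n -> 'rV[R]_d) (a : 'I_n -> R) : R :=
  \sum_i \sum_j a i * a j * K (s i) (s j).

(** Membership in the reproducing kernel space in dual form, by boundedness on finite combinations
    of kernel sections. No Hilbert space is constructed, and this is the inequality [reg_inv_rkhs]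
    takes. *)
Definition rkhs K (f : 'rV[R]_d -> R) := exists2 C, 0 <= C &
  forall n (s : 'I_n -> 'rV[R]_d) a,
    (\sum_i a i * f (s i)) ^+ 2 <= C * kquad K s a.

Lemma eq_rkhs K f g : f =1 g -> rkhs K f -> rkhs K g.
Proof. by move=> /funext ->. Qed.

Lemma rkhsZ K k f : rkhs K f -> rkhs K (fun s => k * f s).
Proof.
move=> [C C0 fC]; exists (k ^+ 2 * C) => [|n s a]; first by rewrite mulr_ge0 ?sqr_ge0.
rewrite (_ : \sum_i _ = k * \sum_i a i * f (s i)); last first.
  by rewrite mulr_sumr; apply: eq_bigr => i _; rewrite mulrCA.
by rewrite exprMn -[leRHS]mulrA ler_wpM2l ?sqr_ge0.
Qed.

Lemma rkhsD K f g : rkhs K f -> rkhs K g -> rkhs K (fun s => f s + g s).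
Proof.
move=> [C C0 fC] [B B0 gB]; exists (2 * (C + B)) => [|n s a].
  by rewrite mulr_ge0 ?addr_ge0.
have -> : \sum_i a i * (f (s i) + g (s i)) =
    \sum_i a i * f (s i) + \sum_i a i * g (s i).
  by rewrite -big_split; apply: eq_bigr => i _; rewrite mulrDr.
have := fC n s a; have := gB n s a.
set x := \sum_i _; set y := \sum_i _; have := sqr_ge0 (x - y).
rewrite (_ : 2 * (C + B) * _ = 2 * (C * kquad K s a) + 2 * (B * kquad K s a));
  last by ring.
by rewrite sqrrB sqrrD; lra.
Qed.

Definition monom (J : seq 'I_d) (s : 'rV[R]_d) : R := \prod_(l <- J) s ord0 l.

(** Summing over words of length [m] instead of multi-indices avoids multinomial coefficients. *)
Lemma dot_expansion (x y : 'rV[R]_d) m :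
  (\sum_l x ord0 l * y ord0 l) ^+ m =
  \sum_(f : {ffun 'I_m -> 'I_d})
    (\prod_k x ord0 (f k)) * (\prod_k y ord0 (f k)).
Proof.
rewrite -[in LHS](card_ord m) -prodr_const bigA_distr_bigA/=.
by apply: eq_bigr => f _; rewrite -big_split.
Qed.

Lemma cvg_sum_fun (I : Type) (r : seq I) (F : I -> nat -> R) (l : I -> R) :
  (forall i, F i n @[n --> \oo] --> l i) ->
  (\sum_(i <- r) F i n) @[n --> \oo] --> \sum_(i <- r) l i.
Proof.
move=> Fl; elim: r => [|i r ih].
  by rewrite big_nil; under eq_fun do rewrite big_nil; exact: cvg_cst.
by rewrite big_cons; under eq_fun do rewrite big_cons; exact: cvgD.
Qed.

(* Feature expansion of the Gaussian kernel: [expR (2 c <x, y>)] is a power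
   series in [<x, y>] with nonnegative coefficients. *)
Lemma gaussian_kquad_ge (c : R) n (s : 'I_n -> 'rV[R]_d) a (J : seq 'I_d) :
  0 <= c ->
  (2 * c) ^+ size J / (size J)`!%:R *
    (\sum_i a i * (expR (- (c * sqn (s i))) * monom J (s i))) ^+ 2 <=
  kquad (fun x y => expR (- (c * sqn (x - y)))) s a.
Proof.
move=> c0; pose b i := a i * expR (- (c * sqn (s i))).
pose dot (x y : 'rV[R]_d) := \sum_l x ord0 l * y ord0 l.
pose x i j := 2 * c * dot (s i) (s j).
pose U m := \sum_i \sum_j b i * b j * exp_coeff (x i j) m.
have sqnB u v : sqn (u - v) = sqn u + sqn v - 2 * dot u v.
  rewrite /sqn /dot mulr_sumr -big_split -sumrB/=; apply: eq_bigr => l _.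
  by rewrite !mxE; ring.
have kE : kquad (fun x y => expR (- (c * sqn (x - y)))) s a =
    \sum_i \sum_j b i * b j * expR (x i j).
  apply: eq_bigr => i _; apply: eq_bigr => j _.
  have -> : expR (- (c * sqn (s i - s j))) =
      expR (- (c * sqn (s i))) * expR (- (c * sqn (s j))) * expR (x i j).
    by rewrite -!expRD; congr expR; rewrite sqnB /x; ring.
  by rewrite /b; ring.
(* Each Taylor term is a nonnegative multiple of a sum of squares, one for each word of length [m].
   The bound keeps the single word [J] and drops the rest. *)
have UE m : U m = (2 * c) ^+ m / m`!%:R *
    \sum_(f : {ffun 'I_m -> 'I_d}) (\sum_i b i * \prod_k s i ord0 (f k)) ^+ 2.
  rewrite mulr_sumr.
  transitivity (\sum_i \sum_j \sum_(f : {ffun 'I_m -> 'I_d})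
    (2 * c) ^+ m / m`!%:R * ((b i * \prod_k s i ord0 (f k)) * (b j * \prod_k s j ord0 (f k)))).
    apply: eq_bigr => i _; apply: eq_bigr => j _.
    transitivity ((2 * c) ^+ m / m`!%:R * (b i * b j) * dot (s i) (s j) ^+ m).
      by rewrite /x exp_coeffE exprMn /=; ring.
    by rewrite /dot dot_expansion mulr_sumr; apply: eq_bigr => f _; ring.
  under eq_bigr do rewrite exchange_big.
  rewrite exchange_big; apply: eq_bigr => f _ /=.
  under eq_bigr do rewrite -mulr_sumr.
  rewrite -mulr_sumr expr2 mulr_suml; congr (_ * _); apply: eq_bigr => i _.
  by rewrite mulr_sumr.
have U0 m : 0 <= U m.
  rewrite UE mulr_ge0 ?divr_ge0 ?exprn_ge0 ?mulr_ge0 ?ler0n//.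
  by apply: sumr_ge0 => f _; rewrite sqr_ge0.
have Ucvg : series U N @[N --> \oo] -->
    kquad (fun x y => expR (- (c * sqn (x - y)))) s a.
  rewrite kE (_ : series U = fun N => \sum_i \sum_j b i * b j * series (exp_coeff (x i j)) N).
    apply: cvg_sum_fun => i; apply: cvg_sum_fun => j.
    apply: cvgM; first exact: cvg_cst.
    exact: is_cvg_series_exp_coeff.
  apply/funext => N; rewrite /series/= exchange_big; apply: eq_bigr => i _ /=.
  rewrite exchange_big; apply: eq_bigr => j _ /=.
  by rewrite mulr_sumr.
rewrite -(cvg_lim _ Ucvg)//; apply: limr_ge; first by apply/cvg_ex; eexists; exact: Ucvg.
exists (size J).+1 => // N /= JN.
rewrite /series/= (bigD1_seq (size J))/= ?iota_uniq//; last first.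
  by rewrite mem_index_iota.
rewrite -[leLHS]addr0 lerD//; last by apply: sumr_ge0 => m _; exact: U0.
rewrite UE ler_wpM2l ?divr_ge0 ?exprn_ge0 ?mulr_ge0//.
pose f0 : {ffun 'I_(size J) -> 'I_d} := [ffun k => tnth (in_tuple J) k].
rewrite (bigD1 f0)//= -[leLHS]addr0 lerD//; last first.
  by apply: sumr_ge0 => f _; rewrite sqr_ge0.
rewrite le_eqVlt; apply/orP; left; apply/eqP; congr (_ ^+ 2).
apply: eq_bigr => i _; rewrite /b -mulrA; congr (_ * (_ * _)).
rewrite /monom [LHS](big_tnth _ _ J); apply: eq_bigr => k _.
by rewrite /f0 ffunE.
Qed.

Lemma gaussian_kquad_ge0 (c : R) n (s : 'I_n -> 'rV[R]_d) a : 0 <= c ->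
  0 <= kquad (fun x y => expR (- (c * sqn (x - y)))) s a.
Proof.
move=> c0; apply: le_trans (gaussian_kquad_ge s a [::] c0).
by rewrite mulr_ge0 ?sqr_ge0// divr_ge0// exprn_ge0// mulr_ge0.
Qed.

(** The interface through which finite and infinite smoothness are treated alike. The radial profile
    [F] makes Gram entries measurable in the locations; the last clause is density of the kernel
    space in the continuous functions. *)
Definition universal_kernel D K (v : R) :=
  [/\ forall x y, K x y = K y x, forall x, K x x = v,
      exists2 F, measurable_fun setT F & forall x y, K x y = F (sqn (x - y)),
      forall n (s : 'I_n -> 'rV[R]_d) a, 0 <= kquad K s a
    & forall g e, {within D, continuous g} -> 0 < e ->
        exists2 f, rkhs K f & forall s, D s -> `|g s - f s| <= e].

Section mixture.
Context {dT : measure_display} {T : measurableType dT}.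
Variables (mu : {sigma_finite_measure set T -> \bar R}) (m cc : T -> R).
Variables (K : 'rV[R]_d -> 'rV[R]_d -> R) (A : set T) (c0 c1 m0 : R).
Hypotheses (mm : measurable_fun setT m) (mcc : measurable_fun setT cc).
Hypotheses (m_ge0 : forall t, 0 <= m t) (cc_ge0 : forall t, 0 <= cc t).
Hypothesis KE : forall x y,
  has_integral mu setT (fun t => m t * expR (- (cc t * sqn (x - y)))) (K x y).
Hypotheses (mA : measurable A) (c0_gt0 : 0 < c0).
Hypothesis ccA : forall t, A t -> c0 <= cc t <= c1.
Hypotheses (m0_gt0 : 0 < m0) (m0E : has_integral mu A m m0).

Lemma kquad_mixture n (s : 'I_n -> 'rV[R]_d) a :
  has_integral mu setT
    (fun t => m t * kquad (fun x y => expR (- (cc t * sqn (x - y)))) s a)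
    (kquad K s a).
Proof.
have : has_integral mu setT (fun t => \sum_i \sum_j a i * a j *
    (m t * expR (- (cc t * sqn (s i - s j))))) (kquad K s a).
  do 2 (apply: has_integral_sum => // ? _).
  exact: has_integralZl.
apply: has_integral_eq => // t _; rewrite mulr_sumr; apply: eq_bigr => i _.
by rewrite mulr_sumr; apply: eq_bigr => j _; rewrite mulrCA.
Qed.

(** The positive factor that multiplies the polynomials: it averages the Gaussian prefactors of the
    feature expansion. On [A] the scale stays in [[c0, c1]]; [c0] makes the feature bounds uniform,
    [c1] keeps [w] positive and continuous. *)
Let w (s : 'rV[R]_d) : R := fine (\int[mu]_(t in A) (m t * expR (- (cc t * sqn s)))%:E)%E.

Lemma mixture_weightE s :
  has_integral mu A (fun t => m t * expR (- (cc t * sqn s))) (w s).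
Proof.
have [||a wa _] := dominated_has_integral mA _ _ m0E
  (f := fun t => m t * expR (- (cc t * sqn s))).
- apply: measurable_funTS; apply: measurable_funM => //.
  apply: measurableT_comp; first exact: measurable_expR.
  by apply: measurableT_comp => //; exact: measurable_funM.
- move=> t _; rewrite ger0_norm ?mulr_ge0 ?expR_ge0// ler_piMr//.
  by rewrite -expR0 ler_expR oppr_le0 mulr_ge0 ?sqn_ge0.
exact: (integrable_has_integral mA (proj1 wa)).
Qed.

Lemma mixture_weight_gt0 s : 0 < w s.
Proof.
apply: (@lt_le_trans _ _ (expR (- (c1 * sqn s)) * m0)).
  by rewrite mulr_gt0 ?expR_gt0.
apply: has_integral_le (has_integralZl mA _ m0E) (mixture_weightE s) => //.
move=> t At; rewrite mulrC ler_wpM2l// ler_expR lerN2 ler_wpM2r ?sqn_ge0//.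
by have /andP[] := ccA At.
Qed.

Lemma mixture_weight_le s : w s <= m0.
Proof.
apply: has_integral_le (mixture_weightE s) m0E => // t At.
by rewrite ler_piMr// -expR0 ler_expR oppr_le0 mulr_ge0 ?sqn_ge0.
Qed.

(** [expR (- u)] is 1-Lipschitz on nonnegative [u], and [cc] is at most [c1] on [A]. *)
Lemma mixture_weight_lip s s' : `|w s - w s'| <= m0 * c1 * `|sqn s - sqn s'|.
Proof.
have expB (u v : R) : 0 <= u -> 0 <= v -> expR (- u) - expR (- v) <= `|u - v|.
  move=> u0 v0; have [uv|vu] := leP u v; last first.
    rewrite (@le_trans _ _ 0) ?normr_ge0// subr_le0 ler_expR lerN2.
    exact: ltW.
  rewrite ler0_norm ?subr_le0// opprB.
  have := expR_ge1Dx (- (v - u)); have : expR (- v) = expR (- u) * expR (- (v - u)).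
    by rewrite -expRD; congr expR; ring.
  have : 0 < expR (- u) by exact: expR_gt0.
  have : expR (- u) <= 1 by rewrite -expR0 ler_expR oppr_le0.
  set p := expR (- u) => p1 p0 -> h.
  have : p * (1 + - (v - u)) <= p * expR (- (v - u)) by rewrite ler_wpM2l ?(ltW p0).
  have : p * (v - u) <= v - u by rewrite ler_piMl// subr_ge0.
  by lra.
have half x y : w x - w y <= m0 * c1 * `|sqn x - sqn y|.
  have wB : has_integral mu A (fun t => m t * expR (- (cc t * sqn x)) +
      (-1) * (m t * expR (- (cc t * sqn y)))) (w x + (-1) * w y).
    by apply: has_integralD => //; [|apply: has_integralZl => //]; exact: mixture_weightE.
  have -> : w x - w y = w x + (-1) * w y by ring.
  have -> : m0 * c1 * `|sqn x - sqn y| = `|sqn x - sqn y| * c1 * m0 by ring.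
  apply: has_integral_le wB (has_integralZl mA (`|sqn x - sqn y| * c1) m0E) => // t At.
  rewrite mulN1r -mulrBr mulrC ler_wpM2r//.
  have /andP[_ cc1] := ccA At.
  apply: le_trans (expB _ _ _ _) _; rewrite ?mulr_ge0 ?sqn_ge0//.
  by rewrite -mulrBr normrM (ger0_norm (cc_ge0 _)) mulrC ler_wpM2l.
rewrite ler_norml half andbT lerNl opprB distrC half//.
Qed.

Lemma mixture_weight_continuous : continuous w.
Proof.
move=> s; apply/(@cvgrPdist_lt _ _ _ (nbhs s)) => e e0.
have c1_ge0 : 0 <= c1.
  have [t At] : exists t, A t.
    apply: contrapT => /forallNP A0.
    have A00 : A = set0 by apply/seteqP; split => t //= /A0.
    have [_] := m0E; rewrite A00 integral_set0 => -[m00].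
    by move: m0_gt0; rewrite -m00 ltxx.
  have /andP[h1 h2] := ccA At; exact: le_trans (le_trans (ltW c0_gt0) h1) h2.
have q0 : 0 < m0 * c1 + 1 by rewrite ltr_wpDl// mulr_ge0// ltW.
have : (fun s => sqn (s - 0)) @ s --> sqn (s - 0) by exact: continuous_sqnB.
move=> /cvgrPdist_lt/(_ (e / (m0 * c1 + 1))); rewrite divr_gt0// => /(_ isT).
apply: filterS => s' /=; rewrite !subr0 ltr_pdivlMr// => h.
rewrite (le_lt_trans (mixture_weight_lip _ _))// (le_lt_trans _ h)//.
by rewrite mulrC ler_wpM2l// lerDl.
Qed.

(* Cauchy-Schwarz under the mixing measure restricted to [A]. *)
Lemma rkhs_mixture_monom J : rkhs K (fun s => w s * monom J s).
Proof.
pose C := (2 * c0) ^+ size J / (size J)`!%:R.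
have C0 : 0 < C by rewrite divr_gt0 ?exprn_gt0 ?mulr_gt0// ltr0n fact_gt0.
exists (m0 / C) => [|n s a]; first by rewrite divr_ge0// ltW.
pose f t := \sum_i a i * (expR (- (cc t * sqn (s i))) * monom J (s i)).
have mf : measurable_fun setT f.
  apply: measurable_sum => i; apply: measurable_funM => //.
  apply: measurable_funM => //.
  apply: measurableT_comp; first exact: measurable_expR.
  by apply: measurableT_comp => //; exact: measurable_funM.
have If : has_integral mu A (fun t => m t * f t)
    (\sum_i a i * (w (s i) * monom J (s i))).
  have : has_integral mu A (fun t => \sum_i (a i * monom J (s i)) *
      (m t * expR (- (cc t * sqn (s i)))))
      (\sum_i (a i * monom J (s i)) * w (s i)).
    apply: has_integral_sum => // i _; apply: has_integralZl => //.
    exact: mixture_weightE.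
  rewrite (_ : \sum_i a i * monom J (s i) * w (s i) =
    \sum_i a i * (w (s i) * monom J (s i))); last first.
    by apply: eq_bigr => i _; rewrite -mulrA [monom _ _ * _]mulrC.
  apply: has_integral_eq => // t _; rewrite /f mulr_sumr.
  by apply: eq_bigr => i _; ring.
have q0 t : 0 <= m t * kquad (fun x y => expR (- (cc t * sqn (x - y)))) s a.
  by rewrite mulr_ge0// gaussian_kquad_ge0.
have [qi qE] := kquad_mixture s a.
have qiA := integrableS measurableT mA (@subsetT _ A) qi.
have qA := integrable_has_integral mA qiA.
set b := fine _ in qA.
have bK : b <= kquad K s a.
  rewrite -lee_fin -qA.2 -qE; apply: ge0_subset_integral => //.
    exact: measurable_int qi.
  by move=> t _; rewrite lee_fin.
have [|t At|ff If2 ffb] := dominated_has_integral mA _ _ (has_integralZl mA C^-1 qA)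
  (f := fun t => m t * f t ^+ 2).
- by apply: measurable_funTS; apply: measurable_funM => //; exact: measurable_funX.
- have -> : `|m t * f t ^+ 2| = m t * f t ^+ 2.
    by rewrite ger0_norm// mulr_ge0// sqr_ge0.
  rewrite [leRHS]mulrCA ler_wpM2l//.
  (* The feature bound at scale [cc t] has a constant at least [C], because [c0 <= cc t] on [A]. *)
  rewrite ler_pdivlMl//; apply: le_trans (gaussian_kquad_ge s a J (cc_ge0 t)).
  have /andP[cc0 _] := ccA At.
  rewrite ler_wpM2r ?sqr_ge0// ler_wpM2r ?invr_ge0// lerXn2r ?nnegrE ?mulr_ge0 ?(ltW c0_gt0)//.
  by rewrite ler_wpM2l.
have := has_integral_cauchy_schwarz mA (fun t _ => m_ge0 t) m0E If If2.
move=> /le_trans; apply; rewrite -mulrA ler_wpM2l ?(ltW m0_gt0)//.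
rewrite (le_trans (ler_norm _))// (le_trans ffb)// ler_wpM2l// invr_ge0.
exact: ltW.
Qed.

(** Products are not handled by closure of [rkhs], so the induction carries an arbitrary multiplier
    [u] compatible with all monomials: a coordinate lengthens the word [J], and a product passes one
    factor into [u]. *)
Lemma rkhs_mixture_poly f : polyfun f -> rkhs K (fun s => w s * f s).
Proof.
move=> pf.
suff : forall u : 'rV[R]_d -> R, (forall J, rkhs K (fun s => w s * (monom J s * u s))) ->
    forall J, rkhs K (fun s => w s * (monom J s * (f s * u s))).
  move=> /(_ (fun=> 1))/(_ _ [::]) h; apply: eq_rkhs (h _) => [s|J].
    by rewrite /monom big_nil mulr1 mul1r.
  by apply: eq_rkhs (rkhs_mixture_monom J) => s; rewrite mulr1.
elim: pf => [c|l|f1 f2 _ ih1 _ ih2|f1 f2 _ ih1 _ ih2] u hu J.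
- by apply: eq_rkhs (rkhsZ c (hu J)) => s; ring.
- by apply: eq_rkhs (hu (l :: J)) => s; rewrite /monom big_cons; ring.
- by apply: eq_rkhs (rkhsD (ih1 u hu J) (ih2 u hu J)) => s; ring.
- apply: eq_rkhs (ih1 (fun s => f2 s * u s) _ J) => [s|J']; first by ring.
  exact: ih2.
Qed.

Lemma mixture_universal D : compact D -> universal_kernel D K (K 0 0).
Proof.
move=> cD; have Kxx x y : K (x - x) 0 = K (y - y) 0 by rewrite !subrr.
split.
- move=> x y; apply: has_integral_uniq (KE x y) _.
  by apply: has_integral_eq (KE y x) => // t _; rewrite -[x - y]opprB sqnN.
- move=> x; apply: has_integral_uniq (KE x x) _.
  by apply: has_integral_eq (KE 0 0) => // t _; rewrite !subrr.
- exists (fun r => fine (\int[mu]_t (m t * expR (- (cc t * r)))%:E)%E).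
    apply: measurableT_comp; first exact: fine_measurable.
    apply: (measurable_fun_fubini_tonelli_F (m2 := mu)
      (fun z : measurableTypeR R * T => (m z.2 * expR (- (cc z.2 * z.1)))%:E)).
      apply/measurable_EFinP; apply: measurable_funM.
        by apply: measurableT_comp mm _; exact: measurable_snd.
      apply: measurableT_comp; first exact: measurable_expR.
      apply: measurableT_comp => //; apply: measurable_funM.
        by apply: measurableT_comp mcc _; exact: measurable_snd.
      exact: measurable_fst.
    by move=> z; rewrite lee_fin mulr_ge0 ?expR_ge0.
  by move=> x y; rewrite (KE x y).2.
- move=> n s a; apply: has_integral_ge0 (kquad_mixture s a) => // t _.
  by rewrite mulr_ge0// gaussian_kquad_ge0.
(* [g / w] is continuous on [D]; a polynomial within [e / m0] of it becomes, after multiplication by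
   [w <= m0], an approximation of [g] within [e]. *)
- move=> g e cg e0; pose G s := g s / w s.
  have cG : {within D, continuous G}.
    move/subspace_continuousP: cg => cg; apply/subspace_continuousP => x Dx.
    apply: cvgM; first exact: cg.
    apply: cvgV; first by rewrite gt_eqF// mixture_weight_gt0.
    by apply: cvg_within_filter; exact: mixture_weight_continuous.
  have [f pf Gf] := polyfun_dense cD cG (divr_gt0 e0 m0_gt0).
  exists (fun s => w s * f s); first exact: rkhs_mixture_poly.
  move=> s Ds; have w0 := mixture_weight_gt0 s.
  have -> : g s - w s * f s = w s * (G s - f s).
    by rewrite /G; field; rewrite gt_eqF.
  rewrite normrM gtr0_norm// (le_trans (ler_wpM2l (ltW w0) (Gf _ Ds)))//.
  by rewrite mulrCA ler_piMr ?(ltW e0)// ler_pdivrMr// mul1r mixture_weight_le.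
Qed.

End mixture.
End kernels.

(** For finite [nu] the mixing measure is Lebesgue measure weighted by [matern_weight]; the squared
    exponential kernel is the degenerate mixture over a Dirac mass, with constant scale [phi]. *)
Lemma matern_universal {R : realType} d (D : set 'rV[R]_d) (sigma2 phi : R) (nu : \bar R) :
  compact D -> 0 < sigma2 -> 0 < phi -> (0 < nu)%E ->
  universal_kernel D (matern sigma2 phi nu) sigma2.
Proof.
move=> cD s0 phi0; case: nu => [nu|_|//].
- rewrite lte_fin => nu0; have [Z Z0 wZ] := matern_weight_integrable nu0.
  have sE : matern sigma2 phi nu%:E (0 : 'rV[R]_d) 0 = sigma2 :> R.
    by rewrite /matern eqxx.
  rewrite -[X in universal_kernel _ _ X]sE.
  have mu01 : (@lebesgue_measure R `[0%R, 1%R]%classic = 1)%E.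
    by rewrite lebesgue_measure_itv/= lte_fin ltr01 -EFinD subr0.
  have mexp : measurable_fun setT (fun t : measurableTypeR R => expR (- t)).
    by apply: measurableT_comp; [exact: measurable_expR|].
  (* The set [A] is the unit interval, on which the scale [phi^2 expR (- t) / 2] lies between the
     [c0] and [c1] given below. *)
  have m01 : has_integral (@lebesgue_measure R) `[0, 1]%classic
      (fun t => sigma2 / Z * matern_weight nu t)
      (fine (\int[lebesgue_measure]_(t in `[0%R, 1%R]) (sigma2 / Z * matern_weight nu t)%:E)%E).
    apply: integrable_has_integral => //.
    apply: (integrableS measurableT) => //.
    exact: (has_integralZl measurableT (sigma2 / Z) wZ).1.
  apply: (mixture_universal (mu := @lebesgue_measure R)
    (m := fun t => sigma2 / Z * matern_weight nu t)
    (cc := fun t => phi ^+ 2 * expR (- t) / 2)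
    (c0 := phi ^+ 2 * expR (- 1) / 2) (c1 := phi ^+ 2 / 2) _ _ _ _ _ _ _ _ _ m01) => //.
  - by apply: measurable_funM => //; exact: measurable_matern_weight.
  - by apply: measurable_funM => //; apply: measurable_funM.
  - by move=> t; rewrite mulr_ge0 ?divr_ge0 ?(ltW s0) ?(ltW Z0) ?expR_ge0.
  - by move=> t; apply: divr_ge0 => //; apply: mulr_ge0; [exact: sqr_ge0|exact: expR_ge0].
  - move=> x y; have := maternE sigma2 x y phi0 nu0 Z0 wZ.
    apply: has_integral_eq => // t _; congr (_ * expR _).
    by rewrite enorm_sqr mulNr.
  - by apply: divr_gt0 => //; apply: mulr_gt0; [exact: exprn_gt0|exact: expR_gt0].
  - move=> t /=; rewrite in_itv/= => /andP[t0 t1].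
    rewrite ler_pM2r ?invr_gt0// ler_pM2l ?exprn_gt0// ler_expR lerN2 t1/=.
    rewrite ler_pM2r ?invr_gt0// ler_piMr ?sqr_ge0//.
    by rewrite -expR0 ler_expR oppr_le0.
  - apply: (@lt_le_trans _ _ (sigma2 / Z * expR (- (expR 1 / 2)))).
      by rewrite mulr_gt0 ?divr_gt0 ?expR_gt0.
    apply: (has_integral_le (f := fun=> sigma2 / Z * expR (- (expR 1 / 2))) _ _ _ m01) => //.
      move=> t; rewrite /= in_itv/= => /andP[t0 t1].
      rewrite ler_pM2l ?divr_gt0// ler_expR lerBrDr.
      have : expR t <= expR 1 by rewrite ler_expR.
      by have := mulr_ge0 (ltW nu0) t0; lra.
    split.
      apply: measurable_bounded_integrable => //.
        by rewrite (_ : _ `[0%R, 1%R]%classic = 1%E) ?ltry//; exact: mu01.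
      exact: bounded_cst.
    rewrite integral_cst// [X in (_ * X)%E](_ : _ = 1%E) ?mule1//; exact: mu01.
- have sE : matern sigma2 phi +oo (0 : 'rV[R]_d) 0 = sigma2 :> R.
    rewrite /matern enorm_sqr subrr (_ : sqn _ = 0) ?mulr0 ?expR0 ?mulr1//.
    by rewrite /sqn big1// => l _; rewrite mxE expr0n.
  rewrite -[X in universal_kernel _ _ X]sE.
  have dE (A : set R) (k : R) : measurable A -> A 0 -> has_integral (\d_(0 : R)) A (fun=> k) k.
    move=> mA A0; split.
      apply/integrableP; split; first exact: measurable_cst.
      by rewrite integral_dirac// diracE mem_set// mul1e ltry.
    by rewrite integral_dirac// diracE mem_set// mul1e.
  have d01 := dE setT sigma2 measurableT I.
  apply: (mixture_universal (mu := \d_(0 : R)) (m := fun=> sigma2) (cc := fun=> phi)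
    (c0 := phi) (c1 := phi) _ _ _ _ _ _ _ _ _ d01) => //.
  - by move=> _; exact: ltW.
  - by move=> _; exact: ltW.
  - by move=> x y; rewrite /matern enorm_sqr mulNr; exact: dE.
  - by move=> _ _; rewrite lexx.
Qed.

Lemma universal_kernel_gram {R : realType} d (D : set 'rV[R]_d) K (v : R) n
    (s : nat -> 'rV[R]_d) : universal_kernel D K v ->
  let G : 'M[R]_n := \matrix_(i, j) K (s i) (s j) in G^T = G /\ psd G.
Proof.
move=> [KC _ _ K0 _]; split; first by apply/matrixP => i j; rewrite !mxE.
move=> a; have := K0 n (fun i => s i) (fun i => a i ord0).
rewrite bilinE /kquad; congr (_ <= _); apply: eq_bigr => i _.
by apply: eq_bigr => j _; rewrite mxE.
Qed.

(** The threshold [N] is uniform over all configurations in [D]. An approximant [f] in the kernel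
    space contributes a constant [C] independent of n, and the remainder is controlled by its sup
    norm through [Q <= 1 / tau2]. *)
Lemma smooth_part_negligible {R : realType} d (D : set 'rV[R]_d) K v (tau2 rho : R)
    (g : 'rV[R]_d -> R) : universal_kernel D K v -> 0 < tau2 -> 0 < rho ->
  {within D, continuous g} ->
  exists N : nat, forall n (S : nat -> 'rV[R]_d), (N <= n)%N -> (forall i, D (S i)) ->
    bilin (invmx (working_cov n K tau2 S)) (\col_(i < n) g (S i))
      (\col_(i < n) g (S i)) <= rho * n%:R.
Proof.
move=> KU tau0 rho0 cg; have [_ _ _ _ Ku] := KU.
(* The cap at 1 gives [e^2 <= e], hence a squared error of at most [rho tau2 / 4] at each
   location. *)
have e0 : 0 < Num.min 1 (rho * tau2 / 4).
  by rewrite lt_min ltr01/= divr_gt0// mulr_gt0.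
have [f [C C0 fC] gf] := Ku g _ cg e0.
(* Beyond this threshold [C <= rho n / 4]; the remainder costs another [rho n / 4], and [bilin_half]
   doubles the sum. *)
exists (Num.truncn (4 * C / rho)).+1; move=> n S Nn SD.
set u := \col_(i < n) g (S i).
pose G : 'M[R]_n := \matrix_(i, j) K (S i) (S j).
have [GT G0] : G^T = G /\ psd G by exact: universal_kernel_gram KU.
have Gq a : bilin G a a = kquad K (fun i : 'I_n => S i) (fun i => a i ord0).
  rewrite bilinE; apply: eq_bigr => i _; apply: eq_bigr => j _.
  by rewrite mxE.
have QT := tr_reg_inv tau2 GT.
have Q0 := psd_reg_inv GT G0 tau0.
rewrite /working_cov -/G.
pose uf : 'cV[R]_n := \col_i f (S i).
have hf : bilin (invmx (G + tau2%:M)) uf uf <= C.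
  apply: reg_inv_rkhs => // a; rewrite Gq bilin1E.
  have := fC n (fun i => S i) (fun i => a i ord0).
  by congr (_ ^+ 2 <= _); apply: eq_bigr => i _; rewrite mxE.
have hd : tau2 * bilin (invmx (G + tau2%:M)) (uf - u) (uf - u) <= rho * tau2 / 4 * n%:R.
  apply: le_trans (reg_inv_le GT G0 tau0 _) _; rewrite bilin1E.
  have -> : rho * tau2 / 4 * n%:R = \sum_(i < n) rho * tau2 / 4.
    by rewrite sumr_const card_ord mulr_natr.
  apply: ler_sum => i _; rewrite -expr2 !mxE -[leLHS]real_normK ?num_real//.
  have := gf _ (SD i); rewrite distrC le_min => /andP[h1 h2].
  by rewrite expr2 (le_trans _ h2)// ler_piMl.
have := bilin_half u (uf - u) QT Q0; rewrite [u + _]addrC subrK.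
have : 4 * C <= rho * n%:R.
  rewrite [leRHS]mulrC -ler_pdivrMr// (le_trans (ltW (truncnS_gt _)))//.
  by rewrite ler_nat.
have hd2 : bilin (invmx (G + tau2%:M)) (uf - u) (uf - u) <= rho / 4 * n%:R.
  by rewrite -(ler_pM2l tau0) (le_trans hd)// le_eqVlt; apply/orP; left; apply/eqP; ring.
have : 0 <= rho * n%:R by rewrite mulr_ge0 ?(ltW rho0).
move: hf hd2; set q := bilin _ u u; move: (bilin _ _ _) (bilin _ _ _) => x y.
rewrite (_ : rho / 4 * n%:R = rho * n%:R / 4); last by ring.
by move: (rho * n%:R) => z; lra.
Qed.

(** * Moments and tightness of the errors *)

Section identically_distributed.
Context {d d' : measure_display} {T : measurableType d} {T' : measurableType d'}.
Context {R : realType} (P : probability T R).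
Implicit Types X Y : {RV P >-> T'}.

Lemma has_integral_distribution X (f : T' -> R) a : measurable_fun setT f ->
  has_integral (distribution P X) setT f a <-> has_integral P setT (f \o X) a.
Proof.
move=> mf; have mfE : measurable_fun setT (EFin \o f) by exact/measurable_EFinP.
have iE : (distribution P X).-integrable setT (EFin \o f) <->
    P.-integrable setT (EFin \o (f \o X)).
  split=> [/integrableP[_]|fX]; last exact: integrable_pushforward.
  rewrite ge0_integral_distribution//; last exact: measurableT_comp.
  move=> h; apply/integrableP; split; last exact: h.
  by apply/measurable_EFinP; exact: measurableT_comp.
split=> [[/iE fi fa]|[fi fa]].
  by split => //; rewrite -fa integral_distribution.
by split; [exact/iE|rewrite -fa integral_distribution].
Qed.

Lemma has_integral_same_law X Y (f : T' -> R) a : measurable_fun setT f ->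
  (forall A, measurable A -> distribution P X A = distribution P Y A) ->
  has_integral P setT (f \o X) a -> has_integral P setT (f \o Y) a.
Proof.
move=> mf XY /(has_integral_distribution X a mf)[/integrableP[mfE fi] fa].
apply/has_integral_distribution => //; split; last first.
  by rewrite -fa; apply: eq_measure_integral => A mA _; exact/esym/XY.
apply/integrableP; split => //; rewrite (eq_measure_integral (distribution P X))//.
by move=> A mA _; exact/esym/XY.
Qed.

Lemma mutually_independent_pair (X : nat -> {RV P >-> T'}) i j
    (f g : T' -> R) : mutually_independent P (fun k => sigma_of (X k)) ->
  i != j -> measurable_fun setT f -> measurable_fun setT g ->
  indep2 P (f \o X i) (g \o X j).
Proof.
move=> Xind ij mf mg A B mA mB.
pose C k := if k == i then X i @^-1` (f @^-1` A) else X j @^-1` (g @^-1` B).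
have Ci : C i = X i @^-1` (f @^-1` A) by rewrite /C eqxx.
have Cj : C j = X j @^-1` (g @^-1` B) by rewrite /C eq_sym (negbTE ij).
have /(_ _)/= := Xind [fset i; j]%fset C.
have -> : \bigcap_(k in [set` [fset i; j]%fset]) C k =
    (f \o X i) @^-1` A `&` (g \o X j) @^-1` B.
  transitivity (C i `&` C j); last by rewrite Ci Cj.
  apply/seteqP; split => w /=.
    by move=> h; split; apply: h; rewrite /= !inE eqxx ?orbT.
  by move=> [wi wj] k; rewrite /= !inE => /orP[] /eqP ->.
move=> ->.
  rewrite big_fsetU1 ?inE//= big_seq_fset1 Ci Cj EFinM !fineK//; apply: fin_num_measure.
    rewrite -[X in measurable X]setTI; apply: (measurable_funPT (X j)) => //.
    by rewrite -[X in measurable X]setTI; exact: mg.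
  rewrite -[X in measurable X]setTI; apply: (measurable_funPT (X i)) => //.
  by rewrite -[X in measurable X]setTI; exact: mf.
move=> k; rewrite !inE => /orP[] /eqP ->.
  exists (f @^-1` A); last by rewrite setTI Ci.
  by rewrite -[X in measurable X]setTI; exact: mf.
exists (g @^-1` B); last by rewrite setTI Cj.
by rewrite -[X in measurable X]setTI; exact: mg.
Qed.

End identically_distributed.

Lemma has_integral_of_sqr {d} {T : measurableType d} {R : realType}
    (P : probability T R) (f : T -> R) v : measurable_fun setT f ->
  has_integral P setT (fun w => f w ^+ 2) v ->
  has_integral P setT f (fine (\int[P]_w (f w)%:E)%E).
Proof.
move=> mf fv; apply: integrable_has_integral => //.
have [| |a [] //] := dominated_has_integral measurableT _ _
  (has_integralD measurableT (has_integral_cst P 1) fv) (f := f).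
- exact: mf.
- move=> x _; have := sqr_ge0 (`|f x| - 1).
  by rewrite sqrrB real_normK ?num_real// expr1n mulr1; have := normr_ge0 (f x); lra.
Qed.

(** * Measurability of matrix inverses and sigma-algebras of sequences *)

Section measurable_inverse_matrix.
Context {d : measure_display} {T : measurableType d} {R : realType}.

(** Squaring makes the base nonnegative, where the power with exponent -1 is the inverse. *)
Lemma measurable_fun_inv (f : T -> R) : measurable_fun setT f ->
  (forall x, f x != 0) -> measurable_fun setT (fun x => (f x)^-1).
Proof.
move=> mf f0; rewrite (_ : (fun x => _) = fun x => f x * (f x ^+ 2) `^ (-1)).
  apply: measurable_funM => //; apply: (measurableT_comp (measurable_powR _)).
  exact: measurable_funX.
apply/funext => x; rewrite powR_inv1 ?sqr_ge0//.
by field; exact: f0.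
Qed.

Lemma measurable_det n (A : T -> 'M[R]_n) :
  (forall i j, measurable_fun setT (fun x => A x i j)) ->
  measurable_fun setT (fun x => \det (A x)).
Proof.
move=> mA; apply: measurable_sum => s; apply: measurable_funM => //.
by apply: measurable_prod => i _; exact: mA.
Qed.

(** By Cramer's formula the entries are cofactors over the determinant. *)
Lemma measurable_invmx n (A : T -> 'M[R]_n) :
  (forall i j, measurable_fun setT (fun x => A x i j)) ->
  (forall x, A x \in unitmx) ->
  forall i j, measurable_fun setT (fun x => invmx (A x) i j).
Proof.
move=> mA uA i j.
rewrite (_ : (fun x => _) = fun x => (\det (A x))^-1 * cofactor (A x) j i).
  apply: measurable_funM.
    apply: measurable_fun_inv; first exact: measurable_det.
    by move=> x; have := uA x; rewrite unitmxE unitfE.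
  apply: measurable_funM => //; apply: measurable_det => k l.
  by under eq_fun do rewrite !mxE; exact: mA.
by apply/funext => x; rewrite /invmx uA !mxE.
Qed.

End measurable_inverse_matrix.

(** Dependence on a sequence alone is expressed by putting its generated sigma-algebra on [Omega];
    ordinary measurability rules then show that events belong to [sigma_of_seq]. *)
Lemma sigma_of_seq_preimage {dO d'} {Omega : measurableType dO}
    {T : measurableType d'} {R : realType} (X : nat -> Omega -> T) (f : Omega -> R) :
  measurable_fun (setT : set (g_sigma_algebraType (\bigcup_i sigma_of (X i)))) f ->
  forall B, measurable B -> sigma_of_seq X (f @^-1` B).
Proof. by move=> mf B mB; have := mf measurableT B mB; rewrite setTI. Qed.

Lemma sigma_of_seq_measurable {dO d'} {Omega : measurableType dO}
    {T : measurableType d'} (X : nat -> Omega -> T) i :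
  measurable_fun (setT : set (g_sigma_algebraType (\bigcup_i sigma_of (X i)))) (X i).
Proof.
by move=> _ B mB; apply: sub_sigma_algebra; exists i => //; exists B.
Qed.

Lemma sigma_of_seq_measurable_fun {dO d'} {Omega : measurableType dO}
    {T : measurableType d'} {R : realType} (X : nat -> Omega -> T) (f : Omega -> R) :
  (forall i, measurable_fun setT (X i)) ->
  measurable_fun (setT : set (g_sigma_algebraType (\bigcup_i sigma_of (X i)))) f ->
  measurable_fun setT f.
Proof.
move=> mX mf _ B mB; rewrite setTI.
have := sigma_of_seq_preimage mf mB.
move: (f @^-1` B); apply: smallest_sub; first exact: sigma_algebra_measurable.
by move=> A [i _ [C mC <-]]; exact: mX.
Qed.

Lemma independent_seq3_indep3 {dO d1 d2 d3} {Omega : measurableType dO}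
    {R : realType} (P : probability Omega R)
    {T1 : measurableType d1} {T2 : measurableType d2} {T3 : measurableType d3}
    (X : nat -> Omega -> T1) (Y : nat -> Omega -> T2) (Z : nat -> Omega -> T3)
    (f g h : Omega -> R) : independent_seq3 P X Y Z ->
  measurable_fun (setT : set (g_sigma_algebraType (\bigcup_i sigma_of (X i)))) f ->
  measurable_fun (setT : set (g_sigma_algebraType (\bigcup_i sigma_of (Y i)))) g ->
  measurable_fun (setT : set (g_sigma_algebraType (\bigcup_i sigma_of (Z i)))) h ->
  indep3 P f g h.
Proof.
move=> XYZ mf mg mh A B C mA mB mC.
by apply: XYZ; exact: sigma_of_seq_preimage.
Qed.

Section white_noise.
Context {dO d' : measure_display} {Omega : measurableType dO}.
Context {T : measurableType d'} {R : realType} (P : probability Omega R).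

(** Moments at index 0 suffice: equality of laws transports them to every index, and pairwise
    independence with zero means removes the off-diagonal products. *)
Lemma iid_white_noise (X : nat -> {RV P >-> T}) (f g : T -> R) c : iid X ->
  measurable_fun setT f -> measurable_fun setT g ->
  has_integral P setT (fun w => f (X 0%N w)) 0 ->
  has_integral P setT (fun w => g (X 0%N w)) 0 ->
  has_integral P setT (fun w => f (X 0%N w) * g (X 0%N w)) c ->
  forall i j, has_integral P setT (fun w => f (X i w) * g (X j w))
    (if i == j then c else 0).
Proof.
move=> [Xind Xlaw] mf mg f0 g0 fgc i j.
have law k A : measurable A -> distribution P (X 0%N) A = distribution P (X k) A.
  exact: Xlaw.
have [<-|ij] := eqVneq i j.
  exact: (has_integral_same_law (f := fun x => f x * g x) (measurable_funM mf mg) (law i)).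
rewrite -(mulr0 0); apply: has_integral_indep2.
- exact: (mutually_independent_pair (f := f) (g := g) Xind ij mf mg).
- exact: (has_integral_same_law mf (law i)).
- exact: (has_integral_same_law mg (law j)).
Qed.

Lemma covariance_centered (f g : Omega -> R) :
  ('E_P[f] = 0)%E -> ('E_P[g] = 0)%E ->
  (covariance P f g = \int[P]_w (f w * g w)%:E)%E.
Proof.
move=> f0 g0; rewrite unlock f0 g0/= unlock; apply: eq_integral => w _.
by rewrite !fctE /= !subr0.
Qed.

Lemma centered_moments (f g : Omega -> R) :
  measurable_fun setT f -> measurable_fun setT g ->
  ('E_P[f] = 0)%E -> ('E_P[g] = 0)%E ->
  covariance P f f \is a fin_num -> covariance P g g \is a fin_num ->
  has_integral P setT f 0 /\
  has_integral P setT (fun w => f w * g w) (fine (covariance P f g)).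
Proof.
move=> mf mg f0 g0.
rewrite (covariance_centered f0 f0) (covariance_centered g0 g0) => ff gg.
have f2 := has_integral_sqr mf (esym (fineK ff)).
have g2 := has_integral_sqr mg (esym (fineK gg)).
split.
  have := has_integral_of_sqr mf f2.
  by move: f0; rewrite unlock => ->.
have [c fgc] := has_integral_prod2 mf mg f2 g2.
by rewrite (covariance_centered f0 g0) fgc.2.
Qed.

End white_noise.

Section gls_consistency.
Context {R : realType} {dO : measure_display} {Omega : measurableType dO}.
Context (P : probability Omega R) (d p : nat).
Variables (D : set 'rV[R]_d) (S : nat -> {RV P >-> 'rV[R]_d}).
Variables (eps : nat -> {RV P >-> R}) (eta : nat -> {RV P >-> 'cV[R]_p}).
Hypothesis errors_indep : independent_seq3 P S eps eta.
Variables (ve : R) (V : 'M[R]_p).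
Hypothesis eps_moments : forall i j,
  has_integral P setT (fun w => eps i w * eps j w) (if i == j then ve else 0).
Hypothesis eta_moments : forall i j k l,
  has_integral P setT (fun w => eta i w k ord0 * eta j w l ord0)
    (if i == j then V k l else 0).
Variables (K : 'rV[R]_d -> 'rV[R]_d -> R) (v tau2 : R).
Hypotheses (K_univ : universal_kernel D K v) (tau2_gt0 : 0 < tau2).

Let Sig n w : 'M[R]_n := working_cov n K tau2 (S ^~ w).
Let Gr n w : 'M[R]_n := \matrix_(i, j) K (S i w) (S j w).
Let Q n w := invmx (Sig n w).
Let E n w : 'M[R]_(n, p) := design_mx n (eta ^~ w).
Let ep n w : 'cV[R]_n := response n (eps ^~ w).

Let GrT n w : (Gr n w)^T = Gr n w.
Proof. exact: (universal_kernel_gram n (S ^~ w) K_univ).1. Qed.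

Let Gr0 n w : psd (Gr n w).
Proof. exact: (universal_kernel_gram n (S ^~ w) K_univ).2. Qed.

Let colE n w (k : 'I_p) (i : 'I_n) : (col k (E n w)) i ord0 = eta i w k ord0.
Proof. by rewrite !mxE. Qed.

Let epE n w (i : 'I_n) : (ep n w) i ord0 = eps i w.
Proof. by rewrite mxE. Qed.

Let ve_ge0 : 0 <= ve.
Proof.
have := eps_moments 0 0; rewrite eqxx; apply: has_integral_ge0 => // w _.
by rewrite -expr2 sqr_ge0.
Qed.

Let V_ge0 k : 0 <= V k k.
Proof.
have := eta_moments 0 0 k k; rewrite eqxx; apply: has_integral_ge0 => // w _.
by rewrite -expr2 sqr_ge0.
Qed.

Lemma eps_tight n M : (0 < n)%N -> 0 < M ->
  within_prob P [set w | n%:R * M <= bilin 1%:M (ep n w) (ep n w)] (ve / M).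
Proof.
move=> n0 M0; have N0 : 0 < n%:R :> R by rewrite ltr0n.
have -> : ve / M = n%:R * ve / (n%:R * M) by field; rewrite !gt_eqF.
apply: markov_within; first by rewrite mulr_gt0.
  by move=> w; exact: psd1.
rewrite -[n in n%:R * ve]card_ord mulr_natl -sumr_const.
have := has_integral_sum measurableT (index_enum 'I_n) (Q := xpredT)
  (fun i _ => eps_moments i i).
under eq_bigr do rewrite eqxx.
apply: has_integral_eq => // w _; rewrite bilin1E.
by apply: eq_bigr => i _; rewrite !epE.
Qed.

Lemma eta_tight n M : (0 < n)%N -> 0 < M ->
  within_prob P
    [set w | n%:R * M <= \sum_k bilin 1%:M (col k (E n w)) (col k (E n w))]
    (\tr V / M).
Proof.
move=> n0 M0; have N0 : 0 < n%:R :> R by rewrite ltr0n.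
have -> : \tr V / M = (\sum_k \sum_(i < n) V k k) / (n%:R * M).
  under eq_bigr do rewrite sumr_const card_ord -mulr_natl.
  by rewrite -mulr_sumr /mxtrace; field; rewrite !gt_eqF.
apply: markov_within; first by rewrite mulr_gt0.
  by move=> w; apply: sumr_ge0 => k _; exact: psd1.
have := has_integral_sum measurableT (index_enum 'I_p) (Q := xpredT)
  (fun k _ => has_integral_sum measurableT (index_enum 'I_n) (Q := xpredT)
  (fun i _ => eta_moments i i k k)).
under eq_bigr do under eq_bigr do rewrite eqxx.
apply: has_integral_eq => // w _; apply: eq_bigr => k _; rewrite bilin1E.
by apply: eq_bigr => i _; rewrite !colE.
Qed.

(** [Omega] with the information of the locations only: what is measurable here is independent of
    both error sequences. *)
Let TS := g_sigma_algebraType (\bigcup_i sigma_of (S i)).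

Let measurable_K i j : measurable_fun (setT : set TS) (fun w => K (S i w) (S j w)).
Proof.
case: K_univ => _ _ [F mF KF] _ _.
rewrite (_ : (fun w => _) = F \o (fun w => sqn (S i w - S j w))); last first.
  by apply/funext => w; exact: KF.
apply: measurableT_comp => //; apply: measurable_sum => l.
apply: measurable_funX.
rewrite (_ : (fun w => _) = fun w => S i w ord0 l - S j w ord0 l); last first.
  by apply/funext => w; rewrite !mxE.
by apply: measurable_funB;
  apply: (measurableT_comp (measurable_entry (T := R) _ _)); exact: sigma_of_seq_measurable.
Qed.

Let Sig_entry n w i j : Sig n w i j = K (S i w) (S j w) + (if i == j then tau2 else 0).
Proof. by rewrite !mxE; case: eqP => _; rewrite ?mulr1n ?mulr0n. Qed.

Let measurable_Sig n (i j : 'I_n) : measurable_fun (setT : set TS) (fun w => Sig n w i j).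
Proof.
rewrite (_ : (fun w => _) = fun w => K (S i w) (S j w) + (if i == j then tau2 else 0)).
  by apply: measurable_funD => //; exact: measurable_K.
by apply/funext => w; exact: Sig_entry.
Qed.

Let measurable_Q n (i j : 'I_n) : measurable_fun (setT : set TS) (fun w => Q n w i j).
Proof.
apply: measurable_invmx => [k l|w]; first exact: measurable_Sig.
exact: (reg_unit (@Gr0 n w) tau2_gt0).
Qed.

Let measurable_S_fun (f : Omega -> R) : measurable_fun (setT : set TS) f -> measurable_fun setT f.
Proof. by apply: sigma_of_seq_measurable_fun => i. Qed.

Lemma has_integral_errors (f : Omega -> R) b i j i' j' k l :
  measurable_fun (setT : set TS) f -> has_integral P setT f b ->
  has_integral P setT (fun w => f w * ((eps i w * eps j w) *
    (eta i' w k ord0 * eta j' w l ord0)))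
    (b * ((if i == j then ve else 0) * (if i' == j' then V k l else 0))).
Proof.
move=> mf fb; apply: has_integral_indep3 => //; apply: (independent_seq3_indep3 errors_indep) => //.
  by apply: measurable_funM; exact: sigma_of_seq_measurable.
by apply: measurable_funM;
  apply: (measurableT_comp (measurable_entry (T := R) _ _)); exact: sigma_of_seq_measurable.
Qed.

Lemma sigma_eta_tight n M : (0 < n)%N -> 0 < M ->
  within_prob P
    [set w | n%:R * M <= \sum_k bilin (Sig n w) (col k (E n w)) (col k (E n w))]
    ((v + tau2) * \tr V / M).
Proof.
move=> n0 M0; have N0 : 0 < n%:R :> R by rewrite ltr0n.
have -> : (v + tau2) * \tr V / M =
    (\sum_k \sum_(i < n) (v + tau2) * V k k) / (n%:R * M).
  under eq_bigr do rewrite sumr_const card_ord -mulr_natl mulrCA.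
  rewrite -mulr_sumr -mulr_sumr /mxtrace; field.
  by rewrite !gt_eqF.
apply: markov_within; first by rewrite mulr_gt0.
  by move=> w; apply: sumr_ge0 => k _; exact: (psd_reg (@Gr0 n w) tau2_gt0).
have Kb i j : exists b, has_integral P setT (fun w => K (S i w) (S j w)) b /\
    (i == j -> b = v).
  have [KC Kd [F mF KF] K0 _] := K_univ.
  have [||b Kb _] := dominated_has_integral measurableT _ _ (has_integral_cst P (2 * `|v|))
      (f := fun w => K (S i w) (S j w)).
  - by apply: measurable_S_fun; exact: measurable_K.
  - move=> w _.
    (* Positivity of the kernel on two points, with weights (1, 1) and (1, -1), bounds the
       off-diagonal value by the diagonal one. *)
    pose s (m : 'I_2) := if m == ord0 then S i w else S j w.
    pose a1 (m : 'I_2) := 1 : R.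
    pose a2 (m : 'I_2) := if m == ord0 then 1 else -1 : R.
    have := K0 2%N s a1; have := K0 2%N s a2.
    rewrite /kquad !big_ord_recl !big_ord0 /s /a1 /a2 /= !Kd (KC (S j w) (S i w)).
    have := ler_norm v; move: (K _ _) => z h1 h2 h3.
    by rewrite ler_norml; apply/andP; split; lra.
  exists b; split => // /eqP ij; apply: (has_integral_uniq Kb).
  by rewrite ij; apply: has_integral_eq (has_integral_cst P v) => // w _; rewrite Kd.
have term (k : 'I_p) (i j : 'I_n) : has_integral P setT
    (fun w => eta i w k ord0 * eta j w k ord0 * Sig n w i j)
    (if i == j then (v + tau2) * V k k else 0).
  have [b [Kb' bv]] := Kb i j.
  have Sb : has_integral P setT (fun w => Sig n w i j)
      (b + (if i == j then tau2 else 0)).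
    under eq_fun do rewrite Sig_entry.
    by apply: has_integralD => //; exact: has_integral_cst.
  (* The outcome errors are absent from this term, so the constant 1 fills their slot. *)
  have indep : indep3 P (fun w => Sig n w i j) (fun=> 1)
      (fun w => eta i w k ord0 * eta j w k ord0).
    apply: (independent_seq3_indep3 errors_indep (measurable_Sig i j)) => //.
    by apply: measurable_funM;
      apply: (measurableT_comp (measurable_entry (T := R) _ _)); exact: sigma_of_seq_measurable.
  have := has_integral_indep3 indep Sb (has_integral_cst P 1) (eta_moments i j k k).
  rewrite mul1r (_ : _ * (if _ then _ else _) = if i == j then (v + tau2) * V k k else 0).
    by apply: has_integral_eq => // w _; rewrite mul1r mulrC.
  rewrite -val_eqE/=; case: eqP => [/eqP ij|_]; last by rewrite mulr0.
  by rewrite bv// -?val_eqE//.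
have := has_integral_sum measurableT (index_enum 'I_p) (Q := xpredT)
  (fun k _ => has_integral_sum measurableT (index_enum 'I_n) (Q := xpredT)
  (fun i _ => has_integral_sum measurableT (index_enum 'I_n) (Q := xpredT)
  (fun j _ => term k i j))).
rewrite (_ : \sum_k \sum_i \sum_(j < n) _ = \sum_k \sum_(i < n) (v + tau2) * V k k).
  apply: has_integral_eq => // w _; apply: eq_bigr => k _; rewrite bilinE.
  by apply: eq_bigr => i _; apply: eq_bigr => j _; rewrite !colE.
apply: eq_bigr => k _; apply: eq_bigr => i _.
rewrite (bigD1 i)//= eqxx big1 ?addr0// => j ji.
by rewrite eq_sym (negbTE ji).
Qed.

Lemma cross_term_small n rho k : (0 < n)%N -> 0 < rho ->
  within_prob P [set w | rho * n%:R <= `|bilin (Q n w) (col k (E n w)) (ep n w)|]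
    (V k k * ve / tau2 ^+ 2 / rho ^+ 2 / n%:R).
Proof.
move=> n0 rho0; have N0 : 0 < n%:R :> R by rewrite ltr0n.
(* Indexed by pairs, the summands are orthogonal: distinct pairs differ in a coordinate, where a
   mixed moment of [eta] or [eps] vanishes. *)
pose Z (ij : 'I_n * 'I_n) w := Q n w ij.1 ij.2 * (eta ij.1 w k ord0 * eps ij.2 w).
have QF w : \sum_i \sum_j Q n w i j ^+ 2 <= n%:R / tau2 ^+ 2.
  exact: (reg_inv_frobenius (@GrT n w) (@Gr0 n w) tau2_gt0).
have Qle w i j : Q n w i j ^+ 2 <= n%:R / tau2 ^+ 2.
  apply: le_trans (QF w); rewrite (bigD1 i)//= (bigD1 j)//= -addrA lerDl.
  rewrite addr_ge0//; first by apply: sumr_ge0 => ? _; exact: sqr_ge0.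
  by do 2 (apply: sumr_ge0 => ? _); exact: sqr_ge0.
have QQ (a b : 'I_n * 'I_n) : exists q,
    has_integral P setT (fun w => Q n w a.1 a.2 * Q n w b.1 b.2) q.
  have [||q Hq _] := dominated_has_integral measurableT _ _
    (has_integral_cst P (n%:R / tau2 ^+ 2)) (f := fun w => Q n w a.1 a.2 * Q n w b.1 b.2).
  - by apply: measurable_S_fun; apply: measurable_funM; exact: measurable_Q.
  - move=> w _; have := Qle w a.1 a.2; have := Qle w b.1 b.2; rewrite normrM.
    move: (n%:R / _) (Q n w a.1 a.2) (Q n w b.1 b.2) => z x y hx hy.
    have := sqr_ge0 (`|x| - `|y|); rewrite sqrrB !real_normK ?num_real//.
    by lra.
  by exists q.
have [q qE] : exists q : 'I_n * 'I_n -> 'I_n * 'I_n -> R, forall a b,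
    has_integral P setT (fun w => Q n w a.1 a.2 * Q n w b.1 b.2) (q a b).
  exists (fun a b => sval (cid (QQ a b))) => a b.
  exact: (svalP (cid (QQ a b))).
pose c a b := q a b * ((if a.2 == b.2 then ve else 0) * (if a.1 == b.1 then V k k else 0)).
have Zc a b : has_integral P setT (fun w => Z a w * Z b w) (c a b).
  have mQQ : measurable_fun (setT : set TS) (fun w => Q n w a.1 a.2 * Q n w b.1 b.2).
    by apply: measurable_funM; exact: measurable_Q.
  apply: has_integral_eq (has_integral_errors a.2 b.2 a.1 b.1 k k mQQ (qE a b)) => // w _.
  by rewrite /Z; ring.
have c0 a b : a != b -> c a b = 0.
  rewrite /c; case: a b => [i j] [i' j'] /=.
  have [->|_] := eqVneq j j'; last by rewrite mul0r mulr0.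
  have [->|_] := eqVneq i i'; last by rewrite !mulr0.
  by rewrite eqxx.
have csum : \sum_a c a a <= V k k * ve * (n%:R / tau2 ^+ 2).
  have -> : \sum_a c a a = V k k * ve * \sum_a q a a.
    by rewrite mulr_sumr; apply: eq_bigr => a _; rewrite /c !eqxx; ring.
  rewrite ler_wpM2l ?mulr_ge0//.
  apply: has_integral_le (has_integral_sum measurableT (index_enum _) (Q := xpredT)
    (fun a _ => qE a a)) (has_integral_cst P (n%:R / tau2 ^+ 2)) => // w _ /=.
  apply: le_trans (QF w); rewrite pair_bigA/= le_eqVlt; apply/orP; left; apply/eqP.
  by apply: eq_bigr => -[i j] _; rewrite expr2.
have t0 : 0 < rho * n%:R by rewrite mulr_gt0.
have := chebyshev_within t0 Zc c0 csum.
have -> : V k k * ve * (n%:R / tau2 ^+ 2) / (rho * n%:R) ^+ 2 =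
    V k k * ve / tau2 ^+ 2 / rho ^+ 2 / n%:R by field; rewrite !gt_eqF.
apply: within_probS => w /=; rewrite bilinE pair_bigA/=.
set A := \sum_(_ | _) _; set B := \sum_(_ | _) _.
suff -> : A = B by [].
by apply: eq_bigr => -[i j] _; rewrite colE epE /Z/=; ring.
Qed.

End gls_consistency.

(** * Coercivity of the empirical second moments by truncation *)

(** Dominated convergence in the truncation level. The bound holds for all later levels, so that one
    level can serve finitely many functions. *)
Lemma truncation_approx {d} {T : measurableType d} {R : realType}
    (mu : {measure set T -> \bar R}) (f b : T -> R) (m a : R) :
  measurable_fun setT b -> has_integral mu setT f m -> 0 < a ->
  exists N0, forall N, (N0 <= N)%N -> exists2 m',
    has_integral mu setT (fun x => if b x <= N%:R then f x else 0) m' &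
    `|m' - m| <= a.
Proof.
move=> mb fm a0; have mf := has_integral_measurable fm.
pose fN (N : nat) x := if b x <= N%:R then f x else 0.
have fN_le N x : `|fN N x| <= `|f x|.
  by rewrite /fN; case: ifP => // _; rewrite normr0.
have mfN N : measurable_fun setT (fN N).
  by apply: measurable_fun_ifT => //; exact: measurable_fun_ler.
have fabs : has_integral mu setT (fun x => `|f x|) (fine (\int[mu]_x `|f x|%:E)%E).
  by apply: integrable_has_integral => //; exact: integrable_abse fm.1.
have fNi N : exists m', has_integral mu setT (fN N) m'.
  by have [||m' ? _] := dominated_has_integral measurableT _ _ fabs (f := fN N);
    [exact: mfN|move=> x _; exact: fN_le|exists m'].
have mE N : has_integral mu setT (fN N) (sval (cid (fNi N))) by exact: svalP (cid (fNi N)).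
have /fine_cvg : (\int[mu]_x (fN N x)%:E @[N --> \oo] --> m%:E)%E.
  rewrite -fm.2.
  apply: (@dominated_cvg _ _ _ mu setT measurableT (fun N x => (fN N x)%:E)
    (EFin \o f) (fun x => `|f x|%:E)) => //.
  - by move=> N; exact/measurable_EFinP.
  - move=> x _; apply: cvg_EFin; first by apply: nearW => N.
    apply: cvg_near_cst; near=> N; rewrite /= /fN ifT//.
    by near: N; exact: nbhs_infty_ger.
  - exact: integrable_abse fm.1.
  - by move=> N x _ /=; rewrite lee_fin.
move=> /cvgrPdist_le/(_ a a0)[N0 _ N0P]; exists N0 => N N0N.
exists (sval (cid (fNi N))); first exact: mE.
have := N0P N N0N; rewrite /= (mE N).2 /= distrC.
exact.
Unshelve. all: by end_near. Qed.

Lemma truncation_approx_fin {d} {T : measurableType d} {R : realType}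
    (mu : {measure set T -> \bar R}) (I : finType) (f : I -> T -> R) (b : T -> R)
    (m : I -> R) (a : R) :
  measurable_fun setT b -> (forall i, has_integral mu setT (f i) (m i)) -> 0 < a ->
  exists (N : nat) (m' : I -> R), forall i,
    has_integral mu setT (fun x => if b x <= N%:R then f i x else 0) (m' i) /\
    `|m' i - m i| <= a.
Proof.
move=> mb fm a0.
have [N0 N0P] := choice (fun i => truncation_approx mb (fm i) a0).
exists (\max_i N0 i).
have /choice[m' m'P] i : exists m',
    has_integral mu setT (fun x => if b x <= (\max_i N0 i)%:R then f i x else 0) m' /\
    `|m' - m i| <= a.
  by have [|m' ? ?] := N0P i (\max_i N0 i); [exact: leq_bigmax|exists m'].
by exists m'.
Qed.

Section covariance_coercive.
Context {R : realType} {dO : measure_display} {Omega : measurableType dO}.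
Context (P : probability Omega R) (p : nat) (eta : nat -> {RV P >-> 'cV[R]_p}).
Hypothesis eta_iid : iid eta.
Variable V : 'M[R]_p.
Hypothesis eta_moments : forall k l,
  has_integral P setT (fun w => eta 0%N w k ord0 * eta 0%N w l ord0) (V k l).

Let b (x : 'cV[R]_p) := \sum_k x k ord0 ^+ 2.

Let mb : measurable_fun setT b.
Proof.
by apply: measurable_sum => k; apply: measurable_funX; exact: measurable_entry.
Qed.

Let truncated_le (N : nat) (x : 'cV[R]_p) k l :
  `|if b x <= N%:R then x k ord0 * x l ord0 else 0| <= N%:R.
Proof.
case: ifP => [bN|_]; last by rewrite normr0.
have sq_le j : `|x j ord0| ^+ 2 <= b x.
  rewrite real_normK ?num_real// /b (bigD1 j)//= lerDl.
  by apply: sumr_ge0 => i _; exact: sqr_ge0.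
apply: le_trans bN; have := sq_le k; have := sq_le l; rewrite normrM.
have := sqr_ge0 (`|x k ord0| - `|x l ord0|); rewrite sqrrB.
by lra.
Qed.

(* Only second moments of [eta] are available, so the law of large numbers for
   [eta_k eta_l] goes through a truncation on [|eta|^2 <= N]; truncating
   decreases the quadratic form. *)
Lemma covariance_coercive (c : R) : 0 < c ->
  (forall u, c * bilin 1%:M u u <= bilin V u u) ->
  exists2 C : R, 0 <= C & forall n, (0 < n)%N ->
    let E w := design_mx n (eta ^~ w) in
    within_prob P [set w | ~ forall u,
      c / 2 * n%:R * bilin 1%:M u u <= bilin 1%:M (E w *m u) (E w *m u)]
      (C / n%:R).
Proof.
(* Each of the [p^2] entries may be off by [2 a n]; the choice [a = c / (4 q)] keeps the total under
   [c n / 2]. The added 1 covers [p = 0]. *)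
move=> c0 cV; pose q : R := p%:R ^+ 2 + 1.
have q0 : 0 < q by rewrite ltr_wpDl ?exprn_ge0.
pose a := c / (4 * q); have a0 : 0 < a by rewrite divr_gt0 ?mulr_gt0.
have [N [m mP]] := truncation_approx_fin (mu := P) (measurableT_comp mb (measurable_funPT (eta 0%N)))
  (fun kl : 'I_p * 'I_p => eta_moments kl.1 kl.2) a0.
pose phi (kl : 'I_p * 'I_p) (x : 'cV[R]_p) :=
  if b x <= N%:R then x kl.1 ord0 * x kl.2 ord0 else 0.
have mphi kl : measurable_fun setT (phi kl).
  apply: measurable_fun_ifT => //; first exact: measurable_fun_ler.
  by apply: measurable_funM; exact: measurable_entry.
pose f kl x := phi kl x - m kl.
have mf kl : measurable_fun setT (f kl) by exact: measurable_funB.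
have f0 kl : has_integral P setT (fun w => f kl (eta 0%N w)) 0.
  have := has_integralD measurableT (mP kl).1 (has_integral_cst P (- m kl)).
  by rewrite subrr.
have m_le kl : `|m kl| <= N%:R.
  have := has_integral_cst P (N%:R : R); have := (mP kl).1 => h1 h2.
  have [||m' h3 h4] := dominated_has_integral measurableT _ _ h2
    (f := fun w => phi kl (eta 0%N w)).
  - exact: has_integral_measurable h1.
  - by move=> w _; exact: truncated_le.
  - by rewrite (has_integral_uniq h1 h3).
have f_le kl x : `|f kl x| <= 2 * N%:R.
  rewrite mulr_natl mulr2n (le_trans (ler_normB _ _))// lerD//.
  exact: truncated_le.
have ff kl : exists2 s, has_integral P setT
    (fun w => f kl (eta 0%N w) * f kl (eta 0%N w)) s & s <= 4 * N%:R ^+ 2.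
  have [||s sP s_le] := dominated_has_integral measurableT _ _
    (has_integral_cst P ((2 * N%:R) ^+ 2))
    (f := fun w => f kl (eta 0%N w) * f kl (eta 0%N w)).
  - by apply: measurable_funM; exact: measurableT_comp.
  - by move=> w _; rewrite normrM expr2 ler_pM.
  - exists s => //; apply: le_trans (ler_norm _) (le_trans s_le _).
    by rewrite le_eqVlt; apply/orP; left; apply/eqP; ring.
exists (#|{: 'I_p * 'I_p}|%:R * (4 * N%:R ^+ 2 / a ^+ 2)).
  by apply: mulr_ge0 => //; rewrite divr_ge0 ?sqr_ge0// mulr_ge0 ?sqr_ge0.
move=> n n0 E; have N0 : 0 < n%:R :> R by rewrite ltr0n.
rewrite -[X in within_prob _ _ X]mulrA.
suff /within_prob_bigcup : forall kl : 'I_p * 'I_p,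
    within_prob P [set w | a * n%:R <= `|\sum_(i < n) f kl (eta i w)|]
      (4 * N%:R ^+ 2 / a ^+ 2 / n%:R).
  apply: within_probS => w /= bad; apply: contrapT => good; apply: bad => u.
  have {}good kl : `|\sum_(i < n) f kl (eta i w)| <= a * n%:R.
    by rewrite leNgt; apply/negP => h; apply: good; exists kl; exact: ltW.
  have -> : bilin 1%:M (E w *m u) (E w *m u) =
      \sum_(i < n) (\sum_k eta i w k ord0 * u k ord0) ^+ 2.
    rewrite bilin1E; apply: eq_bigr => i _; rewrite expr2.
    suff -> : (E w *m u) i ord0 = \sum_k eta i w k ord0 * u k ord0 by [].
    by rewrite mxE; apply: eq_bigr => k _; rewrite mxE.
  have lower : \sum_kl u kl.1 ord0 * u kl.2 ord0 * \sum_(i < n) phi kl (eta i w) <=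
      \sum_(i < n) (\sum_k eta i w k ord0 * u k ord0) ^+ 2.
    under eq_bigr do rewrite mulr_sumr.
    rewrite exchange_big; apply: ler_sum => i _.
    have [bN|bN] := boolP (b (eta i w) <= N%:R); last first.
      by rewrite big1 ?sqr_ge0// => kl _; rewrite /phi (negbTE bN) mulr0.
    under eq_bigr do rewrite /phi bN.
    rewrite expr2 mulr_suml le_eqVlt; apply/orP; left; apply/eqP.
    under [RHS]eq_bigr do rewrite mulr_sumr.
    by rewrite pair_bigA; apply: eq_bigr => kl _ /=; ring.
  apply: le_trans lower.
  have uu kl : `|u kl.1 ord0 * u kl.2 ord0| <= bilin 1%:M u u.
    have sq_le j : `|u j ord0| ^+ 2 <= bilin 1%:M u u.
      rewrite real_normK ?num_real// bilin1E (bigD1 j)//= expr2 lerDl.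
      by apply: sumr_ge0 => i _; rewrite -expr2 sqr_ge0.
    have := sq_le kl.1; have := sq_le kl.2; rewrite normrM.
    have := sqr_ge0 (`|u kl.1 ord0| - `|u kl.2 ord0|); rewrite sqrrB.
    by lra.
  (* One [a n] is the truncation bias, the other the fluctuation of the truncated sum on the good
     event. *)
  have kl_le kl : u kl.1 ord0 * u kl.2 ord0 * (n%:R * V kl.1 kl.2) - bilin 1%:M u u * (2 * a * n%:R)
      <= u kl.1 ord0 * u kl.2 ord0 * \sum_(i < n) phi kl (eta i w).
    rewrite lerBlDr -lerBlDl -mulrBr (le_trans (ler_norm _))// normrM.
    rewrite ler_pM ?normr_ge0 ?uu//.
    have := good kl; rewrite /f sumrB sumr_const card_ord -[_ *+ n]mulr_natl.
    have := (mP kl).2; rewrite -[_ <= a](ler_pM2l N0) -[X in X * `|_|](ger0_norm (ltW N0)) -normrM mulrBr.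
    by move: (\sum_(_ | _) _) (n%:R * m kl) (n%:R * V _ _) => x y z; rewrite !ler_norml => /andP[? ?] /andP[? ?]; apply/andP; split; lra.
  apply: le_trans (ler_sum _ (fun kl _ => kl_le kl)).
  rewrite sumrB sumr_const card_prod card_ord -[X in _ <= _ - X]mulr_natl.
  have -> : \sum_kl u kl.1 ord0 * u kl.2 ord0 * (n%:R * V kl.1 kl.2) = n%:R * bilin V u u.
    rewrite bilinE pair_bigA mulr_sumr; apply: eq_bigr => kl _ /=; ring.
  have := cV u; rewrite -(ler_pM2l N0).
  have b0 := psd1 u; rewrite natrM -expr2.
  have : 2 * a * (p%:R ^+ 2) <= c / 2.
    rewrite (_ : c / 2 = 2 * a * q); last by rewrite /a; field; rewrite gt_eqF.
    by apply: ler_wpM2l; [rewrite mulr_ge0// ltW|rewrite /q lerDl].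
  move=> /(ler_wpM2r (mulr_ge0 (ltW N0) b0)); move: (bilin 1%:M u u) => B.
  by move: (bilin V u u) => W; lra.
move=> kl; have [s sP s_le] := ff kl.
pose cc (i j : 'I_n) := if i == j then s else 0.
have Zc (i j : 'I_n) : has_integral P setT (fun w => f kl (eta i w) * f kl (eta j w)) (cc i j).
  exact: (iid_white_noise eta_iid (mf kl) (mf kl) (f0 kl) (f0 kl) sP).
have csum : \sum_(i < n) cc i i <= n%:R * (4 * N%:R ^+ 2).
  under eq_bigr do rewrite /cc eqxx.
  by rewrite sumr_const card_ord -[X in X <= _]mulr_natl ler_pM2l.
have -> : 4 * N%:R ^+ 2 / a ^+ 2 / n%:R = n%:R * (4 * N%:R ^+ 2) / (a * n%:R) ^+ 2.
  by field; rewrite !gt_eqF.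
apply: (chebyshev_within (mulr_gt0 a0 N0) Zc _ csum) => i j ij.
by rewrite /cc (negbTE ij).
Qed.

End covariance_coercive.

(** * Consistency of the estimator *)

Lemma measurable_enorm_gt {d} {T : measurableType d} {R : realType} p
    (B : T -> 'cV[R]_p) v e : measurable_fun setT B ->
  measurable [set w | e < enorm (B w - v)].
Proof.
move=> /measurable_fun_matrixP mB.
have menorm : measurable_fun setT (fun w => enorm (B w - v)).
  apply: (measurableT_comp (continuous_measurable_fun (@sqrt_continuous R))).
  apply: measurable_sum => i; apply: measurable_sum => j; apply: measurable_funX.
  rewrite (_ : (fun w => _) = fun w => B w i j - v i j).
    by apply: measurable_funB => //; exact: mB.
  by apply/funext => w; rewrite !mxE.
rewrite -[X in measurable X]setTI.
have -> : [set w | e < enorm (B w - v)] = (fun w => enorm (B w - v)) @^-1` `]e, +oo[.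
  by apply/seteqP; split => w /=; rewrite in_itv/= andbT.
by apply: menorm => //; exact: measurable_itv.
Qed.

Lemma continuous_entry {R : realType} d p (D : set 'rV[R]_d)
    (h : 'rV[R]_d -> 'cV[R]_p) k :
  {within D, continuous h} -> {within D, continuous (fun s => h s k ord0)}.
Proof.
move=> ch s; apply: (@continuous_comp _ _ _ (h : subspace D -> 'cV[R]_p)
  (fun x : 'cV[R]_p => x k ord0) s (ch s)).
exact: coord_continuous.
Qed.

Unset Implicit Arguments.
Set Strict Implicit.
Set Printing Implicit Defensive.

Theorem theorem1 (R : realType) (dO : measure_display)
    (Omega : measurableType dO) (P : probability Omega R) (d p : nat)
    (* spatial domain and sampling density *)
    (D : set 'rV[R]_d) (D_convex : convex_set D) (D_compact : compact D)
    (f_s : 'rV[R]_d -> R) (f_s_density : is_density f_s)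
    (f_s_support : closure [set s | f_s s != 0] = D)
    (* locations *)
    (S : nat -> {RV P >-> 'rV[R]_d})
    (S_in : forall i w, D (S i w))
    (S_iid : iid S)
    (S_law : forall i, has_density (S i) f_s)
    (* outcome errors: eps i stands for epsilon(S_i) *)
    (eps : nat -> {RV P >-> R})
    (eps_iid : iid eps)
    (eps_mean : forall i, ('E_P[eps i] = 0)%E)
    (eps_var : forall i, ('V_P[eps i] < +oo)%E)
    (* exposure errors: eta i stands for eta(S_i) *)
    (eta : nat -> {RV P >-> 'cV[R]_p})
    (eta_iid : iid eta)
    (eta_mean : forall i k, ('E_P[(fun w => eta i w k ord0)%R] = 0)%E)
    (eta_cov_fin : forall i k l,
       covariance P (fun w => eta i w k ord0) (fun w => eta i w l ord0)
         \is a fin_num)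
    (eta_cov_posdef : forall i, posdef (covmx P (eta i)))
    (errors_indep : independent_seq3 P S eps eta)
    (* exposures and outcomes *)
    (h : 'rV[R]_d -> 'cV[R]_p) (h_cont : {within D, continuous h})
    (g : 'rV[R]_d -> R) (g_cont : {within D, continuous g})
    (beta : 'cV[R]_p)
    (X : nat -> Omega -> 'cV[R]_p)
    (X_def : forall i w, X i w = h (S i w) + eta i w)
    (Y : nat -> Omega -> R)
    (Y_def : forall i w,
       Y i w = ((X i w)^T *m beta) ord0 ord0 + g (S i w) + eps i w)
    (* working covariance *)
    (sigma2 phi tau2 : R) (nu : \bar R)
    (sigma2_gt0 : 0 < sigma2) (phi_gt0 : 0 < phi) (tau2_gt0 : 0 < tau2)
    (nu_gt0 : (0 < nu)%E)
    (* GLS estimator, arbitrary where X^T Sigma^-1 X is singular *)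
    (betahat : nat -> {RV P >-> 'cV[R]_p})
    (betahat_gls : forall n w,
       let Xn := design_mx n (X ^~ w) in
       let Yn := response n (Y ^~ w) in
       let Sigma := working_cov n (matern sigma2 phi nu) tau2 (S ^~ w) in
       Xn^T *m invmx Sigma *m Xn \in unitmx ->
       betahat n w = gls Xn Sigma Yn) :
  cvg_in_probability P betahat beta.
Proof.
have K_univ := matern_universal D_compact sigma2_gt0 phi_gt0 nu_gt0.
(* From here on the kernel is known only through [universal_kernel]. *)
move: (matern _ _ _) K_univ betahat_gls => K K_univ betahat_gls.
pose ve := fine (covariance P (eps 0%N) (eps 0%N)); pose V := covmx P (eta 0%N).
have eps_var_fin : covariance P (eps 0%N) (eps 0%N) \is a fin_num.
  by rewrite ge0_fin_numE; [exact: eps_var|exact: variance_ge0].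
have mid : measurable_fun setT (@id R) by exact: measurable_id.
have [eps0 eps1] := centered_moments (measurable_funPT (eps 0%N))
  (measurable_funPT (eps 0%N)) (eps_mean 0%N) (eps_mean 0%N) eps_var_fin eps_var_fin.
have eps_moments := iid_white_noise eps_iid mid mid eps0 eps0 eps1.
have ment k : measurable_fun setT (fun x : 'cV[R]_p => x k ord0).
  exact: measurable_entry.
have eta_comp k : measurable_fun setT (fun w => eta 0%N w k ord0).
  by apply: (measurableT_comp (ment k)).
have eta0 k l := centered_moments (eta_comp k) (eta_comp l) (eta_mean 0%N k)
  (eta_mean 0%N l) (eta_cov_fin 0%N k k) (eta_cov_fin 0%N l l).
have eta_second k l : has_integral P setT
    (fun w => eta 0%N w k ord0 * eta 0%N w l ord0) (V k l).
  by rewrite mxE; exact: (eta0 k l).2.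
have eta_moments i j k l := iid_white_noise eta_iid (ment k) (ment l)
  (eta0 k k).1 (eta0 l l).1 (eta_second k l) i j.
have VT : V^T = V.
  by apply/matrixP => k l; rewrite !mxE covarianceC.
have [c c0 cV] := posdef_lower_bound VT (eta_cov_posdef 0%N).
have [C C0 coercive] := covariance_coercive eta_iid eta_second c0 cV.
have ve_ge0 : 0 <= ve.
  by rewrite fine_ge0//; exact: variance_ge0.
have V_ge0 k : 0 <= V k k.
  by apply: has_integral_ge0 (eta_second k k) => // w _; rewrite -expr2 sqr_ge0.
have trV_ge k : V k k <= \tr V.
  by rewrite /mxtrace (bigD1 k)//= lerDl; apply: sumr_ge0.
have trV0 : 0 <= \tr V by exact: sumr_ge0.
move=> e e0.
suff bound r : 0 < r ->
    \forall n \near \oo, (P [set w | (e < enorm (betahat n w - beta))%R] <= r%:E)%E.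
  have mA n : measurable [set w | e < enorm (betahat n w - beta)].
    by apply: measurable_enorm_gt; exact: measurable_funPT.
  apply: cvg_EFin; first by apply: nearW => n; exact: fin_num_measure.
  apply/cvgr0Pnorm_le => r r0; apply: filterS (bound r r0) => n Pn.
  by rewrite ger0_norm ?fine_ge0// -lee_fin fineK// fin_num_measure.
(* Three quarters of [r] go to the tightness events, which [M] controls; the last quarter is shared
   by coercivity and the cross terms, both of order [1 / n]. *)
move=> r0; pose s := r / 4; have s0 : 0 < s by rewrite divr_gt0.
(* The sum of the three Markov numerators, so that [W <= s M] serves all of them; the bounds with
   [M^2] also use [M >= 1]. *)
pose W := ve / tau2 + \tr V / tau2 + (sigma2 + tau2) * \tr V.
have W1 : 0 <= ve / tau2 by rewrite divr_ge0// ltW.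
have W2 : 0 <= \tr V / tau2 by rewrite divr_ge0// ltW.
have W3 : 0 <= (sigma2 + tau2) * \tr V by rewrite mulr_ge0// addr_ge0 ?ltW.
pose M := 1 + W / s.
have Ws0 : 0 <= W / s by apply: divr_ge0 (ltW s0); rewrite !addr_ge0.
have M1 : 1 <= M by rewrite lerDl.
have M0 : 0 < M := lt_le_trans ltr01 M1.
have WM : W <= s * M by rewrite /M mulrDr mulr1 mulrC divfK ?gt_eqF// lerDr ltW.
have MM : s * M <= s * M ^+ 2 by rewrite ler_pM2l// expr2 ler_peMl// ltW.
have [rho rho0 gls_error] := gls_error_bound p (divr_gt0 c0 (ltr0n _ 2)) M0 e0 tau2_gt0.
have rho2 := exprn_gt0 2 rho0.
have [Ng g_small] := smooth_part_negligible K_univ tau2_gt0 rho2 g_cont.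
have [Nh h_small] := choice (fun k => smooth_part_negligible K_univ tau2_gt0 rho2
  (@continuous_entry _ _ _ _ _ k h_cont)).
pose C' := \tr V * ve / tau2 ^+ 2 / rho ^+ 2.
near=> n.
have n0 : (0 < n)%N by near: n; exact: nbhs_infty_gt.
have n0' : 0 < n%:R :> R by rewrite ltr0n.
have nNg : (Ng <= n)%N by near: n; exact: nbhs_infty_ge.
have nNh : (\max_k Nh k <= n)%N by near: n; exact: nbhs_infty_ge.
have nC : (C + p%:R * C') / s <= n%:R by near: n; exact: nbhs_infty_ger.
apply: within_prob_measure.
  by apply: measurable_enorm_gt; exact: measurable_funPT.
have M2 : 0 < tau2 * M ^+ 2 by rewrite mulr_gt0 ?exprn_gt0.
have small1 : ve / (tau2 * M ^+ 2) <= s.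
  rewrite ler_pdivrMr// mulrCA -ler_pdivrMl// mulrC (le_trans _ MM)// (le_trans _ WM)//.
  by rewrite /W -addrA lerDl addr_ge0.
have small2 : \tr V / (tau2 * M ^+ 2) <= s.
  rewrite ler_pdivrMr// mulrCA -ler_pdivrMl// mulrC (le_trans _ MM)// (le_trans _ WM)//.
  by rewrite /W addrAC lerDr addr_ge0.
have small3 : (sigma2 + tau2) * \tr V / M <= s.
  by rewrite ler_pdivrMr// (le_trans _ WM)// /W lerDr addr_ge0.
have cross k : within_prob P
    [set w | rho * n%:R <= `|bilin (invmx (working_cov n K tau2 (S ^~ w)))
      (col k (design_mx n (eta ^~ w))) (response n (eps ^~ w))|] (C' / n%:R).
  apply: within_prob_le (cross_term_small errors_indep eps_moments eta_moments
    K_univ tau2_gt0 k n0 rho0).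
  by rewrite 3?ler_pM2r ?invr_gt0 ?exprn_gt0// ler_wpM2r.
have := within_probU (within_probU (within_probU (within_probU
  (within_prob_le small1 (eps_tight eps_moments n0 M2))
  (within_prob_le small2 (eta_tight eta_moments n0 M2)))
  (within_prob_le small3 (sigma_eta_tight errors_indep eta_moments K_univ tau2_gt0 n0 M0)))
  (coercive n n0)) (within_prob_bigcup cross).
rewrite card_ord => bad.
have /within_prob_le : s + s + s + C / n%:R + p%:R * (C' / n%:R) <= r.
  have : C / n%:R + p%:R * (C' / n%:R) <= s.
    by rewrite mulrA -mulrDl ler_pdivrMr// [s * _]mulrC -ler_pdivrMr.
  by rewrite /s; lra.
(* Outside the union of the bad events the deterministic bound applies at [w]. *)
apply; apply: within_probS bad => w /=; apply: contraPP.
move=> /not_orP[/not_orP[/not_orP[/not_orP[e1 e2] e3] e4] e5].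
apply/negP; rewrite -leNgt.
have [GT G0] := universal_kernel_gram n (S ^~ w) K_univ.
pose H : 'M[R]_(n, p) := design_mx n (fun i => h (S i w)).
have XE : design_mx n (X ^~ w) = H + design_mx n (eta ^~ w).
  by apply/matrixP => i j; rewrite !mxE X_def mxE.
have YE : response n (Y ^~ w) = design_mx n (X ^~ w) *m beta +
    \col_(i < n) g (S i w) + response n (eps ^~ w).
  apply/matrixP => i j; rewrite ord1 !mxE Y_def; congr (_ + _ + _).
  by rewrite mxE; apply: eq_bigr => k _; rewrite !mxE.
have colH k : col k H = \col_(i < n) h (S i w) k ord0.
  by apply/matrixP => i j; rewrite !mxE.
have [|||||||] := gls_error n _ H (design_mx n (eta ^~ w)) (\col_(i < n) g (S i w))
  (response n (eps ^~ w)) beta n0 GT G0.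
- move=> k; rewrite colH; apply: (h_small k n (S ^~ w)) => //.
  by apply: leq_trans nNh; exact: leq_bigmax.
- exact: (g_small n (S ^~ w)).
- have /negP := e1; rewrite -ltNge => /ltW /le_trans; apply.
  by rewrite mulrA mulrC.
- move=> k; have /negP := e2; rewrite -ltNge => /ltW.
  rewrite mulrA mulrC; apply: le_trans; rewrite (bigD1 k)//= lerDl.
  by apply: sumr_ge0 => j _; exact: psd1.
- by have /negP := e3; rewrite -ltNge mulrC => /ltW.
- exact: contrapT e4.
- move=> k; rewrite leNgt; apply/negP => /ltW bad_k; apply: e5; by exists k.
(* On the good event [X^T Q X] is invertible, so the arbitrary value of the estimator is never
   met. *)
rewrite -XE -YE => Xunit; rewrite betahat_gls.
Unshelve. all: by end_near. Qed.
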